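(* Let $k \in \mathbb{N}$ and let $(f_j)_{j \in \mathbb{N}}$ be a sequence of functions in $S^{2^k}$ that satisfy the separation condition uniformly with separation constant $\alpha > 0$ (that is, for every $j$, consecutive Fourier exponents of $f_j$ differ by more than $\alpha$, with the same $\alpha$ for all $j$). Then, for each choice of sign $\pm$, $$\Big\| \Big( \sum_{j \in \mathbb{N}} |H_{\pm} f_j|^2 \Big)^{1/2} \Big\|_{S^{2^k}} \le C \, \Big\| \Big( \sum_{j \in \mathbb{N}} |f_j|^2 \Big)^{1/2} \Big\|_{S^{2^k}},$$ where the constant $C$ depends only on $\alpha$ and $k$ (and not on the sequence $(f_j)$).
   Context: $\mathbb{N} = \{1,2,3,\dots\}$. $\mathcal{P}$ is the space of trigonometric polynomials on $\mathbb{R}$, i.e. finite sums $\sum_{n=-N}^{N} c_n e^{i\lambda_n \cdot}$ with $c_n \in \mathbb{C}$, $\lambda_n \in \mathbb{R}$. For $p \in [1,\infty)$ and a measurable function $f$ on $\mathbb{R}$, the Stepanov norm is $$\|f\|_{S^p} := \Big( \sup_{x \in \mathbb{R}} \int_x^{x+1} |f(s)|^p \, ds \Big)^{1/p}$$ (possibly $+\infty$), and the Stepanov space $S^p$ is the completion of $\mathcal{P}$ with respect to this norm (a space of functions in $L^p_{\mathrm{loc}}(\mathbb{R})$, identified up to a.e. equality). For $f \in S^p$ and $\lambda \in \mathbb{R}$, the Fourier coefficient is $\widehat{f}(\lambda) := \lim_{T \to \infty} \frac{1}{2T} \int_{-T}^{T} f(x) e^{-i\lambda x} \, dx$; it is non-zero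 for only countably many $\lambda$, and $f$ is determined by its Fourier coefficients. The Fourier exponents $(\lambda_n)$ of $f$ are the strictly increasing enumeration, with $\lambda_{-n} = -\lambda_n$ (so $\lambda_0=0$), of the symmetric set $\Lambda_f := \{0\} \cup \{\lambda \in \mathbb{R} : \widehat{f}(\lambda) \ne 0 \text{ or } \widehat{f}(-\lambda) \neq 0\}$ (a finite enumeration if $\Lambda_f$ is finite). The function $f$ satisfies the separation condition with separation constant $\alpha>0$ if $\lambda_{n+1} - \lambda_n > \alpha$ for all consecutive exponents. The modified Hilbert transforms $H_{\pm}$ are the operators such that $H_\pm f$ is the almost periodic function with Fourier coefficients $$\widehat{H_{\pm} f}(\lambda) = -i \, \mathrm{sgn}_{\pm}(\lambda) \widehat{f}(\lambda) \quad \text{for all } \lambda \in \mathbb{R},$$ where $\mathrm{sgn}_{+}(x) = 1$ for $x \ge 0$ and $-1$ for $x < 0$, while $\mathrm{sgn}_{-}(x) = 1$ for $x > 0$ and $-1$ for $x \le 0$. *)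

(* Defs.v *)
From HB Require Import structures.
From mathcomp Require Import all_boot all_order all_algebra.
From mathcomp Require Import complex.
From mathcomp Require Import all_classical all_reals all_analysis.

Set Implicit Arguments.
Unset Strict Implicit.
Unset Printing Implicit Defensive.

Import Order.TTheory GRing.Theory Num.Theory.
Import numFieldNormedType.Exports.

Local Open Scope classical_set_scope.
Local Open Scope ring_scope.
Local Open Scope complex_scope.

Section ComplexValued.
Context {R : realType}.

Definition cexpi (t : R) : R[i] := cos t +i* sin t.

Definition cmodulus (z : R[i]) : R := Normc.normc z.

Definition cmeasurable (f : R -> R[i]) : Prop :=
  measurable_fun setT (fun x => complex.Re (f x)) /\
  measurable_fun setT (fun x => complex.Im (f x)).

Definition cintegral (D : set R) (f : R -> R[i]) : R[i] :=
  (\int[@lebesgue_measure R]_(x in D) complex.Re (f x)) +i*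
  (\int[@lebesgue_measure R]_(x in D) complex.Im (f x)).

Definition clim_pinfty (F : R -> R[i]) : R[i] :=
  lim (complex.Re (F T) @[T --> +oo]) +i* lim (complex.Im (F T) @[T --> +oo]).

End ComplexValued.

Section Stepanov.
Context {R : realType}.

(* The sequence [s] lists the pairs (coefficient, frequency). *)
Definition trig_poly (s : seq (R[i] * R)) (x : R) : R[i] :=
  \sum_(cl <- s) cl.1 * cexpi (cl.2 * x).

(* Stated for a nonnegative extended-real function, to be applied to moduli and
   to square functions; the latter may take the value +oo. *)
Definition stepanov_norm (p : R) (F : R -> \bar R) : \bar R :=
  ((ereal_sup (range (fun x : R =>
     \int[@lebesgue_measure R]_(s in `[x, (x + 1)%R]) (F s `^ p)))) `^ (p^-1)%R)%E.

Definition cstepanov_norm (p : R) (f : R -> R[i]) : \bar R :=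
  stepanov_norm p (fun s => (cmodulus (f s))%:E).

(* The completion of the trigonometric polynomials, realized as the closure of
   the trigonometric polynomials among measurable functions. Elements are
   functions, not classes modulo a.e. equality. *)
Definition stepanov_space (p : R) (f : R -> R[i]) : Prop :=
  cmeasurable f /\
  forall e : R, 0 < e -> exists s : seq (R[i] * R),
    (cstepanov_norm p (fun x => (f x - trig_poly s x)%R) < e%:E)%E.

Definition fourier_coef (f : R -> R[i]) (lambda : R) : R[i] :=
  clim_pinfty (fun T : R =>
    ((2 * T)^-1)%:C * cintegral `[- T, T] (fun x => f x * cexpi (- (lambda * x)))).

Definition fourier_spectrum (f : R -> R[i]) : set R :=
  [set 0] `|` [set lambda | fourier_coef f lambda <> 0 \/
                            fourier_coef f (- lambda) <> 0].

(* [Some N] indexes a finite enumeration by -N, ..., N; [None] an infinite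
   enumeration by all integers. *)
Definition exponent_index (o : option nat) : set int :=
  if o is Some N then [set n : int | `|n| <= N%:Z] else setT.

Definition fourier_exponents (f : R -> R[i]) (o : option nat) (lam : int -> R)
    : Prop :=
  [/\ forall m n, exponent_index o m -> exponent_index o n ->
        m < n -> lam m < lam n,
      forall n, exponent_index o n -> lam (- n) = - lam n
    & lam @` exponent_index o = fourier_spectrum f].

Definition separation_condition (alpha : R) (f : R -> R[i]) : Prop :=
  exists (o : option nat) (lam : int -> R), fourier_exponents f o lam /\
    forall n, exponent_index o n -> exponent_index o (n + 1) ->
      alpha < lam (n + 1) - lam n.

Variant hsign := Plus | Minus.

Definition msgn (s : hsign) (x : R) : R :=
  match s with
  | Plus => if 0 <= x then 1 else -1
  | Minus => if 0 < x then 1 else -1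
  end.

(* [g] is (a representative of) H_s f. Each S^p with p >= 1 embeds in S^1, the
   largest Stepanov space, whose elements are determined a.e. by their Fourier
   coefficients. *)
Definition is_modified_hilbert (s : hsign) (f g : R -> R[i]) : Prop :=
  stepanov_space 1 g /\
  forall lambda : R,
    fourier_coef g lambda = - 'i * (msgn s lambda)%:C * fourier_coef f lambda.

Definition square_function (f : nat -> R -> R[i]) (x : R) : \bar R :=
  ((\sum_(0 <= j <oo) ((cmodulus (f j x)) ^+ 2)%R%:E) `^ (2^-1)%R)%E.

End Stepanov.

(* Main.v *)
Require Import Defs.
From HB Require Import structures.
From mathcomp Require Import all_boot all_order all_algebra.
From mathcomp Require Import complex.
From mathcomp Require Import all_classical all_reals all_analysis.
From mathcomp Require Import measurable_realfun ring lra.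

(** Write f_j = A_j + B_j, where A_j carries the frequencies on which the modified
    sign is 1 and B_j those on which it is -1, so that H f_j = -i (A_j - B_j).  The
    modified sign puts the zero frequency into one of the two halves, hence the
    separation condition leaves a gap of length alpha between the spectra of A_j
    and B_j, and every frequency of G := - sum_j A_j conj(B_j) is at least alpha.

    With X := sum_j |H f_j|^2 and Y := sum_j |f_j|^2, polarization gives
    X = Y + 4 Re G, and the Cauchy-Schwarz inequality gives 4 (Im G)^2 <= X Y
    ([sum_sqr_polarization]).  Where X is much larger than Y, the number G is
    therefore nearly positive, and so is its power G^q with q := 2^(k-1); this
    yields the pointwise inequality X^q <= a Re (G^q) + C Y^q in the style of
    M. Riesz ([riesz_pointwise]).  The frequencies of G^q are again at least alpha,
    so the term Re (G^q) disappears after integration against the Fejer weight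
    (1 - cos (b x)) / (b x)^2 with b := min(alpha, 1), because the Fourier transform
    of that weight is supported in [-b, b] ([freq_ge_fejer_eq0]).  The weight is
    bounded below on the unit interval and decays integrably, so the weighted
    inequality turns into one between suprema of integrals over unit intervals
    ([riesz_trig_local]).  Here |H f_j| and |f_j| enter with the exponent
    2 q = 2^k.  This is the theorem for finitely many trigonometric polynomials
    whose frequencies vanish or are at least alpha in modulus
    ([hilbert_trig_bound]).

    A function f of the Stepanov space is approximated by trigonometric polynomials
    whose frequencies are Fourier exponents of f, and which consequently inherit the
    gap ([bochner_fejer]).  They are the means of f against translates of the kernel
    |sum_(m in S) e^(i m t)|^2 / |S|, where S is a finite set of frequencies almost
    invariant under translation by the frequencies of a given approximant of f
    ([folner]): the mean nearly reproduces that approximant, and Jensen's inequality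
    controls the mean of the remainder ([bf_poly_stepanov_bound]).  The same
    approximation shows that the Fourier coefficients determine the function
    ([stepanov_unique]), so H f_j is the limit in the norm of exponent 1 of the
    transforms of the approximants, along a subsequence whose increments are
    summable ([hilbert_limit], [hilbert_limit_unique]).  This limit also proves
    that H f_j exists.  Fatou's lemma transfers the bound to finitely many
    functions of the Stepanov space ([vector_hilbert_bound]), and monotone
    convergence handles the infinite square function. *)

Set Implicit Arguments.
Unset Strict Implicit.
Unset Printing Implicit Defensive.

Import Order.TTheory GRing.Theory Num.Theory.
Import numFieldNormedType.Exports.

Local Open Scope classical_set_scope.
Local Open Scope ring_scope.
Local Open Scope complex_scope.

(** * Complex moduli and trigonometric polynomials *)

Lemma cmodulus_ge0 (R : realType) (z : R[i]) : 0 <= cmodulus z.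
Proof. by case: z => a b; rewrite /cmodulus /= sqrtr_ge0. Qed.

Lemma sqr_cmodulus (R : realType) (z : R[i]) :
  cmodulus z ^+ 2 = complex.Re z ^+ 2 + complex.Im z ^+ 2.
Proof.
by case: z => a b; rewrite /cmodulus /= sqr_sqrtr // addr_ge0 // sqr_ge0.
Qed.

Lemma cmodulusM (R : realType) (z w : R[i]) :
  cmodulus (z * w) = cmodulus z * cmodulus w.
Proof. exact: Normc.normcM. Qed.

Lemma cmodulusX (R : realType) (z : R[i]) n : cmodulus (z ^+ n) = cmodulus z ^+ n.
Proof.
elim: n => [|n IH]; first by rewrite !expr0 /cmodulus /= expr0n addr0 expr1n sqrtr1.
by rewrite !exprS cmodulusM IH.
Qed.

Lemma cmodulusD (R : realType) (z w : R[i]) :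
  cmodulus (z + w) <= cmodulus z + cmodulus w.
Proof. exact: le_normcD. Qed.

Lemma cmodulusN (R : realType) (z : R[i]) : cmodulus (- z) = cmodulus z.
Proof. exact: normcN. Qed.

Lemma cmodulus0 (R : realType) : cmodulus (0 : R[i]) = 0.
Proof. exact: Normc.normc0. Qed.

Lemma cmodulus_real (R : realType) (x : R) : cmodulus x%:C = `|x|.
Proof. by rewrite /cmodulus /= expr0n addr0 sqrtr_sqr. Qed.

Lemma cmodulus_conj (R : realType) (z : R[i]) : cmodulus (z^*)%C = cmodulus z.
Proof. by case: z => a b; rewrite /cmodulus /= sqrrN. Qed.

Lemma cmodulus_i (R : realType) : cmodulus ('i : R[i]) = 1.
Proof. by rewrite /cmodulus /= expr0n add0r expr1n sqrtr1. Qed.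

Lemma normr_Re_le (R : realType) (z : R[i]) : `|complex.Re z| <= cmodulus z.
Proof.
case: z => a b; rewrite /cmodulus /= -sqrtr_sqr ler_sqrt ?addr_ge0 ?sqr_ge0 //.
by rewrite lerDl sqr_ge0.
Qed.

Lemma normr_Im_le (R : realType) (z : R[i]) : `|complex.Im z| <= cmodulus z.
Proof.
case: z => a b; rewrite /cmodulus /= -sqrtr_sqr ler_sqrt ?addr_ge0 ?sqr_ge0 //.
by rewrite lerDr sqr_ge0.
Qed.

Lemma cmodulus_le_ReIm (R : realType) (z : R[i]) :
  cmodulus z <= `|complex.Re z| + `|complex.Im z|.
Proof.
rewrite -(@ler_pXn2r _ 2) // ?nnegrE ?cmodulus_ge0 ?addr_ge0 ?normr_ge0 //.
rewrite sqr_cmodulus sqrrD !real_normK ?num_real //.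
by rewrite -addrA lerD2l addrC lerDl mulrn_wge0 // mulr_ge0.
Qed.

Lemma cmodulus_sum (R : realType) (I : Type) (r : seq I) (F : I -> R[i]) :
  cmodulus (\sum_(i <- r) F i) <= \sum_(i <- r) cmodulus (F i).
Proof.
elim: r => [|i r IH]; first by rewrite !big_nil cmodulus0.
by rewrite !big_cons (le_trans (cmodulusD _ _)) // lerD2l.
Qed.

Lemma Re_addc (R : realType) (z w : R[i]) :
  complex.Re (z + w) = complex.Re z + complex.Re w.
Proof. by case: z w => a b [c d]. Qed.

Lemma Im_addc (R : realType) (z w : R[i]) :
  complex.Im (z + w) = complex.Im z + complex.Im w.
Proof. by case: z w => a b [c d]. Qed.

Lemma Re_mulc (R : realType) (z w : R[i]) : complex.Re (z * w) =
  complex.Re z * complex.Re w - complex.Im z * complex.Im w.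
Proof. by case: z w => a b [c d]. Qed.

Lemma Im_mulc (R : realType) (z w : R[i]) : complex.Im (z * w) =
  complex.Re z * complex.Im w + complex.Im z * complex.Re w.
Proof. by case: z w => a b [c d]. Qed.

Lemma cexpiD (R : realType) (s t : R) : cexpi (s + t) = cexpi s * cexpi t.
Proof.
by apply/eqP; rewrite eq_complex /= cosD sinD eqxx /= [X in _ == X]addrC eqxx.
Qed.

Lemma cexpi0 (R : realType) : cexpi (0 : R) = 1.
Proof. by rewrite /cexpi cos0 sin0. Qed.

Lemma conj_cexpi (R : realType) (t : R) : ((cexpi t)^*)%C = cexpi (- t).
Proof. by rewrite /cexpi /= cosN sinN. Qed.

Lemma cmodulus_cexpi (R : realType) (t : R) : cmodulus (cexpi t) = 1.
Proof. by rewrite /cmodulus /= cos2Dsin2 sqrtr1. Qed.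

Lemma trig_poly_cat (R : realType) (s t : seq (R[i] * R)) x :
  trig_poly (s ++ t) x = trig_poly s x + trig_poly t x.
Proof. by rewrite /trig_poly big_cat. Qed.

Lemma trig_poly_cons (R : realType) (c : R[i] * R) s x :
  trig_poly (c :: s) x = c.1 * cexpi (c.2 * x) + trig_poly s x.
Proof. by rewrite /trig_poly big_cons. Qed.

Lemma trig_poly_nil (R : realType) (x : R) : trig_poly [::] x = 0.
Proof. by rewrite /trig_poly big_nil. Qed.

Lemma trig_poly_opp (R : realType) (s : seq (R[i] * R)) x :
  trig_poly [seq (- cl.1, cl.2) | cl <- s] x = - trig_poly s x.
Proof.
by rewrite /trig_poly big_map -sumrN; apply: eq_bigr => cl _ /=; rewrite mulNr.
Qed.

(** * The pointwise inequality *)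

(** Squaring a number of the right half plane at most quadruples the ratio
    |Im z| / Re z when this ratio is at most 1/4, because then
    Re (z^2) >= (Re z)^2 / 2.  The margin 4^m is thus consumed by the m successive
    squarings. *)
Lemma sector_pow (R : realType) (m : nat) (z : R[i]) :
  0 <= complex.Re z -> `|complex.Im z| * 4 ^+ m <= complex.Re z ->
  (complex.Re z / 2) ^+ (2 ^ m) <= complex.Re (z ^+ (2 ^ m)).
Proof.
elim: m z => [|m IH] z z0 hz; first by rewrite expn0 !expr1; lra.
have e4 : 1 <= 4 ^+ m :> R by apply: exprn_ege1; lra.
have hv : `|complex.Im z| * 4 <= complex.Re z.
  apply: le_trans hz; rewrite ler_wpM2l // exprS; lra.
have v2 : complex.Im z ^+ 2 * 16 <= complex.Re z ^+ 2.
  have := lerXn2r 2 _ _ hv; rewrite !nnegrE exprMn real_normK ?num_real // => H.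
  have -> : 16 = 4 ^+ 2 :> R by ring.
  by apply: H => //; rewrite mulr_ge0.
have rz : complex.Re (z ^+ 2) = complex.Re z ^+ 2 - complex.Im z ^+ 2.
  by rewrite expr2 Re_mulc -!expr2.
have iz : complex.Im (z ^+ 2) = 2 * (complex.Re z * complex.Im z).
  by rewrite expr2 Im_mulc; ring.
have u2 := sqr_ge0 (complex.Re z).
have r2 : complex.Re z ^+ 2 / 2 <= complex.Re (z ^+ 2) by rewrite rz; lra.
rewrite expnS !exprM; apply: le_trans (IH (z ^+ 2) _ _); last 2 first.
- by apply: le_trans r2; rewrite divr_ge0.
- apply: le_trans r2; rewrite iz !normrM (ger0_norm z0) ger0_norm //.
  have -> : 2 * (complex.Re z * `|complex.Im z|) * 4 ^+ m =
    (complex.Re z * (`|complex.Im z| * 4 ^+ m.+1)) / 2 by rewrite exprS; field.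
  by rewrite ler_pM2r // expr2 ler_wpM2l.
apply: lerXn2r; rewrite ?nnegrE ?sqr_ge0 //.
  by rewrite divr_ge0 //; apply: le_trans r2; rewrite divr_ge0.
by rewrite expr_div_n ler_pdivlMr //; move: r2; lra.
Qed.

(** Where X >= M Y, the hypotheses force Re z >= X / 8 and
    |Im z| <= X / (2 sqrt M), so z lies in the sector of [sector_pow] and z^(2^m) has
    a real part comparable with X^(2^m).  Elsewhere Y dominates X and |z|, and the
    last term absorbs everything, including a negative real part. *)
Lemma riesz_pointwise (R : realType) (m : nat) : exists a C : R,
  [/\ 0 < a, 0 < C & forall (X Y : R) (z : R[i]), 0 <= X -> 0 <= Y ->
     X = Y + 4 * complex.Re z -> 4 * complex.Im z ^+ 2 <= X * Y ->
     X ^+ (2 ^ m) <= a * complex.Re (z ^+ (2 ^ m)) + C * Y ^+ (2 ^ m)].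
Proof.
set q := (2 ^ m)%N.
(* The second factor makes |Im z| 4^m <= X / 8 when 4 (Im z)^2 <= X^2 / M. *)
pose M : R := 16 * 16 ^+ m.
have M16 : 16 <= M by rewrite /M ler_peMr // exprn_ege1 //; lra.
exists (16 ^+ q), (16 ^+ q * (2 * M) ^+ q + M ^+ q); split.
- by rewrite exprn_gt0.
- by rewrite addr_gt0 ?mulr_gt0 ?exprn_gt0 //; lra.
move=> X Y z X0 Y0 hX hv.
have [hXY|/ltW hXY] := leP (M * Y) X.
  have XY2 : 16 * Y <= X by apply: le_trans hXY; rewrite ler_wpM2r.
  have u0 : X / 8 <= complex.Re z by lra.
  apply: (@le_trans _ _ (16 ^+ q * complex.Re (z ^+ q))); last first.
    by rewrite lerDl mulr_ge0 ?exprn_ge0 ?addr_ge0 ?mulr_ge0 ?exprn_ge0 //; lra.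
  have : (complex.Re z / 2) ^+ q <= complex.Re (z ^+ q).
    apply: sector_pow; first by lra.
    apply: le_trans u0.
    rewrite -(@ler_pXn2r _ 2) // ?nnegrE ?divr_ge0 ?mulr_ge0 ?exprn_ge0 //.
    rewrite exprMn real_normK ?num_real // -exprM mulnC exprM.
    have -> : (4 ^+ 2 : R) = 16 by ring.
    have : 4 * complex.Im z ^+ 2 * M <= X * X.
      apply: le_trans (_ : X * (M * Y) <= _); last by rewrite ler_wpM2l.
      rewrite [leRHS]mulrCA [leLHS]mulrC ler_wpM2l //; lra.
    by rewrite /M; lra.
  have h16 : X ^+ q <= 16 ^+ q * (complex.Re z / 2) ^+ q.
    rewrite -exprMn; apply: lerXn2r; rewrite ?nnegrE //; lra.
  by move=> h; apply: (le_trans h16); rewrite ler_wpM2l // exprn_ge0.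
have MY0 : 0 <= M * Y by apply: le_trans hXY.
have YM : Y <= M * Y by rewrite ler_peMl //; lra.
have hu : `|complex.Re z| <= M * Y by rewrite ler_norml; apply/andP; split; lra.
have hv' : `|complex.Im z| <= M * Y.
  rewrite -(@ler_pXn2r _ 2) // ?nnegrE // real_normK ?num_real //.
  apply: (@le_trans _ _ (X * Y)).
    by apply: le_trans hv; have := sqr_ge0 (complex.Im z); lra.
  by rewrite expr2; apply: ler_pM.
have hz : cmodulus (z ^+ q) <= (2 * M) ^+ q * Y ^+ q.
  rewrite cmodulusX -exprMn; apply: lerXn2r; rewrite ?nnegrE ?cmodulus_ge0 //.
    by rewrite -mulrA mulr_ge0.
  by apply: (le_trans (cmodulus_le_ReIm z)); lra.
have hre : - ((2 * M) ^+ q * Y ^+ q) <= complex.Re (z ^+ q).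
  by rewrite lerNl; apply: le_trans hz; apply: le_trans (normr_Re_le _); rewrite -normrN ler_norm.
have hXq : X ^+ q <= M ^+ q * Y ^+ q by rewrite -exprMn; apply: lerXn2r.
have h16 : 0 <= 16 ^+ q :> R by rewrite exprn_ge0.
have := ler_wpM2l h16 hre.
move: hXq; set e1 := X ^+ q; set e2 := Y ^+ q; set e3 := M ^+ q.
set e4 := (2 * M) ^+ q; set e5 := complex.Re _; set e6 := 16 ^+ q; lra.
Qed.

(** * Integrals over translated and dilated domains *)

Lemma integral_unit_cst (R : realType) (x : R) (c : \bar R) :
  (\int[@lebesgue_measure R]_(s in `[x, (x + 1)%R]) c = c)%E.
Proof.
rewrite (integral_cst lebesgue_measure _ c) //= lebesgue_measure_itv /=.
by rewrite lte_fin ltrDl ltr01 -EFinD addrAC subrr add0r mule1.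
Qed.

Lemma integral_shift (R : realType) (c : R) (D : set R) (F : R -> \bar R) :
  measurable D -> measurable_fun [set: R] F -> (forall x, 0 <= F x)%E ->
  (\int[lebesgue_measure]_(x in (fun x => (x + c)%R) @^-1` D) F (x + c)%R =
   \int[lebesgue_measure]_(x in D) F x)%E.
Proof.
move=> mD mF F0.
have mphi : measurable_fun [set: measurableTypeR R]
    ((fun x => x + c) : measurableTypeR R -> measurableTypeR R).
  exact: measurable_funD.
rewrite -(ge0_integral_pushforward mphi lebesgue_measure mD) //; last first.
  exact: measurable_funS mF.
apply: eq_measure_integral => A mA _; apply/esym.
apply: lebesgue_measure_unique => //= _ [[a b]] _ <-.
rewrite /pushforward (_ : _ @^-1` _ = `](a - c), (b - c)]%classic); last first.
  by apply/seteqP; split => x /=; rewrite !in_itv /= ltrBlDr lerBrDr.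
rewrite !lebesgue_measure_itv /= !lte_fin ltrBDr subrK.
by case: ifP => // _; congr (_%:E); ring.
Qed.

Lemma integral_itv_shift (R : realType) (a b c : R) (F : R -> \bar R) :
  measurable_fun [set: R] F -> (forall x, 0 <= F x)%E ->
  (\int[lebesgue_measure]_(x in `[a, b]) F (x + c)%R =
   \int[lebesgue_measure]_(x in `[(a + c)%R, (b + c)%R]) F x)%E.
Proof.
move=> mF F0; rewrite -(@integral_shift _ c `[a + c, b + c]%classic) //.
suff -> : (fun x => x + c) @^-1` `[a + c, b + c]%classic = `[a, b]%classic by [].
by apply/seteqP; split => x /=; rewrite !in_itv /= !lerD2r.
Qed.

Lemma integral_scale (R : realType) (a : R) (F : R -> \bar R) :
  0 < a -> measurable_fun [set: R] F -> (forall x, 0 <= F x)%E ->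
  (\int[lebesgue_measure]_x F x =
   a%:E * \int[lebesgue_measure]_x F (a * x)%R)%E.
Proof.
move=> a0 mF F0.
pose phi : measurableTypeR R -> measurableTypeR R := fun x => a * x.
have mphi : measurable_fun [set: measurableTypeR R] phi by exact: measurable_funM.
pose k : {nonneg R} := NngNum (ltW a0).
rewrite -[in RHS](@preimage_setT _ _ phi).
rewrite -(ge0_integral_pushforward mphi lebesgue_measure measurableT) //.
rewrite -(ge0_integral_mscale _ _ k) //.
apply: eq_measure_integral => A mA _.
apply: lebesgue_measure_unique => //= _ [[c b]] _ <-.
rewrite /mscale /= /pushforward.
rewrite (_ : _ @^-1` _ = `](c / a), (b / a)]%classic); last first.
  apply/seteqP; split => x /=; rewrite !in_itv /= ltr_pdivrMr //.
    by rewrite ler_pdivlMr // /phi mulrC.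
  by rewrite ler_pdivlMr // /phi mulrC.
rewrite !lebesgue_measure_itv /= !lte_fin ltr_pM2r ?invr_gt0 //.
case: ifP => _; last by rewrite mule0.
by rewrite -!EFinD -EFinM; congr (_%:E); field; rewrite gt_eqF.
Qed.

(** Integrating in x first leaves, for each u, the integral of F over the unit
    interval that starts at y + u. *)
Lemma shear_integral_le (R : realType) (F K : R -> \bar R) (y : R) (A : \bar R) :
  measurable_fun [set: R] F -> (forall x, 0 <= F x)%E ->
  measurable_fun [set: R] K -> (forall x, 0 <= K x)%E ->
  (forall x, \int[lebesgue_measure]_(s in `[x, (x + 1)%R]) F s <= A)%E ->
  (\int[lebesgue_measure]_(x in `[y, (y + 1)%R])
     \int[lebesgue_measure]_t (F t * K (t - x)%R) <=
   A * \int[lebesgue_measure]_u K u)%E.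
Proof.
move=> mF F0 mK K0 FA.
have A0 : (0 <= A)%E by apply: le_trans (FA 0); apply: integral_ge0.
have mFc c : measurable_fun [set: R] (fun u : R => F (u + c)).
  by apply: measurableT_comp => //; exact: measurable_funD.
have inner x : (\int[lebesgue_measure]_t (F t * K (t - x)%R) =
    \int[lebesgue_measure]_u (F (u + x)%R * K u))%E.
  rewrite -(@integral_shift _ x setT (fun t => F t * K (t - x)%R)%E) //.
  - by apply: eq_integral => u _; rewrite addrK.
  - apply: emeasurable_funM => //; apply: measurableT_comp => //.
    exact: measurable_funB.
  - by move=> t; rewrite mule_ge0.
under eq_integral do rewrite inner.
pose D : set R := `[y, y + 1]%classic.
pose f (z : measurableTypeR R * measurableTypeR R) : \bar R :=
  ((\1_D z.1)%:E * (F (z.2 + z.1)%R * K z.2))%E.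
have f0 z : (0 <= f z)%E by rewrite mule_ge0 ?mule_ge0 // lee_fin indicE.
have mf : measurable_fun setT f.
  have m1 : measurable_fun [set: R] (\1_D : R -> R) by apply: measurable_indic; exact: measurable_itv.
  apply: emeasurable_funM; last apply: emeasurable_funM.
  - by apply/measurable_EFinP; exact: (measurableT_comp m1 measurable_fst).
  - apply: (measurableT_comp mF).
    exact: measurable_funD measurable_snd measurable_fst.
  - exact: (measurableT_comp mK measurable_snd).
have -> : (\int[lebesgue_measure]_(x in D)
    \int[lebesgue_measure]_u (F (u + x)%R * K u) =
    \int[lebesgue_measure]_x \int[lebesgue_measure]_u f (x, u))%E.
  rewrite integral_mkcond; apply: eq_integral => x _; rewrite patchE /f /=.
  rewrite indicE; case: ifP => _; last first.
    by rewrite integral0_eq // => u _; rewrite mul0e.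
  by apply: eq_integral => u _; rewrite mul1e.
rewrite (fubini_tonelli f) //.
rewrite -ge0_integralZl //.
apply: ge0_le_integral => //.
- by move=> u _; apply: integral_ge0.
- exact: measurable_fun_fubini_tonelli_G.
- by apply: emeasurable_funM => //.
move=> u _; rewrite /f /=.
under eq_integral do rewrite muleA muleC.
rewrite ge0_integralZl //; last 2 first.
- apply: emeasurable_funM; first by apply/measurable_EFinP; apply: measurable_indic; exact: measurable_itv.
  by under eq_fun do rewrite addrC; exact: mFc.
- by move=> x _; rewrite mule_ge0 // lee_fin indicE.
rewrite muleC lee_wpmul2r //.
apply: le_trans (FA (y + u)).
rewrite addrAC -integral_itv_shift //.
rewrite [leRHS]integral_mkcond; apply: ge0_le_integral => //.
- by move=> x _; rewrite mule_ge0 // lee_fin indicE.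
- apply: emeasurable_funM; first by apply/measurable_EFinP; apply: measurable_indic; exact: measurable_itv.
  by under eq_fun do rewrite addrC; exact: mFc.
- by apply/(measurable_restrictT _ _).1 => //; apply: measurable_funTS; exact: mFc.
move=> x _; rewrite patchE indicE.
by case: ifP => _; rewrite ?mul1e ?mul0e // addrC.
Qed.

Lemma integral_opp (R : realType) (F : R -> \bar R) :
  measurable_fun [set: R] F -> (forall x, 0 <= F x)%E ->
  (\int[lebesgue_measure]_x F (- x)%R = \int[lebesgue_measure]_x F x)%E.
Proof.
move=> mF F0.
pose phi : measurableTypeR R -> measurableTypeR R := fun x => - x.
have mphi : measurable_fun [set: measurableTypeR R] phi by exact: measurable_funN.
rewrite -[in LHS](@preimage_setT _ _ phi).
rewrite -(ge0_integral_pushforward mphi lebesgue_measure measurableT) //.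
by apply: eq_measure_integral => A mA _; exact: lebesgue_measureN.
Qed.

(** * The Fejer weight *)

(** The indicator of 0 restores the limit of the quotient at 0, since division by
    zero gives 0; this makes [fejer] positive there. *)
Definition fejer (R : realType) (u : R) : R :=
  (1 - cos u) / u ^+ 2 + \1_[set 0] u / 2.

(** This is the form in which the quotient is used below: it holds at 0 as
    well. *)
Lemma fejer_sqrM (R : realType) (u : R) : u ^+ 2 * fejer u = 1 - cos u.
Proof.
rewrite /fejer indicE; have [->|u0] := eqVneq u 0.
  by rewrite expr0n cos0 mul0r subrr.
rewrite memNset; last by move=> /= /eqP; rewrite (negbTE u0).
by rewrite mul0r addr0 mulrCA divff ?mulr1 // expf_neq0.
Qed.

Lemma fejer0 (R : realType) : fejer (0 : R) = 1 / 2.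
Proof. by rewrite /fejer expr0n invr0 mulr0 add0r indicE mem_set. Qed.

Lemma fejer_ge0 (R : realType) (u : R) : 0 <= fejer u.
Proof.
rewrite /fejer addr_ge0 ?mulr_ge0 ?indicE ?ler0n // invr_ge0 ?sqr_ge0 //.
Qed.

Lemma fejerN (R : realType) (u : R) : fejer (- u) = fejer u.
Proof.
rewrite /fejer cosN sqrrN !indicE; congr (_ + _%:R / _).
by congr nat_of_bool; apply/idP/idP => /set_mem /= /eqP;
  rewrite ?oppr_eq0 => /eqP h; apply/mem_set => /=; rewrite h ?oppr0.
Qed.

Lemma measurable_fejer (R : realType) : measurable_fun [set: R] (@fejer R).
Proof.
apply: measurable_funD; apply: measurable_funM => //.
- by apply: measurable_funB => //; apply: continuous_measurable_fun; exact: continuous_cos.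
- rewrite (_ : (fun u : R => _) = (fun u => (u ^+ 2) `^ (-1))); last first.
    by apply/funext => u; rewrite powR_inv1 // sqr_ge0.
  by apply: (measurableT_comp (measurable_powR (-1))); exact: measurable_funX.
Qed.

Lemma sin_mean_value (R : realType) (v : R) : 0 <= v ->
  exists2 c, 0 <= c <= v & sin v = cos c * v.
Proof.
move=> v0.
have [c|c] := @MVT_segment R sin cos 0 v v0 (fun x _ => is_derive_sin x).
  by apply: continuous_subspaceT => x; exact: continuous_sin.
by rewrite in_itv /= sin0 !subr0 => hc h; exists c.
Qed.

Lemma oneBcos (R : realType) (u : R) : 1 - cos u = 2 * sin (u / 2) ^+ 2.
Proof.
have -> : cos u = cos ((u / 2) *+ 2) by congr cos; rewrite mulr2n; field.
by rewrite cos_mulr2n cos2sin2; ring.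
Qed.

Lemma oneBcos_le (R : realType) (u : R) : 1 - cos u <= u ^+ 2 / 2.
Proof.
rewrite -cos_norm -(real_normK (num_real u)) oneBcos.
have [c _ ->] := @sin_mean_value R (`|u| / 2) (divr_ge0 (normr_ge0 u) (ler0n _ 2)).
have : cos c ^+ 2 <= 1 by rewrite cos2sin2 gerBl sqr_ge0.
have := sqr_ge0 `|u|; rewrite exprMn expr_div_n => h1 h2.
by have := ler_wpM2r h1 h2; lra.
Qed.

Lemma oneBcos_ge (R : realType) (u : R) : 0 <= u <= 2 -> u ^+ 2 / 8 <= 1 - cos u.
Proof.
move=> /andP[u0 u2]; rewrite oneBcos.
have [|c /andP[c0 cu] ->] := @sin_mean_value R (u / 2); first lra.
have : c ^+ 2 <= 1 by rewrite expr_le1 //; lra.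
move=> c2; have := oneBcos_le c => hc; have : 1 / 2 <= cos c by lra.
move=> hc2; have : (1 / 2) ^+ 2 <= cos c ^+ 2.
  by rewrite lerXn2r ?nnegrE //; lra.
rewrite !exprMn => h; have := ler_wpM2r (sqr_ge0 u) h; lra.
Qed.

Lemma fejer_le (R : realType) (u : R) : fejer u <= 3 * (oneDsqr u)^-1.
Proof.
have h : 0 < oneDsqr u by rewrite (lt_le_trans _ (oneDsqr_ge1 u)).
rewrite ler_pdivlMr //.
rewrite /oneDsqr mulrDr mulr1 [_ * u ^+ 2]mulrC fejer_sqrM.
have : fejer u <= 1 / 2.
  have [->|u0] := eqVneq u 0; first by rewrite fejer0.
  have u2 : 0 < u ^+ 2 by rewrite exprn_even_gt0.
  by rewrite -(ler_pM2l u2) fejer_sqrM; have := oneBcos_le u; lra.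
have := cos_geN1 u; lra.
Qed.

Lemma fejer_ge (R : realType) (u : R) : 0 <= u <= 1 -> 1 / 8 <= fejer u.
Proof.
move=> /andP[u0 u1].
have [->|n0] := eqVneq u 0; first by rewrite fejer0; lra.
have u2 : 0 < u ^+ 2 by rewrite exprn_even_gt0.
rewrite -(ler_pM2l u2) fejer_sqrM.
have := @oneBcos_ge R u; rewrite u0 /= => /(_ _); rewrite (le_trans u1) ?ler1n // => /(_ isT); lra.
Qed.

Lemma integral_oneDsqrV (R : realType) :
  (\int[@lebesgue_measure R]_x ((oneDsqr x)^-1)%:E = pi%:E)%E.
Proof.
rewrite ge0_symfun_integralT /=.
- rewrite (_ : [set x | _] = `[0, +oo[%classic); last first.
    by apply/seteqP; split => x/=; rewrite in_itv/= andbT.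
  by rewrite integral0y_oneDsqr -EFinM; congr (_%:E); field.
- by move=> x; rewrite invr_ge0 (le_trans ler01) // oneDsqr_ge1.
- exact: continuous_oneDsqrV.
- by move=> x; rewrite /= /oneDsqr sqrrN.
Qed.

Lemma integrable_ge0 (R : realType) (D : set R) (f : R -> R) : measurable D ->
  measurable_fun D f -> (forall x, 0 <= f x) ->
  (\int[lebesgue_measure]_(x in D) (f x)%:E < +oo)%E ->
  (@lebesgue_measure R).-integrable D (EFin \o f).
Proof.
move=> mD mf f0 hf; apply/integrableP; split; first exact/measurable_EFinP.
by under eq_integral do rewrite /= ger0_norm //.
Qed.

(** The quadratic factor is the one for which the dilated weight multiplied by
    x ^+ 2 is 1 - cos (a * x), whatever the sign of a. *)
Lemma integrable_fejer_scale (R : realType) (a : R) :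
  (@lebesgue_measure R).-integrable [set: R]
    (EFin \o (fun x => a ^+ 2 * fejer (a * x))) /\
  \int[@lebesgue_measure R]_x (a ^+ 2 * fejer (a * x)) =
  `|a| * \int[@lebesgue_measure R]_x fejer x.
Proof.
have mf (b : R) : measurable_fun [set: R] (fun x => fejer (b * x)).
  by apply: (measurableT_comp (@measurable_fejer R)); exact: measurable_funM.
have intf : (\int[@lebesgue_measure R]_x (fejer x)%:E < +oo)%E.
  apply: (@le_lt_trans _ _ (\int[@lebesgue_measure R]_x (3%:E * ((oneDsqr x)^-1)%:E)%E)%E).
    apply: ge0_le_integral => //.
    - by move=> x _; rewrite lee_fin fejer_ge0.
    - by apply/measurable_EFinP; exact: measurable_fejer.
    - apply/measurable_EFinP; apply: measurable_funM => //.
      by apply: continuous_measurable_fun; exact: continuous_oneDsqrV.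
    - by move=> x _; rewrite lee_fin fejer_le.
  rewrite ge0_integralZl_EFin //; first by rewrite integral_oneDsqrV ltry.
  - by apply/measurable_EFinP; apply: continuous_measurable_fun; exact: continuous_oneDsqrV.
have intfE : (\int[@lebesgue_measure R]_x (fejer x)%:E)%E =
    (\int[@lebesgue_measure R]_x fejer x)%:E.
  rewrite fineK // ge0_fin_numE // integral_ge0 // => x _.
  by rewrite lee_fin fejer_ge0.
have key : (\int[@lebesgue_measure R]_x (a ^+ 2 * fejer (a * x))%:E)%E =
    (`|a| * \int[@lebesgue_measure R]_x fejer x)%:E.
  have [->|a0] := eqVneq a 0.
    rewrite normr0 mul0r integral0_eq // => x _.
    by rewrite expr0n mul0r.
  have na0 : 0 < `|a| by rewrite normr_gt0.
  under eq_integral do rewrite EFinM.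
  rewrite ge0_integralZl_EFin ?sqr_ge0 //; [|by move=> x _; rewrite lee_fin fejer_ge0|]; last first.
    by apply/measurable_EFinP; exact: mf.
  have -> : (\int[@lebesgue_measure R]_x (fejer (a * x))%:E =
      \int[@lebesgue_measure R]_x (fejer (`|a| * x))%:E)%E.
    apply: eq_integral => x _; congr (_%:E).
    by have [//|_] := ger0P a; rewrite mulNr fejerN.
  rewrite -(real_normK (num_real a)) expr2 EFinM -muleA.
  rewrite -(@integral_scale _ _ (fun x => (fejer x)%:E) na0) ?intfE //.
    by apply/measurable_EFinP; exact: measurable_fejer.
  by move=> x; rewrite lee_fin fejer_ge0.
split; last by rewrite /Rintegral key.
apply: integrable_ge0 => //.
- exact: measurable_funM.
- by move=> x; rewrite mulr_ge0 ?sqr_ge0 ?fejer_ge0.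
- by rewrite key ltry.
Qed.

Lemma integrable_fejer_bounded (R : realType) (b M : R) (h : R -> R) : 0 < b ->
  measurable_fun [set: R] h -> (forall x, `|h x| <= M) ->
  (@lebesgue_measure R).-integrable [set: R]
    (EFin \o (fun x => fejer (b * x) * h x)).
Proof.
move=> b0 mh hM.
have [iw _] := integrable_fejer_scale b.
have bh : [bounded h x | x in [set: R]].
  exists M; split; first exact: num_real.
  by move=> N MN x _; apply: le_trans (ltW MN).
have mh' : measurable_fun [set: measurableTypeR R] h by exact: mh.
have := integrableMr measurableT mh' bh (integrableZl measurableT (b ^- 2) iw).
apply: eq_integrable => // x _ /=.
rewrite -!EFinM; congr (_%:E).
by rewrite [RHS]mulrC; congr (_ * _); rewrite mulrA mulVf ?mul1r // expf_neq0 // gt_eqF.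
Qed.

(** The product formula for cosines writes b^2 w(b x) cos(lambda x), with w the
    Fejer weight, as half the second difference in a, with step b at a = lambda, of
    a^2 w(a x).  As the integral of the latter is proportional to |a|, what remains is a
    multiple of |lambda + b| + |lambda - b| - 2 |lambda|, which vanishes for
    b <= |lambda|: the Fourier transform of the weight is a triangle function supported
    in [-b, b]. *)
Lemma fejer_cos_eq0 (R : realType) (b lambda : R) : 0 < b -> b <= `|lambda| ->
  \int[@lebesgue_measure R]_x (fejer (b * x) * cos (lambda * x)) = 0.
Proof.
move=> b0 hb.
suff : b ^+ 2 * \int[@lebesgue_measure R]_x (fejer (b * x) * cos (lambda * x)) = 0.
  by move/eqP; rewrite mulf_eq0 expf_eq0 /= gt_eqF //= => /eqP.
have mcos : measurable_fun [set: R] (fun x => cos (lambda * x)).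
  apply: continuous_measurable_fun => x; apply: continuous_comp; last exact: continuous_cos.
  exact: mulrl_continuous.
rewrite -RintegralZl //; last first.
  by apply: (@integrable_fejer_bounded _ _ 1) => // x; exact: cos_max.
have [i1 e1] := integrable_fejer_scale (lambda + b).
have [i2 e2] := integrable_fejer_scale (lambda - b).
have [i3 e3] := integrable_fejer_scale lambda.
have i12 : (@lebesgue_measure R).-integrable [set: R] (EFin \o (fun x =>
    (lambda + b) ^+ 2 * fejer ((lambda + b) * x) +
    (lambda - b) ^+ 2 * fejer ((lambda - b) * x))).
  by have := integrableD measurableT i1 i2; apply: eq_integrable.
have ih : (@lebesgue_measure R).-integrable [set: R] (EFin \o (fun x =>
    2^-1 * ((lambda + b) ^+ 2 * fejer ((lambda + b) * x) +
            (lambda - b) ^+ 2 * fejer ((lambda - b) * x)))).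
  by have := integrableZl measurableT (2^-1) i12; apply: eq_integrable.
transitivity (\int[@lebesgue_measure R]_x
    (2^-1 * ((lambda + b) ^+ 2 * fejer ((lambda + b) * x) +
             (lambda - b) ^+ 2 * fejer ((lambda - b) * x)) -
     lambda ^+ 2 * fejer (lambda * x))).
  apply: eq_Rintegral => x _.
  have [->|x0] := eqVneq x 0.
    by rewrite !mulr0 fejer0 cos0; field.
  have x2 : x ^+ 2 != 0 by rewrite expf_neq0.
  apply: (mulfI x2).
  have E (a : R) : x ^+ 2 * (a ^+ 2 * fejer (a * x)) = 1 - cos (a * x).
    by rewrite -fejer_sqrM exprMn; ring.
  rewrite mulrBr E [x ^+ 2 * (2^-1 * _)]mulrCA mulrDr !E.
  rewrite (_ : x ^+ 2 * _ = (x ^+ 2 * (b ^+ 2 * fejer (b * x))) * cos (lambda * x)); last by ring.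
  by rewrite E [(lambda + b) * x]mulrDl [(lambda - b) * x]mulrBl cosD cosB; field.
rewrite RintegralB // (RintegralZl (2^-1) measurableT i12) RintegralD // e1 e2 e3.
rewrite -mulrDl mulrA -mulrBl [X in X * _](_ : _ = 0) ?mul0r //.
have [l0|l0] := leP 0 lambda.
  rewrite (ger0_norm l0) in hb; rewrite (ger0_norm l0).
  by rewrite ger0_norm ?ger0_norm; [field|lra|lra].
rewrite (ltr0_norm l0) in hb; rewrite (ltr0_norm l0).
by rewrite ler0_norm ?ler0_norm; [field|lra|lra].
Qed.

Lemma fejer_sin_eq0 (R : realType) (b lambda : R) : 0 < b ->
  \int[@lebesgue_measure R]_x (fejer (b * x) * sin (lambda * x)) = 0.
Proof.
move=> b0.
have msin : measurable_fun [set: R] (fun x => sin (lambda * x)).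
  apply: continuous_measurable_fun => x; apply: continuous_comp; last exact: continuous_sin.
  exact: mulrl_continuous.
have i1 : (@lebesgue_measure R).-integrable [set: R]
    (EFin \o (fun x => fejer (b * x) * 1)).
  by apply: (@integrable_fejer_bounded _ _ 1) => // x; rewrite normr1.
have i2 : (@lebesgue_measure R).-integrable [set: R]
    (EFin \o (fun x => fejer (b * x) * sin (lambda * x))).
  by apply: (@integrable_fejer_bounded _ _ 1) => // x; exact: sin_max.
have : \int[@lebesgue_measure R]_x (fejer (b * x) * 1 + fejer (b * x) * sin (lambda * x)) =
    \int[@lebesgue_measure R]_x (fejer (b * x) * 1 - fejer (b * x) * sin (lambda * x)).
  rewrite /Rintegral -[in RHS]integral_opp.
  - by under [in RHS]eq_integral do rewrite !mulrN fejerN sinN mulrN opprK.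
  - by have := integrableB measurableT i1 i2 => /(measurable_int _).
  by move=> x; rewrite lee_fin -mulrBr mulr_ge0 ?fejer_ge0 // subr_ge0 sin_le1.
rewrite RintegralD // RintegralB // => /addrI /eqP.
by rewrite -subr_eq0 opprK -mulr2n mulrn_eq0 /= => /eqP.
Qed.

Lemma fejer_band_limited (R : realType) (b lambda : R) (c : R[i]) :
  0 < b -> b <= `|lambda| ->
  (@lebesgue_measure R).-integrable [set: R]
    (EFin \o (fun x => fejer (b * x) * complex.Re (c * cexpi (lambda * x)))) /\
  \int[@lebesgue_measure R]_x
    (fejer (b * x) * complex.Re (c * cexpi (lambda * x))) = 0.
Proof.
move=> b0 hb.
have mcos : measurable_fun [set: R] (fun x => cos (lambda * x)).
  apply: continuous_measurable_fun => x; apply: continuous_comp; last exact: continuous_cos.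
  exact: mulrl_continuous.
have msin : measurable_fun [set: R] (fun x => sin (lambda * x)).
  apply: continuous_measurable_fun => x; apply: continuous_comp; last exact: continuous_sin.
  exact: mulrl_continuous.
have E x : fejer (b * x) * complex.Re (c * cexpi (lambda * x)) =
    complex.Re c * (fejer (b * x) * cos (lambda * x)) -
    complex.Im c * (fejer (b * x) * sin (lambda * x)).
  by rewrite Re_mulc /cexpi /=; ring.
have i1 : (@lebesgue_measure R).-integrable [set: R]
    (EFin \o (fun x => fejer (b * x) * cos (lambda * x))).
  by apply: (@integrable_fejer_bounded _ _ 1) => // x; exact: cos_max.
have i2 : (@lebesgue_measure R).-integrable [set: R]
    (EFin \o (fun x => fejer (b * x) * sin (lambda * x))).
  by apply: (@integrable_fejer_bounded _ _ 1) => // x; exact: sin_max.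
have j1 := integrableZl measurableT (complex.Re c) i1.
have j2 := integrableZl measurableT (complex.Im c) i2.
split.
  have := integrableB measurableT j1 j2; apply: eq_integrable => // x _ /=.
  by rewrite E EFinB !EFinM.
under eq_Rintegral do rewrite E.
rewrite RintegralB // !RintegralZl // fejer_cos_eq0 // fejer_sin_eq0 //.
by rewrite !mulr0 subrr.
Qed.

(** The weight is dominated by a multiple of 1 / (1 + (b t)^2), which varies by
    at most a factor 3 on unit intervals since b <= 1.  It is therefore dominated by an
    average of itself over unit intervals, and [shear_integral_le] applies. *)
Lemma fejer_weight_le (R : realType) (b : R) (F : R -> \bar R) (A : \bar R) :
  0 < b <= 1 -> measurable_fun [set: R] F -> (forall x, 0 <= F x)%E ->
  (forall x, \int[lebesgue_measure]_(s in `[x, (x + 1)%R]) F s <= A)%E ->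
  (\int[lebesgue_measure]_t (F t * (fejer (b * t))%:E) <=
   (9 * (pi / b))%:E * A)%E.
Proof.
move=> /andP[b0 b1] mF F0 FA.
have A0 : (0 <= A)%E by apply: le_trans (FA 0); apply: integral_ge0.
pose v (t : R) : R := (oneDsqr (b * t))^-1.
have v0 t : 0 <= v t by rewrite invr_ge0 (le_trans ler01) // oneDsqr_ge1.
have mv : measurable_fun [set: R] v.
  apply: continuous_measurable_fun => x.
  apply: (@continuous_comp _ _ _ (fun t => b * t) (fun u => (oneDsqr u)^-1)).
    exact: mulrl_continuous.
  exact: continuous_oneDsqrV.
have intv : (\int[lebesgue_measure]_u (v u)%:E = (pi / b)%:E)%E.
  have mq : measurable_fun [set: R] (fun u : R => ((oneDsqr u)^-1)%:E).
    by apply/measurable_EFinP; apply: continuous_measurable_fun; exact: continuous_oneDsqrV.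
  have q0 (u : R) : (0 <= ((oneDsqr u)^-1)%:E)%E.
    by rewrite lee_fin invr_ge0 (le_trans ler01) // oneDsqr_ge1.
  have := integral_scale b0 mq q0.
  rewrite integral_oneDsqrV => h.
  by rewrite EFinM h muleAC -EFinM divff ?mul1e // gt_eqF.
have vshift t s : 0 <= s <= 1 -> v t <= 3 * v (t - s).
  move=> /andP[s0 s1]; rewrite /v /oneDsqr.
  have h1 : 0 < 1 + (b * t) ^+ 2 by have := sqr_ge0 (b * t); lra.
  have h2 : 0 < 1 + (b * (t - s)) ^+ 2 by have := sqr_ge0 (b * (t - s)); lra.
  rewrite -[leLHS]div1r ler_pdivrMr // mulrAC ler_pdivlMr // mul1r.
  have bs : (b * s) ^+ 2 <= 1.
    by rewrite expr_le1 // ?mulr_ge0 ?mulr_ile1 // ltW.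
  have := sqr_ge0 (b * t + b * s); move: bs; rewrite mulrBr !sqrrB !sqrrD.
  have := sqr_ge0 (b * t); lra.
pose D : set R := `[0, 0 + 1]%classic.
have mD : measurable D by exact: measurable_itv.
have mvs t : measurable_fun [set: R] (fun s => v (t - s)).
  by apply: (measurableT_comp mv); exact: measurable_funB.
(* 9 = 3 * 3: one factor comes from [fejer_le], the other from [vshift]. *)
have wle t : ((fejer (b * t))%:E <=
    9%:E * \int[lebesgue_measure]_(s in D) (v (t - s))%:E)%E.
  apply: (@le_trans _ _ (3 * v t)%:E); first by rewrite lee_fin fejer_le.
  rewrite (_ : 9 = 3 * 3 :> R); last by ring.
  rewrite !EFinM -muleA lee_wpmul2l ?lee_fin //.
  rewrite -ge0_integralZl_EFin //; last 2 first.
  - by move=> s _; rewrite lee_fin.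
  - by apply: measurable_funTS; apply/measurable_EFinP; exact: mvs.
  rewrite -[leLHS](integral_unit_cst 0).
  apply: ge0_le_integral => //.
  - by move=> s _; rewrite lee_fin.
  - apply: measurable_funTS; apply: emeasurable_funM => //.
    by apply/measurable_EFinP; exact: mvs.
  - move=> s; rewrite /D /= in_itv /= add0r => Ds.
    by rewrite -EFinM lee_fin vshift.
pose f (z : measurableTypeR R * measurableTypeR R) : \bar R :=
  (F z.1 * ((\1_D z.2)%:E * (v (z.1 - z.2))%:E))%E.
have f0 z : (0 <= f z)%E.
  by rewrite mule_ge0 ?mule_ge0 // lee_fin ?indicE.
have mf : measurable_fun setT f.
  have m1 : measurable_fun [set: R] (\1_D : R -> R) by exact: measurable_indic.
  apply: emeasurable_funM; last apply: emeasurable_funM.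
  - exact: (measurableT_comp mF measurable_fst).
  - by apply/measurable_EFinP; exact: (measurableT_comp m1 measurable_snd).
  - apply/measurable_EFinP; apply: (measurableT_comp mv).
    exact: measurable_funB measurable_fst measurable_snd.
have fE t : (\int[lebesgue_measure]_s f (t, s) =
    F t * \int[lebesgue_measure]_(s in D) (v (t - s))%:E)%E.
  rewrite /f /= ge0_integralZl //; last 2 first.
  - apply: emeasurable_funM; apply/measurable_EFinP; last exact: mvs.
    exact: measurable_indic.
  - by move=> s _; rewrite mule_ge0 // lee_fin ?indicE.
  congr (_ * _)%E; rewrite [RHS]integral_mkcond; apply: eq_integral => s _.
  by rewrite patchE indicE; case: ifP => _; rewrite ?mul1e ?mul0e.
have fE2 s : (\int[lebesgue_measure]_t f (t, s) =
    (\1_D s)%:E * \int[lebesgue_measure]_t (F t * (v (t - s))%:E))%E.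
  rewrite -ge0_integralZl //.
  - by apply: eq_integral => t _; rewrite /f /= muleCA.
  - apply: emeasurable_funM => //; apply/measurable_EFinP.
    by apply: (measurableT_comp mv); exact: measurable_funB.
  - by move=> t _; rewrite mule_ge0 // lee_fin.
apply: (@le_trans _ _ (9%:E * \int[lebesgue_measure]_t \int[lebesgue_measure]_s f (t, s))%E).
  rewrite -ge0_integralZl_EFin //; last 2 first.
  - by move=> t _; apply: integral_ge0.
  - exact: measurable_fun_fubini_tonelli_F.
  apply: ge0_le_integral => //.
  - by move=> t _; rewrite mule_ge0 // lee_fin fejer_ge0.
  - apply: emeasurable_funM => //; apply/measurable_EFinP.
    by apply: (measurableT_comp (@measurable_fejer R)); exact: measurable_funM.
  - by apply: emeasurable_funM => //; exact: measurable_fun_fubini_tonelli_F.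
  - by move=> t _; rewrite fE muleCA lee_wpmul2l.
rewrite EFinM -muleA lee_wpmul2l ?lee_fin // (fubini_tonelli f) //.
under eq_integral do rewrite fE2.
apply: (@le_trans _ _ (\int[lebesgue_measure]_(s in D)
    \int[lebesgue_measure]_t (F t * (v (t - s))%:E))%E).
  rewrite [leRHS]integral_mkcond le_eqVlt; apply/orP; left; apply/eqP.
  apply: eq_integral => s _.
  by rewrite patchE indicE; case: ifP => _; rewrite ?mul1e ?mul0e.
rewrite muleC -intv.
apply: (@shear_integral_le R F (fun u => (v u)%:E) 0 A) => //.
by apply/measurable_EFinP.
Qed.

(** * Trigonometric polynomials with frequencies bounded below *)

(** Stated up to pointwise equality, since a product of trigonometric polynomials
    is again one but has no canonical list of coefficients. *)
Definition freq_ge (R : realType) (b : R) (F : R -> R[i]) :=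
  exists2 s : seq (R[i] * R), all (fun cl => b <= cl.2) s & F =1 trig_poly s.

Lemma freq_ge_trig (R : realType) (b : R) s :
  all (fun cl => b <= cl.2) s -> freq_ge b (trig_poly s).
Proof. by exists s. Qed.

Lemma freq_geW (R : realType) (a b : R) F : b <= a -> freq_ge a F -> freq_ge b F.
Proof.
move=> ba [s hs Fs]; exists s => //; apply: sub_all hs => cl; exact: le_trans.
Qed.

Lemma freq_ge_sum (R : realType) (b : R) (r : seq nat) (F : nat -> R -> R[i]) :
  (forall j, freq_ge b (F j)) -> freq_ge b (fun x => \sum_(j <- r) F j x).
Proof.
move=> hF; elim: r => [|j r [s hs IH]].
  by exists [::] => // x; rewrite big_nil trig_poly_nil.
have [t ht Ft] := hF j; exists (t ++ s); first by rewrite all_cat hs ht.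
by move=> x; rewrite big_cons trig_poly_cat -IH -Ft.
Qed.

Lemma freq_geM (R : realType) (a b : R) F G :
  freq_ge a F -> freq_ge b G -> freq_ge (a + b) (fun x => F x * G x).
Proof.
move=> [s hs Fs] [t ht Gt].
exists [seq (p.1.1 * p.2.1, p.1.2 + p.2.2) | p <- allpairs pair s t].
  apply/allP => _ /mapP[_ /allpairsP[[p q] /= [ps qt ->]] ->] /=.
  by rewrite lerD // ?(allP hs) ?(allP ht).
move=> x; rewrite Fs Gt /trig_poly big_map big_allpairs_dep mulr_suml.
apply: eq_bigr => p _; rewrite mulr_sumr; apply: eq_bigr => q _ /=.
by rewrite mulrDl cexpiD; ring.
Qed.

(** Each further factor can only raise the frequencies, as b is nonnegative. *)
Lemma freq_geX (R : realType) (b : R) F n : 0 <= b ->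
  freq_ge b F -> freq_ge b (fun x => F x ^+ n.+1).
Proof.
move=> b0 hF; elim: n => [|n IH].
  by have [s hs Fs] := hF; exists s => // x; rewrite expr1 Fs.
have := freq_geM hF IH => /(freq_geW _) h.
by have [|s hs Fs] := h b; [rewrite lerDl|exists s => // x; rewrite exprS Fs].
Qed.

Lemma freq_ge_conj (R : realType) (b : R) s :
  all (fun cl => cl.2 <= - b) s -> freq_ge b (fun x => ((trig_poly s x)^*)%C).
Proof.
move=> hs; exists [seq ((cl.1^*)%C, - cl.2) | cl <- s].
  by rewrite all_map; apply: sub_all hs => cl /=; rewrite lerNr.
move=> x; rewrite /trig_poly big_map rmorph_sum; apply: eq_bigr => cl _ /=.
by rewrite rmorphM mulNr -conj_cexpi.
Qed.

(** Translation changes the coefficients and keeps the frequencies; this is why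
    an inequality proved around the origin holds around every point with the same
    constant. *)
Definition translate_trig (R : realType) (y : R) (s : seq (R[i] * R)) :=
  [seq (cl.1 * cexpi (cl.2 * y), cl.2) | cl <- s].

Lemma translate_trigE (R : realType) (y : R) s x :
  trig_poly (translate_trig y s) x = trig_poly s (x + y).
Proof.
rewrite /trig_poly big_map; apply: eq_bigr => cl _ /=.
by rewrite mulrDr cexpiD; ring.
Qed.

Lemma continuous_trig_poly (R : realType) (s : seq (R[i] * R)) :
  continuous (fun x => complex.Re (trig_poly s x)) /\
  continuous (fun x => complex.Im (trig_poly s x)).
Proof.
have cc (l : R) : continuous (fun x => cos (l * x)).
  by move=> x; apply: continuous_comp; [exact: mulrl_continuous|exact: continuous_cos].
have cs (l : R) : continuous (fun x => sin (l * x)).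
  by move=> x; apply: continuous_comp; [exact: mulrl_continuous|exact: continuous_sin].
elim: s => [|cl s [IHr IHi]].
  split; rewrite (_ : (fun x => _) = cst 0).
  - exact: cst_continuous.
  - by apply/funext => x; rewrite trig_poly_nil.
  - exact: cst_continuous.
  - by apply/funext => x; rewrite trig_poly_nil.
split.
- rewrite (_ : (fun x => _) = (fun x => complex.Re cl.1 * cos (cl.2 * x) -
    complex.Im cl.1 * sin (cl.2 * x) + complex.Re (trig_poly s x))).
    move=> x; apply: cvgD; last exact: IHr.
    by apply: cvgB; apply: cvgM; (exact: cvg_cst || exact: cc || exact: cs).
  by apply/funext => x; rewrite trig_poly_cons Re_addc Re_mulc.
- rewrite (_ : (fun x => _) = (fun x => complex.Re cl.1 * sin (cl.2 * x) +
    complex.Im cl.1 * cos (cl.2 * x) + complex.Im (trig_poly s x))).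
    move=> x; apply: cvgD; last exact: IHi.
    by apply: cvgD; apply: cvgM; (exact: cvg_cst || exact: cc || exact: cs).
  by apply/funext => x; rewrite trig_poly_cons Im_addc Im_mulc.
Qed.

Lemma cmeasurable_trig_poly (R : realType) (s : seq (R[i] * R)) :
  cmeasurable (trig_poly s).
Proof.
by have [cr ci] := continuous_trig_poly s; split; apply: continuous_measurable_fun.
Qed.

Lemma trig_poly_bounded (R : realType) (s : seq (R[i] * R)) x :
  cmodulus (trig_poly s x) <= \sum_(cl <- s) cmodulus cl.1.
Proof.
apply: le_trans (cmodulus_sum _ _) _; apply: ler_sum => cl _.
by rewrite cmodulusM cmodulus_cexpi mulr1.
Qed.

Lemma measurable_cmodulus (R : realType) (f : R -> R[i]) :
  cmeasurable f -> measurable_fun [set: R] (fun x => cmodulus (f x)).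
Proof.
move=> [mr mi].
rewrite (_ : (fun x => _) =
   (fun x => (complex.Re (f x) ^+ 2 + complex.Im (f x) ^+ 2) `^ 2^-1)); last first.
  apply/funext => x; rewrite powR12_sqrt; last by rewrite addr_ge0 ?sqr_ge0.
  by case: (f x).
apply: (measurableT_comp (measurable_powR 2^-1)).
by apply: measurable_funD; apply: measurable_funX.
Qed.

(** All frequencies lie outside the interval on which the Fourier transform of
    the weight lives. *)
Lemma freq_ge_fejer_eq0 (R : realType) (b : R) F : 0 < b -> freq_ge b F ->
  (@lebesgue_measure R).-integrable [set: R]
    (EFin \o (fun x => fejer (b * x) * complex.Re (F x))) /\
  \int[@lebesgue_measure R]_x (fejer (b * x) * complex.Re (F x)) = 0.
Proof.
move=> b0 [s hs Fs].
rewrite (_ : (fun x => _) = (fun x => fejer (b * x) * complex.Re (trig_poly s x))); last first.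
  by apply/funext => x; rewrite Fs.
elim: s hs {Fs} => [_|cl s IH /= /andP[h1 h2]].
  rewrite (_ : (fun x => _) = cst 0); last first.
    by apply/funext => x; rewrite trig_poly_nil mulr0.
  split; first exact: integrable0.
  by rewrite Rintegral_cst // mul0r.
have [i1 e1] := IH h2.
have [i2 e2] := @fejer_band_limited R b cl.2 cl.1 b0 (le_trans h1 (ler_norm _)).
rewrite (_ : (fun x => _) = (fun x =>
  fejer (b * x) * complex.Re (cl.1 * cexpi (cl.2 * x)) +
  fejer (b * x) * complex.Re (trig_poly s x))); last first.
  by apply/funext => x; rewrite trig_poly_cons Re_addc mulrDr.
split; first by have := integrableD measurableT i2 i1; apply: eq_integrable.
by rewrite RintegralD // e1 e2 addr0.
Qed.

(** * Finite square functions *)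

Lemma cauchy_schwarz_sum (R : realType) (I : Type) (r : seq I) (x y : I -> R) :
  (\sum_(i <- r) x i * y i) ^+ 2 <= (\sum_(i <- r) x i ^+ 2) * (\sum_(i <- r) y i ^+ 2).
Proof.
elim: r => [|i r]; first by rewrite !big_nil mulr0 expr0n.
rewrite !big_cons.
set s := \sum_(j <- r) x j * y j; set P := \sum_(j <- r) x j ^+ 2.
set Q := \sum_(j <- r) y j ^+ 2 => IH.
have P0 : 0 <= P by apply: sumr_ge0 => *; exact: sqr_ge0.
have Q0 : 0 <= Q by apply: sumr_ge0 => *; exact: sqr_ge0.
have h0 : 0 <= P * y i ^+ 2 + Q * x i ^+ 2 by apply: addr_ge0; apply: mulr_ge0 => //; exact: sqr_ge0.
suff : 2 * (s * (x i * y i)) <= P * y i ^+ 2 + Q * x i ^+ 2.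
  by move=> h; rewrite sqrrD exprMn mulrDl !mulrDr; lra.
apply: le_trans (ler_norm _) _.
rewrite -(@ler_pXn2r _ 2) ?nnegrE // real_normK ?num_real //.
have := ler_wpM2r (sqr_ge0 (x i * y i)) IH => h.
have := sqr_ge0 (P * y i ^+ 2 - Q * x i ^+ 2).
rewrite sqrrB sqrrD !exprMn in h *.
have e : P * Q * (x i ^+ 2 * y i ^+ 2) = P * y i ^+ 2 * (Q * x i ^+ 2) by ring.
lra.
Qed.

Definition sum_sqr (R : realType) (J : nat) (F : nat -> R -> R[i]) (x : R) : R :=
  \sum_(0 <= j < J) cmodulus (F j x) ^+ 2.

Lemma sum_sqr_ge0 (R : realType) J (F : nat -> R -> R[i]) x : 0 <= sum_sqr J F x.
Proof. by apply: sumr_ge0 => j _; exact: sqr_ge0. Qed.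

Lemma measurable_sum_sqr (R : realType) J (F : nat -> R -> R[i]) :
  (forall j, cmeasurable (F j)) -> measurable_fun [set: R] (sum_sqr J F).
Proof.
move=> mF; apply: measurable_sum => j; apply: measurable_funX.
exact: measurable_cmodulus.
Qed.

Lemma sum_sqr_trig_bounded (R : realType) J (s : nat -> seq (R[i] * R)) n :
  exists M, forall x, `|sum_sqr J (fun j => trig_poly (s j)) x ^+ n| <= M.
Proof.
exists ((\sum_(0 <= j < J) (\sum_(cl <- s j) cmodulus cl.1) ^+ 2) ^+ n) => x.
rewrite ger0_norm ?exprn_ge0 ?sum_sqr_ge0 //.
have h : sum_sqr J (fun j => trig_poly (s j)) x <=
    \sum_(0 <= j < J) (\sum_(cl <- s j) cmodulus cl.1) ^+ 2.
  apply: ler_sum => j _; apply: lerXn2r; rewrite ?nnegrE ?cmodulus_ge0 //.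
    by apply: sumr_ge0 => *; exact: cmodulus_ge0.
  exact: trig_poly_bounded.
by apply: lerXn2r => //; rewrite nnegrE ?sum_sqr_ge0 // (le_trans _ h) ?sum_sqr_ge0.
Qed.

(** The first claim is the polarization identity.  For the second, the imaginary
    part of (A - B) conj(A + B) is twice that of A conj(B), and the Cauchy-Schwarz
    inequality bounds the sum of these products. *)
Lemma sum_sqr_polarization (R : realType) J (A B : nat -> R -> R[i]) x :
  let z := - \sum_(0 <= j < J) A j x * ((B j x)^*)%C in
  let X := sum_sqr J (fun j x => A j x - B j x) x in
  let Y := sum_sqr J (fun j x => A j x + B j x) x in
  X = Y + 4 * complex.Re z /\ 4 * complex.Im z ^+ 2 <= X * Y.
Proof.
have ReS (r : seq nat) (F : nat -> R[i]) :
    complex.Re (\sum_(j <- r) F j) = \sum_(j <- r) complex.Re (F j).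
  by elim: r => [|j r IH]; rewrite ?big_nil // !big_cons Re_addc IH.
have ImS (r : seq nat) (F : nat -> R[i]) :
    complex.Im (\sum_(j <- r) F j) = \sum_(j <- r) complex.Im (F j).
  by elim: r => [|j r IH]; rewrite ?big_nil // !big_cons Im_addc IH.
have ReN (w : R[i]) : complex.Re (- w) = - complex.Re w by case: w.
have ImN (w : R[i]) : complex.Im (- w) = - complex.Im w by case: w.
move=> z X Y; split.
  rewrite /z ReN ReS mulrN mulr_sumr -sumrN -big_split /=.
  apply: eq_bigr => j _; rewrite !sqr_cmodulus.
  by case: (A j x) (B j x) => a1 a2 [b1 b2] /=; ring.
apply: (@le_trans _ _ ((\sum_(0 <= j < J)
    cmodulus (A j x - B j x) * cmodulus (A j x + B j x)) ^+ 2)); last first.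
  exact: cauchy_schwarz_sum.
have -> : 4 * complex.Im z ^+ 2 = (\sum_(0 <= j < J)
    complex.Im ((A j x - B j x) * ((A j x + B j x)^*)%C)) ^+ 2.
  rewrite /z ImN ImS sqrrN (_ : 4 = 2 ^+ 2 :> R); last by ring.
  rewrite -exprMn mulr_sumr; congr (_ ^+ 2); apply: eq_bigr => j _.
  by case: (A j x) (B j x) => a1 a2 [b1 b2] /=; ring.
rewrite -[leLHS]real_normK ?num_real //; apply: lerXn2r; rewrite ?nnegrE //.
  by apply: sumr_ge0 => j _; rewrite mulr_ge0 ?cmodulus_ge0.
apply: le_trans (ler_norm_sum _ _ _) _; apply: ler_sum => j _.
by apply: le_trans (normr_Im_le _) _; rewrite cmodulusM cmodulus_conj.
Qed.

(** * The vector-valued inequality for trigonometric polynomials *)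

(** With G := - sum_j A_j conj(B_j), every frequency of G is at least a + c, the
    distance between the two halves of the spectrum.  Integrating [riesz_pointwise]
    against the weight, the term in G vanishes. *)
Lemma riesz_trig_weighted (R : realType) (m : nat) : exists2 C : R, 0 < C &
  forall (b a c : R) (A B : nat -> seq (R[i] * R)) (J : nat),
  0 < b -> b <= a + c ->
  (forall j, all (fun cl => a <= cl.2) (A j)) ->
  (forall j, all (fun cl => cl.2 <= - c) (B j)) ->
  (\int[lebesgue_measure]_x ((sum_sqr J (fun j x => (trig_poly (A j) x - trig_poly (B j) x)%R) x
      ^+ (2 ^ m))%R%:E * (fejer (b * x))%:E) <=
   C%:E * \int[lebesgue_measure]_x ((sum_sqr J (fun j x => (trig_poly (A j) x + trig_poly (B j) x)%R) x
      ^+ (2 ^ m))%R%:E * (fejer (b * x))%:E))%E.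
Proof.
have [r [C [r0 C0 hr]]] := riesz_pointwise R m.
exists C => // b a c A B J b0 bac hA hB.
set X := sum_sqr J _; set Y := sum_sqr J (fun j x => _ + _).
set q := (2 ^ m)%N.
pose G x := - \sum_(0 <= j < J) trig_poly (A j) x * ((trig_poly (B j) x)^*)%C.
have hG : freq_ge b (fun x => G x ^+ q).
  rewrite (_ : q = q.-1.+1); last by rewrite prednK // expn_gt0.
  apply: freq_geX; first exact: ltW.
  apply: (@freq_geW _ (a + c)) => //.
  have [s hs Gs] : freq_ge (a + c) (fun x =>
      \sum_(0 <= j < J) trig_poly (A j) x * ((trig_poly (B j) x)^*)%C).
    apply: freq_ge_sum => j; apply: freq_geM.
      exact: freq_ge_trig.
    exact: freq_ge_conj.
  exists [seq (- cl.1, cl.2) | cl <- s]; first by rewrite all_map.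
  by move=> x; rewrite /G Gs trig_poly_opp.
have [iG eG] := freq_ge_fejer_eq0 b0 hG.
have [MX hMX] : exists M, forall x, `|X x ^+ q| <= M.
  have [M hM] := sum_sqr_trig_bounded J (fun j => A j ++ [seq (- cl.1, cl.2) | cl <- B j]) q.
  exists M => x; rewrite (_ : X x = sum_sqr J
    (fun j => trig_poly (A j ++ [seq (- cl.1, cl.2) | cl <- B j])) x) //.
  by apply: eq_bigr => j _; rewrite trig_poly_cat trig_poly_opp.
have [MY hMY] : exists M, forall x, `|Y x ^+ q| <= M.
  have [M hM] := sum_sqr_trig_bounded J (fun j => A j ++ B j) q.
  exists M => x; rewrite (_ : Y x = sum_sqr J (fun j => trig_poly (A j ++ B j)) x) //.
  by apply: eq_bigr => j _; rewrite trig_poly_cat.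
have mY : measurable_fun [set: R] Y.
  apply: measurable_sum_sqr => j.
  rewrite (_ : (fun x => _) = trig_poly (A j ++ B j)); first exact: cmeasurable_trig_poly.
  by apply/funext => x; rewrite trig_poly_cat.
have mX : measurable_fun [set: R] X.
  apply: measurable_sum_sqr => j.
  rewrite (_ : (fun x => _) = trig_poly (A j ++ [seq (- cl.1, cl.2) | cl <- B j])).
    exact: cmeasurable_trig_poly.
  by apply/funext => x; rewrite trig_poly_cat trig_poly_opp.
have iX := integrable_fejer_bounded b0 (measurable_funX q mX) hMX.
have iY := integrable_fejer_bounded b0 (measurable_funX q mY) hMY.
have E (Z : R -> R) : (\int[@lebesgue_measure R]_x ((Z x ^+ q)%:E * (fejer (b * x))%:E) =
    \int[@lebesgue_measure R]_x (fejer (b * x) * Z x ^+ q)%:E)%E.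
  by apply: eq_integral => x _; rewrite muleC -EFinM.
rewrite !E.
have fin (Z : R -> R) : (@lebesgue_measure R).-integrable [set: R]
    (EFin \o (fun x => fejer (b * x) * Z x ^+ q)) ->
    (\int[@lebesgue_measure R]_x (fejer (b * x) * Z x ^+ q)%:E =
    (\int[@lebesgue_measure R]_x (fejer (b * x) * Z x ^+ q))%:E)%E.
  by move=> iZ; rewrite fineK //; exact: integrable_fin_num.
rewrite !fin // -EFinM lee_fin.
have iYC := integrableZl measurableT C iY.
have iGr := integrableZl measurableT r iG.
apply: (@le_trans _ _ (\int[@lebesgue_measure R]_x
   (r * (fejer (b * x) * complex.Re (G x ^+ q)) + C * (fejer (b * x) * Y x ^+ q)))).
  apply: le_Rintegral => //.
    by have := integrableD measurableT iGr iYC; apply: eq_integrable.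
  move=> x _; rewrite !(mulrCA _ (fejer _)) -mulrDr ler_wpM2l ?fejer_ge0 //.
  have [h1 h2] := sum_sqr_polarization J (fun j => trig_poly (A j)) (fun j => trig_poly (B j)) x.
  by apply: hr => //; exact: sum_sqr_ge0.
by rewrite RintegralD // !RintegralZl // eG mulr0 add0r.
Qed.

Lemma unit_integral_le_weighted (R : realType) (b : R) (F : R -> R) :
  0 < b <= 1 -> measurable_fun [set: R] F -> (forall x, 0 <= F x) ->
  (\int[lebesgue_measure]_(x in `[0%R, 1%R]) (F x)%:E <=
   8%:E * \int[lebesgue_measure]_x ((F x)%:E * (fejer (b * x))%:E))%E.
Proof.
move=> /andP[b0 b1] mF F0.
have mw : measurable_fun [set: R] (fun x => ((F x)%:E * (fejer (b * x))%:E)%E).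
  apply: emeasurable_funM; apply/measurable_EFinP => //.
  by apply: (measurableT_comp (@measurable_fejer R)); exact: measurable_funM.
have w0 x : (0 <= (F x)%:E * (fejer (b * x))%:E)%E.
  by rewrite mule_ge0 // lee_fin ?fejer_ge0.
apply: (@le_trans _ _ (8%:E * \int[lebesgue_measure]_(x in `[0%R, 1%R])
    ((F x)%:E * (fejer (b * x))%:E))%E); last first.
  by rewrite lee_wpmul2l ?lee_fin // ge0_subset_integral.
have mw1 : measurable_fun (`[0, 1]%classic : set R)
    (fun x => ((F x)%:E * (fejer (b * x))%:E)%E) by exact: measurable_funTS.
rewrite -ge0_integralZl_EFin //.
apply: ge0_le_integral => //.
- by move=> x _; rewrite lee_fin.
- by apply/measurable_EFinP; apply: measurable_funTS.
- by apply: emeasurable_funM.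
move=> x /=; rewrite in_itv /= => /andP[x0 x1].
rewrite -!EFinM lee_fin mulrCA -[leLHS]mulr1 ler_wpM2l //.
have : 1 / 8 <= fejer (b * x) by apply: fejer_ge; rewrite mulr_ge0 ?mulr_ile1 // ltW.
lra.
Qed.

(** Translating to the unit interval at the origin, where the weight is at least
    1/8, passes from the local to the weighted integral; [fejer_weight_le] passes back
    to a supremum of local integrals. *)
Lemma riesz_trig_local (R : realType) (m : nat) (b : R) : 0 < b <= 1 ->
  exists2 C : R, 0 < C &
  forall (a c : R) (A B : nat -> seq (R[i] * R)) (J : nat) (M : \bar R),
  b <= a + c ->
  (forall j, all (fun cl => a <= cl.2) (A j)) ->
  (forall j, all (fun cl => cl.2 <= - c) (B j)) ->
  (forall y, \int[lebesgue_measure]_(x in `[y, (y + 1)%R])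
     (sum_sqr J (fun j x => trig_poly (A j) x + trig_poly (B j) x) x ^+ (2 ^ m))%:E
     <= M)%E ->
  forall y, (\int[lebesgue_measure]_(x in `[y, (y + 1)%R])
     (sum_sqr J (fun j x => trig_poly (A j) x - trig_poly (B j) x) x ^+ (2 ^ m))%:E
     <= C%:E * M)%E.
Proof.
move=> hb; have /andP[b0 b1] := hb.
have [C C0 hC] := riesz_trig_weighted R m.
exists (8 * C * (9 * (pi / b))).
  by rewrite !mulr_gt0 ?invr_gt0 ?pi_gt0.
move=> a c A B J M bac hA hB hM y.
have mT (s t : nat -> seq (R[i] * R)) (e : R) : measurable_fun [set: R]
    (sum_sqr J (fun j x => trig_poly (s j) x + e%:C * trig_poly (t j) x)).
  apply: measurable_sum_sqr => j.
  rewrite (_ : (fun x => _) = trig_poly (s j ++ [seq (e%:C * cl.1, cl.2) | cl <- t j])).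
    exact: cmeasurable_trig_poly.
  apply/funext => x; rewrite trig_poly_cat; congr (_ + _).
  by rewrite /trig_poly big_map mulr_sumr; apply: eq_bigr => cl _ /=; rewrite mulrA.
set X := sum_sqr J _; set Y := sum_sqr J (fun j x => _ + _) in hM.
have mX : measurable_fun [set: R] X.
  rewrite (_ : X = sum_sqr J (fun j x => trig_poly (A j) x + (-1)%:C * trig_poly (B j) x)) //.
  by apply/funext => x; apply: eq_bigr => j _; rewrite rmorphN rmorph1 mulN1r.
have mY : measurable_fun [set: R] Y.
  rewrite (_ : Y = sum_sqr J (fun j x => trig_poly (A j) x + 1%:C * trig_poly (B j) x)) //.
  by apply/funext => x; apply: eq_bigr => j _; rewrite rmorph1 mul1r.
have mXq : measurable_fun [set: R] (fun x => (X x ^+ (2 ^ m))%:E).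
  by apply/measurable_EFinP; exact: measurable_funX.
have mYq : measurable_fun [set: R] (fun x => (Y x ^+ (2 ^ m))%:E).
  by apply/measurable_EFinP; exact: measurable_funX.
have X0 x : (0 <= (X x ^+ (2 ^ m))%:E)%E by rewrite lee_fin exprn_ge0 ?sum_sqr_ge0.
have Y0 x : (0 <= (Y x ^+ (2 ^ m))%:E)%E by rewrite lee_fin exprn_ge0 ?sum_sqr_ge0.
rewrite -{1}[y]add0r (_ : y + 1 = 1 + y); last by rewrite addrC.
rewrite -(@integral_itv_shift R 0 1 y (fun x => (X x ^+ (2 ^ m))%:E)) //.
have mXy : measurable_fun [set: R] (fun x => X (x + y) ^+ (2 ^ m)).
  apply: measurable_funX; apply: (measurableT_comp mX); exact: measurable_funD.
apply: le_trans (@unit_integral_le_weighted R b (fun x => X (x + y) ^+ (2 ^ m)) hb mXy _) _.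
  by move=> x; rewrite exprn_ge0 ?sum_sqr_ge0.
rewrite -!mulrA EFinM -!muleA lee_wpmul2l ?lee_fin //.
have hA' j : all (fun cl => a <= cl.2) (translate_trig y (A j)) by rewrite all_map.
have hB' j : all (fun cl => cl.2 <= - c) (translate_trig y (B j)) by rewrite all_map.
have := hC b a c (fun j => translate_trig y (A j)) (fun j => translate_trig y (B j)) J b0 bac hA' hB'.
under eq_integral => x _.
  rewrite (_ : sum_sqr _ _ _ = X (x + y)); last first.
    by apply: eq_bigr => j _; rewrite !translate_trigE.
  over.
under [in leRHS]eq_integral => x _.
  rewrite (_ : sum_sqr _ _ _ = Y (x + y)); last first.
    by apply: eq_bigr => j _; rewrite !translate_trigE.
  over.
move=> h; apply: le_trans h _.
rewrite EFinM -!muleA lee_wpmul2l ?lee_fin ?(ltW C0) //.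
apply: (@fejer_weight_le R b (fun x => (Y (x + y) ^+ (2 ^ m))%:E) M hb).
- by apply: (measurableT_comp mYq); exact: measurable_funD.
- by move=> x; exact: Y0.
- move=> x; rewrite (integral_itv_shift _ _ _ mYq Y0) addrAC; exact: hM.
Qed.

(** * Limits of complex functions at infinity *)

(** Stated with the modulus, for the sake of estimates, rather than through real
    and imaginary parts as [clim_pinfty]; [tends_to_clim] relates the two. *)
Definition tends_to (R : realType) (F : R -> R[i]) (l : R[i]) :=
  forall e : R, 0 < e -> \forall T \near +oo, cmodulus (F T - l) <= e.

Lemma cmodulusB (R : realType) (z w : R[i]) : cmodulus (z - w) = cmodulus (w - z).
Proof. by rewrite -cmodulusN opprB. Qed.

Lemma tends_to_clim (R : realType) (F : R -> R[i]) l :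
  tends_to F l -> clim_pinfty F = l.
Proof.
case: l => a b hF; rewrite /clim_pinfty; congr (_ +i* _).
- apply/cvg_lim => //; apply/cvgrPdist_le => e e0.
  apply: filterS (hF e e0) => T; apply: le_trans.
  apply: le_trans (normr_Re_le _); case: (F T) => u v /=.
  by rewrite distrC.
- apply/cvg_lim => //; apply/cvgrPdist_le => e e0.
  apply: filterS (hF e e0) => T; apply: le_trans.
  apply: le_trans (normr_Im_le _); case: (F T) => u v /=.
  by rewrite distrC.
Qed.

Lemma tends_to_unique (R : realType) (F : R -> R[i]) l l' :
  tends_to F l -> tends_to F l' -> l = l'.
Proof. by move=> /tends_to_clim <- /tends_to_clim. Qed.

(** Approximate limits of every precision make F Cauchy at infinity. *)
Lemma tends_to_cauchy (R : realType) (F : R -> R[i]) :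
  (forall e : R, 0 < e -> exists l, \forall T \near +oo, cmodulus (F T - l) <= e) ->
  tends_to F (clim_pinfty F).
Proof.
move=> hF.
have hc (g : R[i] -> R) : (forall z w, `|g z - g w| <= cmodulus (z - w)) ->
    cvg (g (F T) @[T --> +oo]).
  move=> gl; apply/cauchy_cvgP/cauchy_ballP => e e0.
  have e4 : 0 < e / 4 by rewrite divr_gt0.
  have [l hl] := hF _ e4.
  exists ([set x | `|x - g l| <= e / 4], [set x | `|x - g l| <= e / 4]) => /=.
    by split; apply: filterS hl => T; apply: le_trans; exact: gl.
  move=> [x y] /= [h1 h2]; rewrite /ball /=.
  have -> : x - y = (x - g l) - (y - g l) by ring.
  apply: le_lt_trans (ler_normB _ _) _; lra.
have cRe : cvg (complex.Re (F T) @[T --> +oo]).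
  by apply: hc => -[a b] [c d] /=; exact: (normr_Re_le (_ +i* _)).
have cIm : cvg (complex.Im (F T) @[T --> +oo]).
  by apply: hc => -[a b] [c d] /=; exact: (normr_Im_le ((a - c) +i* (b - d))).
move=> e e0; have e2 : 0 < e / 2 by rewrite divr_gt0.
have /cvgrPdist_le/(_ _ e2) h1 := cRe; have /cvgrPdist_le/(_ _ e2) h2 := cIm.
apply: filterS2 h1 h2 => T; rewrite /clim_pinfty => h1 h2.
apply: le_trans (cmodulus_le_ReIm _) _.
move: h1 h2; case: (F T) => a b /=; rewrite distrC => h1; rewrite distrC => h2.
lra.
Qed.

Lemma tends_toD (R : realType) (F G : R -> R[i]) l l' :
  tends_to F l -> tends_to G l' -> tends_to (fun T => F T + G T) (l + l').
Proof.
move=> hF hG e e0; have e2 : 0 < e / 2 by rewrite divr_gt0.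
apply: filterS2 (hF _ e2) (hG _ e2) => T h1 h2.
rewrite (_ : _ - _ = (F T - l) + (G T - l')); last by ring.
by apply: le_trans (cmodulusD _ _) _; lra.
Qed.

Lemma tends_toZ (R : realType) (c : R[i]) (F : R -> R[i]) l :
  tends_to F l -> tends_to (fun T => c * F T) (c * l).
Proof.
move=> hF e e0.
have c1 : 0 < cmodulus c + 1 by rewrite ltr_wpDl ?cmodulus_ge0.
have e2 : 0 < e / (cmodulus c + 1) by rewrite divr_gt0.
apply: filterS (hF _ e2) => T h; rewrite -mulrBr cmodulusM.
rewrite ler_pdivlMr // in h; apply: le_trans h.
by rewrite mulrC ler_wpM2l ?cmodulus_ge0 // lerDl.
Qed.

Lemma tends_to_cst (R : realType) (c : R[i]) : tends_to (fun _ : R => c) c.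
Proof. by move=> e e0; apply: nearW => T; rewrite subrr cmodulus0 ltW. Qed.

Lemma tends_to_sum (R : realType) (I : Type) (r : seq I) (F : I -> R -> R[i]) l :
  (forall i, tends_to (F i) (l i)) ->
  tends_to (fun T => \sum_(i <- r) F i T) (\sum_(i <- r) l i).
Proof.
move=> hF; elim: r => [|i r IH].
  rewrite big_nil (_ : (fun T => _) = fun=> 0); first exact: tends_to_cst.
  by apply/funext => T; rewrite big_nil.
rewrite big_cons (_ : (fun T => _) = fun T => F i T + \sum_(j <- r) F j T).
  exact: tends_toD.
by apply/funext => T; rewrite big_cons.
Qed.

Lemma tends_to_le (R : realType) (F : R -> R[i]) l (B : R) :
  tends_to F l -> (\forall T \near +oo, cmodulus (F T) <= B) -> cmodulus l <= B.
Proof.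
move=> hF hB; apply/ler_addgt0Pr => e e0.
have [T [h1 h2]] := filter_ex (filterI (hF _ e0) hB).
rewrite (_ : l = F T - (F T - l)); last by ring.
by apply: le_trans (cmodulusD _ _) _; rewrite cmodulusN lerD.
Qed.

Lemma eq_mean_to (R : realType) (F G : R -> R[i]) l :
  (\forall T \near +oo, F T = G T) -> tends_to F l -> tends_to G l.
Proof. by move=> FG hF e e0; apply: filterS2 FG (hF e e0) => T ->. Qed.

(** * Uniform bounds over unit intervals *)

(** The bound on the p-th power of the Stepanov norm, without extracting the
    root: the estimates below add and compare such powers.  The value A may be
    infinite. *)
Definition stepanov_bound (R : realType) (p : nat) (h : R -> R[i]) (A : \bar R) :=
  forall x, (\int[lebesgue_measure]_(s in `[x, (x + 1)%R])
    (cmodulus (h s) ^+ p)%:E <= A)%E.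

Definition stepanov_bounded (R : realType) (f : R -> R[i]) :=
  cmeasurable f /\ exists A : R, stepanov_bound 1 f A%:E.

Lemma cmeasurableD (R : realType) (f g : R -> R[i]) :
  cmeasurable f -> cmeasurable g -> cmeasurable (fun x => f x + g x).
Proof.
move=> [f1 f2] [g1 g2]; split.
  rewrite (_ : (fun x => _) = (fun x => complex.Re (f x) + complex.Re (g x))).
    exact: measurable_funD.
  by apply/funext => x; rewrite Re_addc.
rewrite (_ : (fun x => _) = (fun x => complex.Im (f x) + complex.Im (g x))).
  exact: measurable_funD.
by apply/funext => x; rewrite Im_addc.
Qed.

Lemma cmeasurableM (R : realType) (f g : R -> R[i]) :
  cmeasurable f -> cmeasurable g -> cmeasurable (fun x => f x * g x).
Proof.
move=> [f1 f2] [g1 g2]; split.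
  rewrite (_ : (fun x => _) = (fun x => complex.Re (f x) * complex.Re (g x) -
     complex.Im (f x) * complex.Im (g x))).
    by apply: measurable_funB; apply: measurable_funM.
  by apply/funext => x; rewrite Re_mulc.
rewrite (_ : (fun x => _) = (fun x => complex.Re (f x) * complex.Im (g x) +
   complex.Im (f x) * complex.Re (g x))).
  by apply: measurable_funD; apply: measurable_funM.
by apply/funext => x; rewrite Im_mulc.
Qed.

Lemma cmeasurable_cst (R : realType) (c : R[i]) : cmeasurable (fun _ : R => c).
Proof. by split; exact: measurable_cst. Qed.

Lemma cmeasurableB (R : realType) (f g : R -> R[i]) :
  cmeasurable f -> cmeasurable g -> cmeasurable (fun x => f x - g x).
Proof.
move=> mf mg; rewrite (_ : (fun x => _) = (fun x => f x + (-1) * g x)).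
  by apply: cmeasurableD => //; apply: cmeasurableM => //; exact: cmeasurable_cst.
by apply/funext => x; rewrite mulN1r.
Qed.

Lemma trig_poly1 (R : realType) (c : R[i]) (l x : R) :
  trig_poly [:: (c, l)] x = c * cexpi (l * x).
Proof. by rewrite trig_poly_cons trig_poly_nil addr0. Qed.

Lemma cmeasurable_cexpi (R : realType) (l : R) : cmeasurable (fun x => cexpi (l * x)).
Proof.
rewrite (_ : (fun x => _) = trig_poly [:: (1, l)]); first exact: cmeasurable_trig_poly.
by apply/funext => x; rewrite trig_poly1 mul1r.
Qed.

Lemma measurable_cmodulusX (R : realType) (f : R -> R[i]) n : cmeasurable f ->
  measurable_fun [set: R] (fun x => (cmodulus (f x) ^+ n)%:E).
Proof.
by move=> mf; apply/measurable_EFinP; apply: measurable_funX; exact: measurable_cmodulus.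
Qed.

Lemma integral_itv_itvS (R : realType) (a b c : R) (F : R -> \bar R) :
  measurable_fun [set: R] F -> (forall x, 0 <= F x)%E -> a <= b -> b <= c ->
  (\int[lebesgue_measure]_(x in `[a, c]) F x <=
   \int[lebesgue_measure]_(x in `[a, b]) F x + \int[lebesgue_measure]_(x in `[b, c]) F x)%E.
Proof.
move=> mF F0 ab bc.
rewrite (_ : `[a, c]%classic = `[a, b]%classic `|` `]b, c]%classic); last first.
  apply/seteqP; split => x /=; rewrite !in_itv /=.
    by move=> /andP[-> ->] /=; case: (leP x b) => h; [by left|by right].
  move=> [/andP[-> h]|/andP[h ->]] /=; first exact: le_trans bc.
  by rewrite (le_trans ab) // ltW.
rewrite ge0_integral_setU //; last 2 first.
- exact: measurable_funTS.
- by rewrite disj_set2E; apply/eqP; apply/seteqP; split => x //=; rewrite !in_itv /= => -[/andP[_ h1] /andP[]]; rewrite ltNge h1.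
rewrite leeD2l // ge0_subset_integral //; first exact: measurable_funTS.
by move=> x /=; rewrite !in_itv /= => /andP[/ltW -> ->].
Qed.

(** The interval [-T, T] is covered by at most 2 T + 1 unit intervals. *)
Lemma integral_long_le (R : realType) (F : R -> \bar R) (A : R) (T : R) :
  measurable_fun [set: R] F -> (forall x, 0 <= F x)%E ->
  (forall x, \int[lebesgue_measure]_(s in `[x, (x + 1)%R]) F s <= A%:E)%E ->
  0 <= T ->
  (\int[lebesgue_measure]_(x in `[(- T)%R, T]) F x <= ((2 * T + 1) * A)%:E)%E.
Proof.
move=> mF F0 FA T0.
have A0 : 0 <= A by rewrite -lee_fin; apply: le_trans (FA 0); apply: integral_ge0.
have step (a : R) (n : nat) : (\int[lebesgue_measure]_(x in `[a, (a + n%:R)%R]) F x <= (n%:R * A)%:E)%E.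
  elim: n => [|n IH]; first by rewrite addr0 set_itv1 integral_set1 mul0r.
  apply: le_trans (@integral_itv_itvS R a (a + n%:R) (a + n.+1%:R) F mF F0 _ _) _.
  - by rewrite lerDl.
  - by rewrite lerD2l ler_nat.
  by rewrite -natr1 (addrA a) mulrDl mul1r EFinD leeD.
have n1 := truncnS_gt (2 * T).
have n2 : (Num.truncn (2 * T))%:R <= 2 * T by rewrite truncn_le mulr_ge0.
apply: (@le_trans _ _ (\int[lebesgue_measure]_(x in `[(- T)%R, (- T + (Num.truncn (2 * T)).+1%:R)%R]) F x)%E).
  apply: ge0_subset_integral => //; first exact: measurable_funTS.
  by move=> x /=; rewrite !in_itv /= => /andP[-> h] /=; lra.
apply: le_trans (step _ _) _; rewrite lee_fin ler_wpM2r // -natr1; lra.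
Qed.

Lemma integral_cmodulus_long_le (R : realType) (f : R -> R[i]) (A : R) (T : R) :
  cmeasurable f -> stepanov_bound 1 f A%:E -> 0 <= T ->
  (\int[lebesgue_measure]_(x in `[(- T)%R, T]) (cmodulus (f x))%:E <= ((2 * T + 1) * A)%:E)%E.
Proof.
move=> mf fA T0; apply: integral_long_le => //.
- exact: (measurable_cmodulusX 1).
- by move=> x; rewrite lee_fin cmodulus_ge0.
Qed.

Lemma cintegrable_itv (R : realType) (f : R -> R[i]) (a b : R) :
  stepanov_bounded f ->
  (@lebesgue_measure R).-integrable `[a, b] (EFin \o (fun x => complex.Re (f x))) /\
  (@lebesgue_measure R).-integrable `[a, b] (EFin \o (fun x => complex.Im (f x))).
Proof.
move=> [mf [A fA]]; have [mr mi] := mf.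
have fin : (\int[lebesgue_measure]_(x in `[a, b]) (cmodulus (f x))%:E < +oo)%E.
  pose T := `|a| + `|b|.
  apply: le_lt_trans (ltry ((2 * T + 1) * A)).
  apply: le_trans (integral_cmodulus_long_le mf fA _); last by rewrite addr_ge0.
  apply: ge0_subset_integral => //.
  - by apply: measurable_funTS; exact: (measurable_cmodulusX 1).
  - by move=> x _; rewrite lee_fin cmodulus_ge0.
  - move=> x /=; rewrite !in_itv /= => /andP[h1 h2].
    have := ler_norm (- a); have := ler_norm b; rewrite normrN.
    have := normr_ge0 a; have := normr_ge0 b; rewrite /T; lra.
have key (g : R -> R) : measurable_fun [set: R] g -> (forall x, `|g x| <= cmodulus (f x)) ->
    (@lebesgue_measure R).-integrable `[a, b] (EFin \o g).
  move=> mg hg; apply/integrableP; split.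
    by apply/measurable_EFinP; exact: measurable_funTS.
  apply: le_lt_trans fin; apply: ge0_le_integral => //.
  - by apply: measurable_funTS; apply/measurable_EFinP; exact: measurableT_comp.
  - by apply: measurable_funTS; exact: (measurable_cmodulusX 1).
  - by move=> x _ /=; rewrite lee_fin.
by split; apply: key => // x; [exact: normr_Re_le|exact: normr_Im_le].
Qed.

Lemma cintegralD (R : realType) (f g : R -> R[i]) (a b : R) :
  stepanov_bounded f -> stepanov_bounded g ->
  cintegral `[a, b] (fun x => f x + g x) = cintegral `[a, b] f + cintegral `[a, b] g.
Proof.
move=> /(cintegrable_itv a b)[f1 f2] /(cintegrable_itv a b)[g1 g2].
rewrite /cintegral.
under eq_Rintegral do rewrite Re_addc.
under [X in _ +i* X = _]eq_Rintegral do rewrite Im_addc.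
by rewrite !RintegralD.
Qed.

Lemma cintegralZ (R : realType) (c : R[i]) (f : R -> R[i]) (a b : R) :
  stepanov_bounded f ->
  cintegral `[a, b] (fun x => c * f x) = c * cintegral `[a, b] f.
Proof.
move=> /(cintegrable_itv a b)[f1 f2].
have iZ (r : R) (g : R -> R) : (@lebesgue_measure R).-integrable `[a, b] (EFin \o g) ->
    (@lebesgue_measure R).-integrable `[a, b] (EFin \o (fun x => r * g x)).
  by move=> ig; have := @integrableZl _ _ _ lebesgue_measure `[a, b]%classic
    (measurable_itv _) r _ ig; apply: eq_integrable.
rewrite /cintegral.
under eq_Rintegral do rewrite Re_mulc.
under [X in _ +i* X = _]eq_Rintegral do rewrite Im_mulc.
rewrite RintegralB ?RintegralD //; try exact: iZ.
by rewrite !RintegralZl //; case: c.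
Qed.

(** The factor 2 comes from estimating the real and imaginary parts
    separately. *)
Lemma cmodulus_cintegral_le (R : realType) (f : R -> R[i]) (a b : R) :
  stepanov_bounded f ->
  ((cmodulus (cintegral `[a, b] f))%:E <=
   2%:E * \int[lebesgue_measure]_(x in `[a, b]) (cmodulus (f x))%:E)%E.
Proof.
move=> hf; have [f1 f2] := cintegrable_itv a b hf; have [mf _] := hf.
have key (g : R -> R) : (@lebesgue_measure R).-integrable `[a, b] (EFin \o g) ->
    (forall x, `|g x| <= cmodulus (f x)) ->
    (`|\int[@lebesgue_measure R]_(x in `[a, b]) g x|%:E <=
    \int[lebesgue_measure]_(x in `[a, b]) (cmodulus (f x))%:E)%E.
  move=> ig hg; rewrite EFin_normr_Rintegral //.
  apply: le_trans (le_abse_integral _ _ _) _ => //; first exact: measurable_int ig.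
  apply: ge0_le_integral => //.
  - by apply: measurableT_comp => //; exact: measurable_int ig.
  - by apply: measurable_funTS; exact: (measurable_cmodulusX 1).
  - by move=> x _ /=; rewrite lee_fin.
apply: (@le_trans _ _ (`|complex.Re (cintegral `[a, b] f)| + `|complex.Im (cintegral `[a, b] f)|)%:E).
  by rewrite lee_fin cmodulus_le_ReIm.
rewrite mule_natl mule2n EFinD.
by apply: leeD; apply: key => // x; [exact: normr_Re_le|exact: normr_Im_le].
Qed.

Lemma stepanov_boundedD (R : realType) (f g : R -> R[i]) :
  stepanov_bounded f -> stepanov_bounded g -> stepanov_bounded (fun x => f x + g x).
Proof.
move=> [mf [A fA]] [mg [B gB]]; split; first exact: cmeasurableD.
exists (A + B) => x; rewrite EFinD; apply: le_trans (leeD (fA x) (gB x)).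
have mF := measurable_cmodulusX 1 mf; have mG := measurable_cmodulusX 1 mg.
rewrite -ge0_integralD //; last 4 first.
- by move=> s _; rewrite lee_fin cmodulus_ge0.
- exact: measurable_funTS.
- by move=> s _; rewrite lee_fin cmodulus_ge0.
- exact: measurable_funTS.
apply: ge0_le_integral => //.
- by move=> s _; rewrite lee_fin cmodulus_ge0.
- by apply: measurable_funTS; apply: measurable_cmodulusX; exact: cmeasurableD.
- by apply: emeasurable_funD; apply: measurable_funTS.
- by move=> s _; rewrite -EFinD lee_fin !expr1 cmodulusD.
Qed.

Lemma stepanov_boundedM (R : realType) (f g : R -> R[i]) (M : R) :
  stepanov_bounded f -> cmeasurable g -> (forall x, cmodulus (g x) <= M) ->
  stepanov_bounded (fun x => g x * f x).
Proof.
move=> [mf [A fA]] mg gM; split; first exact: cmeasurableM.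
have M0 : 0 <= M by apply: le_trans (gM 0); exact: cmodulus_ge0.
exists (M * A) => x; rewrite EFinM.
apply: (@le_trans _ _ (M%:E * \int[lebesgue_measure]_(s in `[x, (x + 1)%R]) (cmodulus (f s) ^+ 1)%:E)%E); last first.
  by rewrite lee_wpmul2l ?lee_fin.
have mF := measurable_cmodulusX 1 mf.
rewrite -ge0_integralZl_EFin //; last 2 first.
- by move=> s _; rewrite lee_fin cmodulus_ge0.
- exact: measurable_funTS.
apply: ge0_le_integral => //.
- by move=> s _; rewrite lee_fin cmodulus_ge0.
- by apply: measurable_funTS; apply: measurable_cmodulusX; exact: cmeasurableM.
- by apply: emeasurable_funM => //; apply: measurable_funTS.
- by move=> s _; rewrite -EFinM lee_fin !expr1 cmodulusM ler_wpM2r ?cmodulus_ge0.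
Qed.

Lemma stepanov_bounded_cst1 (R : realType) : stepanov_bounded (fun _ : R => 1%:C : R[i]).
Proof.
split; first exact: cmeasurable_cst.
exists 1 => x; under eq_integral do rewrite expr1 cmodulus_real normr1.
by rewrite integral_unit_cst.
Qed.

Lemma stepanov_boundedZ (R : realType) (c : R[i]) (f : R -> R[i]) :
  stepanov_bounded f -> stepanov_bounded (fun x => c * f x).
Proof.
move=> hf; exact: (@stepanov_boundedM _ f (fun=> c) (cmodulus c) hf (cmeasurable_cst c)).
Qed.

Lemma stepanov_bounded_trig (R : realType) (s : seq (R[i] * R)) :
  stepanov_bounded (trig_poly s).
Proof.
rewrite (_ : trig_poly s = fun x => trig_poly s x * 1%:C).
  apply: (@stepanov_boundedM _ _ _ _ (stepanov_bounded_cst1 R) (cmeasurable_trig_poly s)).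
  exact: trig_poly_bounded.
by apply/funext => x; rewrite mulr1.
Qed.

Lemma stepanov_bounded_cexpi (R : realType) (l : R) (f : R -> R[i]) :
  stepanov_bounded f -> stepanov_bounded (fun x => f x * cexpi (l * x)).
Proof.
move=> hf; rewrite (_ : (fun x => _) = (fun x => cexpi (l * x) * f x)).
  apply: (@stepanov_boundedM _ _ _ 1 hf (cmeasurable_cexpi l)) => x.
  by rewrite cmodulus_cexpi.
by apply/funext => x; rewrite mulrC.
Qed.

(** * Mean values *)

Definition cmean (R : realType) (f : R -> R[i]) (T : R) : R[i] :=
  ((2 * T)^-1)%:C * cintegral `[- T, T] f.

Lemma cmeanD (R : realType) (f g : R -> R[i]) T :
  stepanov_bounded f -> stepanov_bounded g ->
  cmean (fun x => f x + g x) T = cmean f T + cmean g T.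
Proof. by move=> hf hg; rewrite /cmean cintegralD // mulrDr. Qed.

Lemma cmeanZ (R : realType) (c : R[i]) (f : R -> R[i]) T :
  stepanov_bounded f -> cmean (fun x => c * f x) T = c * cmean f T.
Proof. by move=> hf; rewrite /cmean cintegralZ // mulrCA. Qed.

Lemma stepanov_bounded_sum (R : realType) (I : Type) (r : seq I) (f : I -> R -> R[i]) :
  (forall i, stepanov_bounded (f i)) -> stepanov_bounded (fun x => \sum_(i <- r) f i x).
Proof.
move=> hf; elim: r => [|i r IH].
  rewrite (_ : (fun x => _) = trig_poly [::]); first exact: stepanov_bounded_trig.
  by apply/funext => x; rewrite big_nil trig_poly_nil.
rewrite (_ : (fun x => _) = (fun x => f i x + \sum_(j <- r) f j x)).
  exact: stepanov_boundedD.
by apply/funext => x; rewrite big_cons.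
Qed.

Lemma cmean_sum (R : realType) (I : Type) (r : seq I) (f : I -> R -> R[i]) T :
  (forall i, stepanov_bounded (f i)) ->
  cmean (fun x => \sum_(i <- r) f i x) T = \sum_(i <- r) cmean (f i) T.
Proof.
move=> hf; elim: r => [|i r IH].
  rewrite big_nil (_ : (fun x => _) = fun x => 0 * trig_poly [::] x).
    by rewrite cmeanZ ?mul0r //; exact: stepanov_bounded_trig.
  by apply/funext => x; rewrite big_nil mul0r.
rewrite big_cons -IH -cmeanD //; last exact: stepanov_bounded_sum.
by congr (cmean _ _); apply/funext => x; rewrite big_cons.
Qed.

(** The constant is 2 from [cmodulus_cintegral_le], times
    (2 T + 1) / (2 T) <= 3 / 2 for T >= 1. *)
Lemma cmodulus_cmean_le (R : realType) (f : R -> R[i]) (A T : R) :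
  cmeasurable f -> stepanov_bound 1 f A%:E -> 1 <= T ->
  cmodulus (cmean f T) <= 3 * A.
Proof.
move=> mf fA T1; have T0 : 0 < T by apply: lt_le_trans T1.
have A0 : 0 <= A.
  rewrite -lee_fin; apply: le_trans (fA 0); apply: integral_ge0 => x _.
  by rewrite lee_fin exprn_ge0 ?cmodulus_ge0.
rewrite /cmean cmodulusM cmodulus_real ger0_norm ?invr_ge0 ?mulr_ge0 ?(ltW T0) //.
rewrite mulrC ler_pdivrMr ?mulr_gt0 //.
have hf : stepanov_bounded f by split => //; exists A.
have := le_trans (cmodulus_cintegral_le (- T) T hf) (lee_wpmul2l _ (integral_cmodulus_long_le mf fA (ltW T0))).
rewrite -EFinM lee_fin => /(_ (ler0n _ 2)) h.
rewrite lee_fin in h; apply: (le_trans h); have := ler_wpM2r A0 T1; lra.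
Qed.

Lemma Rintegral_cos_sin_le (R : realType) (theta T : R) : theta != 0 -> 0 < T ->
  `|\int[@lebesgue_measure R]_(x in `[- T, T]) cos (theta * x)| <= 2 / `|theta| /\
  `|\int[@lebesgue_measure R]_(x in `[- T, T]) sin (theta * x)| <= 2 / `|theta|.
Proof.
move=> th0 T0.
have TT : - T < T by lra.
have dl (x : R) : is_derive x 1 (fun x : R => theta * x) theta.
  have : is_derive x (1 : R) (theta \*: (@id R)) theta.
    by apply: is_derive_eq; rewrite /GRing.scale /= mulr1.
  exact.
have ds (x : R) : is_derive x 1 (fun x : R => theta^-1 * sin (theta * x)) (cos (theta * x)).
  have h : is_derive x (1 : R) (sin \o (fun x : R => theta * x)) (cos (theta * x) * theta).
    exact: is_derive1_comp.
  have : is_derive x (1 : R) (theta^-1 \*: (sin \o (fun x : R => theta * x))) (cos (theta * x)).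
    by apply: is_derive_eq; rewrite /GRing.scale /= mulrCA mulVf // mulr1.
  exact.
have dc (x : R) : is_derive x 1 (fun x : R => - theta^-1 * cos (theta * x)) (sin (theta * x)).
  have h : is_derive x (1 : R) (cos \o (fun x : R => theta * x)) (- sin (theta * x) * theta).
    exact: is_derive1_comp.
  have : is_derive x (1 : R) ((- theta^-1) \*: (cos \o (fun x : R => theta * x))) (sin (theta * x)).
    by apply: is_derive_eq; rewrite /GRing.scale /= mulNr mulNr mulrN opprK mulrCA mulVf // mulr1.
  exact.
have FTC (f F : R -> R) : continuous f -> (forall x : R, is_derive x 1 F (f x)) ->
    (forall x, `|F x| <= `|theta|^-1) ->
    `|\int[@lebesgue_measure R]_(x in `[- T, T]) f x| <= 2 / `|theta|.
  move=> cf dF hF.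
  have cF : continuous F.
    move=> x; apply: differentiable_continuous; apply/derivable1_diffP.
    by have [] := dF x.
  rewrite /Rintegral (@continuous_FTC2 R f F (- T) T TT).
  - rewrite -EFinB /=; apply: le_trans (ler_normB _ _) _.
    by rewrite mulrDl !mul1r; apply: lerD.
  - exact: continuous_subspaceT.
  - split; first by move=> x _; have [] := dF x.
      by apply: cvg_at_right_filter; exact: cF.
    by apply: cvg_at_left_filter; exact: cF.
  - by move=> x _; rewrite derive1E; have [_ ->] := dF x.
have cl : continuous (fun x : R => theta * x) by exact: mulrl_continuous.
split.
  apply: (FTC _ _ _ ds).
    by move=> x; apply: continuous_comp; [exact: cl|exact: continuous_cos].
  by move=> x; rewrite normrM normfV ler_piMr ?invr_ge0 // sin_max.
apply: (FTC _ _ _ dc).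
  by move=> x; apply: continuous_comp; [exact: cl|exact: continuous_sin].
by move=> x; rewrite normrM normrN normfV ler_piMr ?invr_ge0 // cos_max.
Qed.

(** The integral of an oscillating exponential over [-T, T] stays bounded, so its
    mean tends to 0. *)
Lemma mean_cexpi (R : realType) (theta : R) :
  tends_to (cmean (fun x => cexpi (theta * x))) (if theta == 0 then 1 else 0).
Proof.
case: eqVneq => [->|th0].
  apply: (@eq_mean_to _ (fun=> 1)); last exact: tends_to_cst.
  near=> T; have T0 : 0 < T by near: T; exact: nbhs_pinfty_gt.
  rewrite /cmean /cintegral.
  under eq_Rintegral do rewrite mul0r cexpi0.
  under [X in _ +i* X]eq_Rintegral do rewrite mul0r cexpi0.
  rewrite /= !Rintegral_cst //= lebesgue_measure_itv /= lte_fin.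
  rewrite (_ : - T < T); last by rewrite gtrN.
  rewrite /= mul0r opprK mul1r.
  by apply/eqP; rewrite eq_complex /=; apply/andP; split; apply/eqP; field; rewrite gt_eqF.
move=> e e0; near=> T; have T0 : 0 < T by near: T; exact: nbhs_pinfty_gt.
have h : 2 / `|theta| / e <= T by near: T; apply: nbhs_pinfty_ge; exact: num_real.
rewrite subr0 /cmean cmodulusM cmodulus_real ger0_norm ?invr_ge0 ?mulr_ge0 ?(ltW T0) //.
rewrite mulrC ler_pdivrMr ?mulr_gt0 //.
have [h1 h2] := Rintegral_cos_sin_le th0 T0.
apply: le_trans (cmodulus_le_ReIm _) _; rewrite /cintegral /=.
rewrite ler_pdivrMr // in h.
apply: (le_trans (lerD h1 h2)); lra.
Unshelve. all: by end_near. Qed.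

(** A frequency may occur several times in the list, hence a sum. *)
Definition trig_coef (R : realType) (s : seq (R[i] * R)) (lambda : R) : R[i] :=
  \sum_(cl <- s | cl.2 == lambda) cl.1.

Lemma mean_trig_poly (R : realType) (s : seq (R[i] * R)) (lambda : R) :
  tends_to (cmean (fun x => trig_poly s x * cexpi (- (lambda * x)))) (trig_coef s lambda).
Proof.
rewrite /trig_coef big_mkcond.
rewrite (_ : cmean _ = fun T => \sum_(cl <- s) cl.1 * cmean (fun x => cexpi ((cl.2 - lambda) * x)) T).
  have := @tends_to_sum R _ s (fun cl T => cl.1 * cmean (fun x => cexpi ((cl.2 - lambda) * x)) T)
    (fun cl => cl.1 * (if cl.2 - lambda == 0 then 1 else 0)) _.
  rewrite (_ : \sum_(i <- s) (if i.2 == lambda then i.1 else 0) =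
    \sum_(cl <- s) cl.1 * (if cl.2 - lambda == 0 then 1 else 0)).
    by apply => cl; apply: tends_toZ; exact: mean_cexpi.
  by apply: eq_bigr => cl _; rewrite subr_eq0; case: ifP => _; rewrite ?mulr1 ?mulr0.
apply/funext => T.
have hb (theta : R) : stepanov_bounded (fun x => cexpi (theta * x)).
  have := stepanov_bounded_trig [:: (1, theta)].
  by rewrite (_ : trig_poly _ = fun x => cexpi (theta * x)) //; apply/funext => x;
     rewrite trig_poly1 mul1r.
under eq_bigr do rewrite -cmeanZ //.
rewrite -cmean_sum; last by move=> cl; exact: stepanov_boundedZ.
congr (cmean _ _); apply/funext => x; rewrite /trig_poly mulr_suml.
by apply: eq_bigr => cl _; rewrite mulrBl cexpiD mulrA.
Qed.

(** * Stepanov spaces and Fourier coefficients *)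

(** Membership in the Stepanov space of exponent p, expressed with
    [stepanov_bound] instead of the norm. *)
Definition stepanov_approx (R : realType) (p : nat) (f : R -> R[i]) :=
  cmeasurable f /\ forall e : R, 0 < e -> exists s,
    stepanov_bound p (fun x => f x - trig_poly s x) e%:E.

Lemma le_poweR (R : realType) (r : R) (x y : \bar R) : 0 <= r -> (0 <= x)%E ->
  (x <= y)%E -> (x `^ r <= y `^ r)%E.
Proof.
move=> r0 x0 xy; apply: gt0_ler_poweR => //; rewrite in_itv /= leey andbT //.
exact: le_trans xy.
Qed.

Lemma exists_pow_le (R : realType) (n : nat) (e : R) : (0 < n)%N -> 0 < e ->
  exists2 d : R, 0 < d & d ^+ n <= e.
Proof.
move=> n0 e0; exists (Num.min e 1); first by rewrite lt_min e0 ltr01.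
have d0 : 0 <= Num.min e 1 by rewrite le_min ltW ?ler01.
apply: (@le_trans _ _ (Num.min e 1 ^+ 1)); last by rewrite expr1 ge_min lexx.
by apply: ler_wiXn2l; rewrite // ge_min lexx orbT.
Qed.

Lemma stepanov_spaceE (R : realType) (n : nat) (f : R -> R[i]) : (0 < n)%N ->
  stepanov_space n%:R f <-> stepanov_approx n f.
Proof.
move=> n0; have nR : (n%:R : R) != 0 by rewrite pnatr_eq0 -lt0n.
have nR0 : 0 < (n%:R : R) by rewrite ltr0n.
have E (h : R -> R[i]) : cstepanov_norm n%:R h = ((ereal_sup (range (fun x : R =>
     \int[@lebesgue_measure R]_(s in `[x, (x + 1)%R]) (cmodulus (h s) ^+ n)%:E))) `^ (n%:R^-1)%R)%E.
  rewrite /cstepanov_norm /stepanov_norm.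
  have -> : (fun x : R => \int[@lebesgue_measure R]_(s in `[x, (x + 1)%R]) (cmodulus (h s))%:E `^ n%:R)%E =
      (fun x : R => \int[@lebesgue_measure R]_(s in `[x, (x + 1)%R]) (cmodulus (h s) ^+ n)%:E)%E; last by [].
  apply/funext => x; apply: eq_integral => s _.
  by rewrite poweR_EFin powR_mulrn ?cmodulus_ge0.
have S0 (h : R -> R[i]) : (0 <= ereal_sup (range (fun x : R =>
     \int[@lebesgue_measure R]_(s in `[x, (x + 1)%R]) (cmodulus (h s) ^+ n)%:E)))%E.
  apply: le_trans (ereal_sup_ubound _) ; last by exists 0.
  by apply: integral_ge0 => s _; rewrite lee_fin exprn_ge0 ?cmodulus_ge0.
split=> -[mf hf]; split=> // e e0.
- have [d d0 de] := exists_pow_le n0 e0.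
  have [s hs] := hf d d0; exists s => x.
  rewrite E in hs; move: hs; set S := ereal_sup _ => hs.
  have hS : (S <= (d ^+ n)%:E)%E.
    have -> : S = ((S `^ n%:R^-1) `^ n%:R)%E.
      by rewrite -poweRrM mulVf // poweRe1 //; exact: S0.
    rewrite -powR_mulrn ?(ltW d0) // -poweR_EFin.
    by apply: le_poweR; rewrite ?(ltW nR0) ?poweR_ge0 ?(ltW hs).
  apply: le_trans (_ : _ <= S)%E _; first by apply: ereal_sup_ubound; exists x.
  by apply: (le_trans hS); rewrite lee_fin.
- have e2 : 0 < e / 2 by rewrite divr_gt0.
  have [s hs] := hf ((e / 2) ^+ n) (exprn_gt0 _ e2); exists s.
  rewrite E; set S := ereal_sup _.
  have hS : (S <= ((e / 2) ^+ n)%:E)%E by apply: ge_ereal_sup => _ [x _ <-]; exact: hs.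
  apply: (@le_lt_trans _ _ (e / 2)%:E); last by rewrite lte_fin; lra.
  have -> : (e / 2)%:E = ((((e / 2) ^+ n)%:E) `^ n%:R^-1)%E.
    by rewrite -powR_mulrn ?(ltW e2) // poweR_EFin -powRrM divff // powRr1 // ltW.
  by apply: le_poweR; rewrite ?invr_ge0 ?(ltW nR0) //; exact: S0.
Qed.

Lemma powD_le (R : realType) (n : nat) (a b : R) : 0 <= a -> 0 <= b ->
  (a + b) ^+ n <= 2 ^+ n * (a ^+ n + b ^+ n).
Proof.
move=> a0 b0; wlog ab : a b a0 b0 / a <= b.
  move=> h; have [/h|/ltW/h] := leP a b; first exact.
  by rewrite addrC [b ^+ n + _]addrC; apply.
apply: (@le_trans _ _ ((2 * b) ^+ n)).
  by apply: lerXn2r; rewrite ?nnegrE ?addr_ge0 ?mulr_ge0 //; lra.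
by rewrite exprMn ler_wpM2l ?exprn_ge0 // lerDr exprn_ge0.
Qed.

Lemma stepanov_boundD (R : realType) (p : nat) (f g : R -> R[i]) (A B : \bar R) :
  cmeasurable f -> cmeasurable g -> stepanov_bound p f A -> stepanov_bound p g B ->
  stepanov_bound p (fun x => f x + g x) ((2 ^+ p)%:E * (A + B)).
Proof.
move=> mf mg fA gB x.
have mF := measurable_cmodulusX p mf; have mG := measurable_cmodulusX p mg.
have X0 (h : R -> R[i]) s : (0 <= (cmodulus (h s) ^+ p)%:E)%E.
  by rewrite lee_fin exprn_ge0 ?cmodulus_ge0.
apply: (@le_trans _ _ ((2 ^+ p)%:E * \int[lebesgue_measure]_(s in `[x, (x + 1)%R])
   ((cmodulus (f s) ^+ p)%:E + (cmodulus (g s) ^+ p)%:E))%E); last first.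
  rewrite lee_wpmul2l ?lee_fin ?exprn_ge0 // ge0_integralD //; last 2 first.
  - exact: measurable_funTS.
  - exact: measurable_funTS.
  by apply: leeD; [exact: fA|exact: gB].
rewrite -ge0_integralZl_EFin ?exprn_ge0 //; last 2 first.
- by move=> s _; rewrite adde_ge0.
- by apply: emeasurable_funD; exact: measurable_funTS.
apply: ge0_le_integral => //.
- by move=> s _; exact: (X0 (fun x => f x + g x)).
- by apply: measurable_funTS; apply: measurable_cmodulusX; exact: cmeasurableD.
- by apply: emeasurable_funM => //; apply: emeasurable_funD; exact: measurable_funTS.
move=> s _; rewrite -EFinD -EFinM lee_fin.
apply: le_trans (powD_le p (cmodulus_ge0 _) (cmodulus_ge0 _)).
apply: lerXn2r; rewrite ?nnegrE ?addr_ge0 ?cmodulus_ge0 //; exact: cmodulusD.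
Qed.

Lemma stepanov_boundN (R : realType) (p : nat) (f : R -> R[i]) (A : \bar R) :
  stepanov_bound p f A -> stepanov_bound p (fun x => - f x) A.
Proof. by move=> fA x; under eq_integral do rewrite cmodulusN; exact: fA. Qed.

Lemma eq_stepanov_bound (R : realType) (p : nat) (f g : R -> R[i]) (A : \bar R) :
  f =1 g -> stepanov_bound p f A -> stepanov_bound p g A.
Proof. by move=> /funext ->. Qed.

Lemma stepanov_boundW (R : realType) (p : nat) (f : R -> R[i]) (A B : \bar R) :
  (A <= B)%E -> stepanov_bound p f A -> stepanov_bound p f B.
Proof. by move=> AB fA x; apply: le_trans AB. Qed.

Lemma stepanov_approxB (R : realType) (p : nat) (f g : R -> R[i]) :
  stepanov_approx p f -> stepanov_approx p g -> stepanov_approx p (fun x => f x - g x).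
Proof.
move=> [mf hf] [mg hg]; split; first exact: cmeasurableB.
move=> e e0; pose d := e / 2 / 2 ^+ p.
have d0 : 0 < d by rewrite /d !divr_gt0 ?exprn_gt0.
have [s hs] := hf d d0; have [t ht] := hg d d0.
exists (s ++ [seq (- cl.1, cl.2) | cl <- t]).
have := stepanov_boundD _ _ hs (stepanov_boundN ht).
rewrite -EFinD -EFinM (_ : _ * (d + d) = e); last first.
  by rewrite /d; field; rewrite expf_neq0.
move=> H; apply: eq_stepanov_bound (H _ _).
- by move=> x; rewrite trig_poly_cat trig_poly_opp; ring.
- by apply: cmeasurableB => //; exact: cmeasurable_trig_poly.
- rewrite (_ : (fun x => _) = fun x => trig_poly t x - g x).
    by apply: cmeasurableB => //; exact: cmeasurable_trig_poly.
  by apply/funext => x; rewrite opprB.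
Qed.

Lemma stepanov_approx_trig (R : realType) (p : nat) (s : seq (R[i] * R)) :
  (0 < p)%N -> stepanov_approx p (trig_poly s).
Proof.
move=> p0; split; first exact: cmeasurable_trig_poly.
move=> e e0; exists s => x.
under eq_integral do rewrite subrr cmodulus0 expr0n (gtn_eqF p0).
by rewrite integral0 lee_fin ltW.
Qed.

(** The embedding of the Stepanov spaces into the one of exponent 1, from the
    elementary inequality u <= d + d^(1 - p) u^p; the free parameter d makes the bound
    as small as the data allow. *)
Lemma stepanov_bound_to1 (R : realType) (p : nat) (f : R -> R[i]) (A d : R) :
  (0 < p)%N -> cmeasurable f -> 0 < d -> stepanov_bound p f A%:E ->
  stepanov_bound 1 f (d + d ^- p.-1 * A)%:E.
Proof.
move=> p0 mf d0 fA x.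
have mF := measurable_cmodulusX p mf.
apply: (@le_trans _ _ (\int[lebesgue_measure]_(s in `[x, (x + 1)%R])
   (cst d%:E s + (d ^- p.-1)%:E * (cmodulus (f s) ^+ p)%:E))%E); last first.
  have di : 0 <= d ^- p.-1 by rewrite invr_ge0 exprn_ge0 // ltW.
  have h0 s : (0 <= (d ^- p.-1)%:E * (cmodulus (f s) ^+ p)%:E)%E.
    by rewrite mule_ge0 // lee_fin ?exprn_ge0 ?cmodulus_ge0.
  rewrite ge0_integralD //; last 2 first.
  - by move=> s _; rewrite lee_fin ltW.
  - by apply: emeasurable_funM => //; exact: measurable_funTS.
  rewrite integral_unit_cst EFinD EFinM ge0_integralZl_EFin //; last 2 first.
  - by move=> s _; rewrite lee_fin exprn_ge0 ?cmodulus_ge0.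
  - exact: measurable_funTS.
  by rewrite leeD2l // lee_wpmul2l ?lee_fin //; exact: fA.
apply: ge0_le_integral => //.
- by move=> s _; rewrite lee_fin exprn_ge0 ?cmodulus_ge0.
- by apply: measurable_funTS; exact: measurable_cmodulusX.
- apply: emeasurable_funD => //; apply: emeasurable_funM => //.
  exact: measurable_funTS.
move=> s _; rewrite -EFinM -EFinD lee_fin expr1.
have c0 := cmodulus_ge0 (f s).
have [h|/ltW h] := leP (cmodulus (f s)) d.
  by rewrite (le_trans h) // lerDl mulr_ge0 ?invr_ge0 ?exprn_ge0 // ltW.
apply: (@le_trans _ _ (d ^- p.-1 * cmodulus (f s) ^+ p)); last by rewrite lerDr ltW.
rewrite -(prednK p0) /= mulrC ler_pdivlMr ?exprn_gt0 // exprS ler_wpM2l //.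
by apply: lerXn2r; rewrite ?nnegrE // ltW.
Qed.

Lemma stepanov_approx_to1 (R : realType) (p : nat) (f : R -> R[i]) :
  (0 < p)%N -> stepanov_approx p f -> stepanov_approx 1 f.
Proof.
move=> p0 [mf hf]; split=> // e e0; have e2 : 0 < e / 2 by rewrite divr_gt0.
have [s hs] := hf _ (exprn_gt0 p e2); exists s.
have ms : cmeasurable (fun x => f x - trig_poly s x).
  by apply: cmeasurableB => //; exact: cmeasurable_trig_poly.
have := stepanov_bound_to1 p0 ms e2 hs.
rewrite (_ : _ ^- _ * _ = e / 2); first by rewrite -splitr.
case: (p) p0 => // n _; rewrite /= exprSr mulrA mulVf ?mul1r //.
by rewrite expf_neq0 // gt_eqF.
Qed.

Lemma stepanov_approx_bounded (R : realType) (f : R -> R[i]) :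
  stepanov_approx 1 f -> stepanov_bounded f.
Proof.
move=> [mf hf]; have [s hs] := hf 1 ltr01.
rewrite (_ : f = fun x => (f x - trig_poly s x) + trig_poly s x); last first.
  by apply/funext => x; rewrite subrK.
apply: stepanov_boundedD; last exact: stepanov_bounded_trig.
split; last by exists 1.
by apply: cmeasurableB => //; exact: cmeasurable_trig_poly.
Qed.

Lemma cmeasurable_cexpi_mul (R : realType) (f : R -> R[i]) (lambda : R) :
  cmeasurable f -> cmeasurable (fun x => f x * cexpi (- (lambda * x))).
Proof.
move=> mf; rewrite (_ : (fun x => _) = (fun x => f x * cexpi (- lambda * x))).
  by apply: cmeasurableM => //; exact: cmeasurable_cexpi.
by apply/funext => x; rewrite mulNr.
Qed.

Lemma stepanov_bounded_cexpiN (R : realType) (f : R -> R[i]) (lambda : R) :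
  stepanov_bounded f -> stepanov_bounded (fun x => f x * cexpi (- (lambda * x))).
Proof.
move=> hf; rewrite (_ : (fun x => _) = (fun x => f x * cexpi (- lambda * x))).
  exact: stepanov_bounded_cexpi.
by apply/funext => x; rewrite mulNr.
Qed.

Lemma stepanov_bound_cexpi (R : realType) (p : nat) (f : R -> R[i]) (lambda : R) A :
  stepanov_bound p f A -> stepanov_bound p (fun x => f x * cexpi (- (lambda * x))) A.
Proof.
by move=> fA x; under eq_integral do rewrite cmodulusM cmodulus_cexpi mulr1; exact: fA.
Qed.

(** The limit that defines the Fourier coefficient exists: the means of f are
    uniformly close to those of a trigonometric polynomial, which converge. *)
Lemma fourier_coefP (R : realType) (f : R -> R[i]) (lambda : R) :
  stepanov_approx 1 f ->
  tends_to (cmean (fun x => f x * cexpi (- (lambda * x)))) (fourier_coef f lambda).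
Proof.
move=> hf; have [mf hfe] := hf; apply: tends_to_cauchy => e e0.
have e6 : 0 < e / 6 by rewrite divr_gt0.
have [s hs] := hfe _ e6; exists (trig_coef s lambda).
have e2 : 0 < e / 2 by rewrite divr_gt0.
near=> T.
have hT : cmodulus (cmean (fun x => trig_poly s x * cexpi (- (lambda * x))) T - trig_coef s lambda) <= e / 2.
  by near: T; exact: mean_trig_poly.
have T1 : 1 <= T by near: T; apply: nbhs_pinfty_ge; exact: num_real.
have md : cmeasurable (fun x => f x - trig_poly s x).
  by apply: cmeasurableB => //; exact: cmeasurable_trig_poly.
have bd : stepanov_bounded (fun x => f x - trig_poly s x).
  by split => //; exists (e / 6).
have E : cmean (fun x => f x * cexpi (- (lambda * x))) T =
    cmean (fun x => (f x - trig_poly s x) * cexpi (- (lambda * x))) T +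
    cmean (fun x => trig_poly s x * cexpi (- (lambda * x))) T.
  rewrite -cmeanD; [|exact: stepanov_bounded_cexpiN|
    by apply: stepanov_bounded_cexpiN; exact: stepanov_bounded_trig].
  by congr (cmean _ _); apply/funext => x; rewrite -mulrDl subrK.
rewrite E -addrA; apply: le_trans (cmodulusD _ _) _.
have := cmodulus_cmean_le (cmeasurable_cexpi_mul lambda md) (stepanov_bound_cexpi lambda hs) T1.
lra.
Unshelve. all: by end_near. Qed.

Lemma fourier_coef_le (R : realType) (f : R -> R[i]) (lambda A : R) :
  stepanov_approx 1 f -> stepanov_bound 1 f A%:E ->
  cmodulus (fourier_coef f lambda) <= 3 * A.
Proof.
move=> hf fA; apply: tends_to_le (fourier_coefP lambda hf) _.
near=> T; apply: cmodulus_cmean_le.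
- by apply: cmeasurable_cexpi_mul; case: hf.
- exact: stepanov_bound_cexpi.
- by near: T; apply: nbhs_pinfty_ge; exact: num_real.
Unshelve. all: by end_near. Qed.

Lemma fourier_coefB (R : realType) (f g : R -> R[i]) (lambda : R) :
  stepanov_approx 1 f -> stepanov_approx 1 g ->
  fourier_coef (fun x => f x - g x) lambda = fourier_coef f lambda - fourier_coef g lambda.
Proof.
move=> hf hg.
apply: tends_to_unique (fourier_coefP lambda (stepanov_approxB hf hg)) _.
rewrite -mulN1r.
have := tends_toD (fourier_coefP lambda hf) (tends_toZ (-1) (fourier_coefP lambda hg)).
apply: eq_mean_to; apply: nearW => T.
have bf := stepanov_bounded_cexpiN lambda (stepanov_approx_bounded hf).
have bg := stepanov_bounded_cexpiN lambda (stepanov_approx_bounded hg).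
rewrite -cmeanZ // -cmeanD //; last exact: stepanov_boundedZ.
by congr (cmean _ _); apply/funext => x; rewrite mulN1r mulrBl.
Qed.

Lemma fourier_coef_trig (R : realType) (s : seq (R[i] * R)) (lambda : R) :
  fourier_coef (trig_poly s) lambda = trig_coef s lambda.
Proof.
exact: tends_to_unique (fourier_coefP lambda (@stepanov_approx_trig R 1 s isT)) (mean_trig_poly s lambda).
Qed.

(** * Almost invariant finite sets of frequencies *)

(** Bernoulli's inequality gives (1 + e)^((d+1) M) >= (M e)^(d+1), which
    exceeds ((d+2) M)^d as soon as M > (d+2)^d / e^(d+1). *)
Lemma exists_exp_gt_poly (R : realType) (e : R) (d : nat) : 0 < e ->
  exists N : nat, (N.+1%:R) ^+ d < (1 + e) ^+ N.
Proof.
move=> e0.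
pose c : R := (d.+2%:R) ^+ d / e ^+ d.+1.
have c0 : 0 <= c by rewrite divr_ge0 // exprn_ge0 // ltW.
pose M := (Num.truncn c).+1.
have Mc : c < M%:R by exact: truncnS_gt.
exists (d.+1 * M)%N.
have M1 : 1 <= M%:R :> R by rewrite ler1n.
apply: (@le_lt_trans _ _ ((d.+2%:R * M%:R) ^+ d)).
  apply: lerXn2r; rewrite ?nnegrE ?mulr_ge0 //.
  by rewrite -natrM ler_nat (mulSn d.+1) -[(d.+1 * M).+1]add1n leq_add2r.
apply: (@lt_le_trans _ _ ((M%:R * e) ^+ d.+1)).
  rewrite !exprMn [M%:R ^+ d.+1]exprS [ltRHS]mulrAC ltr_pM2r ?exprn_gt0 ?ltr0n //.
  by move: Mc; rewrite /c ltr_pdivrMr ?exprn_gt0.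
rewrite mulnC exprM; apply: lerXn2r; rewrite ?nnegrE ?mulr_ge0 ?exprn_ge0 ?addr_ge0 ?(ltW e0) //.
elim: (M) => [|k IH]; first by rewrite mul0r expr0.
rewrite exprS mulrDl mul1r -natr1 mulrDl mul1r; apply: lerD => //.
by rewrite ler_peMr ?(ltW e0) // exprn_ege1 // lerDl ltW.
Qed.

Section Folner.
Context {R : realType} (L : seq R).

(** The combinations of the elements of L with integer coefficients between 0 and
    N.  Distinct coefficients may give the same sum, as the frequencies can satisfy
    integer relations; the list without repetitions is what gets translated. *)
Definition box (N : nat) : seq R :=
  undup [seq \sum_(i < size L) (val (f i))%:R * nth 0 L i
        | f : {ffun 'I_(size L) -> 'I_N.+1} <- enum {ffun 'I_(size L) -> 'I_N.+1}].

Lemma mem_box N (m : 'I_(size L) -> nat) : (forall i, (m i <= N)%N) ->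
  \sum_(i < size L) (m i)%:R * nth 0 L i \in box N.
Proof.
move=> mN; rewrite mem_undup; apply/mapP.
exists [ffun i => inord (m i) : 'I_N.+1]; first by rewrite mem_enum.
by apply: eq_bigr => i _; rewrite ffunE /= inordK // ltnS.
Qed.

Lemma boxP N x : x \in box N -> exists2 m : 'I_(size L) -> nat,
  (forall i, (m i <= N)%N) & x = \sum_(i < size L) (m i)%:R * nth 0 L i.
Proof.
rewrite mem_undup => /mapP[f _ ->]; exists (fun i => val (f i)) => // i.
by rewrite -ltnS ltn_ord.
Qed.

Lemma size_box N : (size (box N) <= N.+1 ^ size L)%N.
Proof.
apply: leq_trans (size_undup _) _; rewrite size_map -cardE card_ffun.
by rewrite !card_ord.
Qed.

Lemma box_sub N x : x \in box N -> x \in box N.+1.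
Proof. by move=> /boxP[m hm ->]; apply: mem_box => i; exact: leqW. Qed.

Lemma box_translate N x l : x \in box N -> l \in L -> x + l \in box N.+1.
Proof.
move=> /boxP[m hm ->] lL.
have iL : (index l L < size L)%N by rewrite index_mem.
pose j := Ordinal iL.
rewrite (_ : _ + l = \sum_(i < size L) (m i + (i == j))%:R * nth 0 L i).
  by apply: mem_box => i; rewrite -addn1 leq_add // leq_b1.
rewrite (_ : l = \sum_(i < size L) (i == j)%:R * nth 0 L i).
  by rewrite -big_split /=; apply: eq_bigr => i _; rewrite natrD mulrDl.
rewrite (bigD1 j) //= eqxx mul1r nth_index // big1 ?addr0 // => i /negbTE ->.
by rewrite mul0r.
Qed.

(** Translation by l maps the box into the next larger one and is injective, so
    the points that leave the box are counted by the increment of its size. *)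
Lemma box_boundary N l : l \in L ->
  (count (fun x => (x + l)%R \notin box N) (box N) <= size (box N.+1) - size (box N))%N.
Proof.
move=> lL.
have u N' : uniq (box N') by exact: undup_uniq.
have e : (size (box N.+1) - size (box N) = size [seq x <- box N.+1 | x \notin box N])%N.
  have -> : size (box N) = size [seq x <- box N.+1 | x \in box N].
    apply/eqP; rewrite eqn_leq !uniq_leq_size ?filter_uniq //.
      by move=> x; rewrite mem_filter => /andP[].
    by move=> x hx; rewrite mem_filter hx box_sub.
  by rewrite !size_filter -(count_predC (fun x => x \in box N) (box N.+1)) addKn.
rewrite e -size_filter -(size_map (fun x => x + l)); apply: uniq_leq_size.
  by rewrite map_inj_uniq ?filter_uniq // => x y /addIr.
move=> _ /mapP[x + ->]; rewrite !mem_filter => /andP[h hx].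
by rewrite h box_translate.
Qed.

End Folner.

(** If every box grew by a factor larger than 1 + e, the sizes would grow
    exponentially, whereas they are bounded by a polynomial ([size_box]). *)
Lemma folner (R : realType) (L : seq R) (e : R) : 0 < e ->
  exists S : seq R, [/\ uniq S, (0 < size S)%N & forall l, l \in L ->
    (count (fun x => x + l \notin S) S)%:R <= e * (size S)%:R].
Proof.
move=> e0.
have b0 N : (0 < size (box L N))%N.
  have := @mem_box R L N (fun=> 0%N) (fun=> leq0n _).
  by case: (box L N).
suff [N hN] : exists N, (size (box L N.+1))%:R <= (1 + e) * (size (box L N))%:R.
  exists (box L N); split => //; first exact: undup_uniq.
  move=> l lL; apply: (@le_trans _ _ ((size (box L N.+1) - size (box L N))%:R)).
    by rewrite ler_nat box_boundary.
  have h : (size (box L N) <= size (box L N.+1))%N.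
    by apply: uniq_leq_size; [exact: undup_uniq|move=> x; exact: box_sub].
  by rewrite natrB // lerBlDr -{2}[(size (box L N))%:R]mul1r -mulrDl [e + 1]addrC.
apply: contrapT => hN.
have grow N : (1 + e) ^+ N <= (size (box L N))%:R.
  elim: N => [|N IH]; first by rewrite expr0 ler1n.
  rewrite exprS; apply: (@le_trans _ _ ((1 + e) * (size (box L N))%:R)).
    by rewrite ler_wpM2l // addr_ge0 // ltW.
  by rewrite leNgt; apply/negP => h; apply: hN; exists N; exact: ltW.
have [N hN'] := exists_exp_gt_poly (size L) e0.
have := lt_le_trans hN' (grow N); rewrite -natrX ltr_nat ltnNge.
by rewrite size_box.
Qed.

(** * Jensen's inequality for powers *)

(** The tangent line at c of the convex function u ^ (n+1), lying below its
    graph. *)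
Lemma young_pow (R : realType) (n : nat) (u c : R) : 0 <= u -> 0 <= c ->
  n.+1%:R * c ^+ n * u <= u ^+ n.+1 + n%:R * c ^+ n.+1.
Proof.
move=> u0 c0; elim: n => [|n IH]; first by rewrite expr0 !mul1r expr1 mul0r addr0.
have h : c ^+ n.+1 * u + u ^+ n.+1 * c <= u ^+ n.+2 + c ^+ n.+2.
  rewrite -subr_ge0 !(exprS _ n.+1).
  rewrite (_ : _ - _ = (u - c) * (u ^+ n.+1 - c ^+ n.+1)); last by ring.
  have [uc|/ltW uc] := leP u c.
    by rewrite mulr_le0 // subr_le0 // lerXn2r.
  by rewrite mulr_ge0 // subr_ge0 // lerXn2r.
have := ler_wpM2l c0 IH.
rewrite -[n.+2%:R]natr1 -[n.+1%:R]natr1 in h *.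
rewrite !(exprS c n.+1) !(exprS c n) in h *; lra.
Qed.

(** Integrating [young_pow] at c := I / 2 against k.  The mass of k is only assumed
    to be at most 2, whence the factor 2 ^ n. *)
Lemma jensen_pow (R : realType) (n : nat) (D : set R) (u k : R -> R) (I : R) :
  measurable D -> measurable_fun [set: R] u -> measurable_fun [set: R] k ->
  (forall t, 0 <= u t) -> (forall t, 0 <= k t) ->
  (\int[lebesgue_measure]_(t in D) (k t)%:E <= 2%:E)%E ->
  (\int[lebesgue_measure]_(t in D) (u t * k t)%:E = I%:E)%E ->
  ((I ^+ n.+1)%:E <= (2 ^+ n)%:E * \int[lebesgue_measure]_(t in D) (u t ^+ n.+1 * k t)%:E)%E.
Proof.
move=> mD mu mk u0 k0 hk hI.
have mD' (g : R -> R) : measurable_fun [set: R] g -> measurable_fun D (EFin \o g).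
  by move=> mg; apply/measurable_EFinP; exact: measurable_funTS.
have I0 : 0 <= I.
  by rewrite -lee_fin -hI; apply: integral_ge0 => t _; rewrite lee_fin mulr_ge0.
(* If k had mass 2 exactly, c would be the mean of u. *)
pose c := I / 2; have c0 : 0 <= c by rewrite divr_ge0.
have : ((n.+1%:R * c ^+ n)%:E * I%:E <=
    \int[lebesgue_measure]_(t in D) (u t ^+ n.+1 * k t)%:E + (n%:R * c ^+ n.+1)%:E * 2%:E)%E.
  apply: (@le_trans _ _ (\int[lebesgue_measure]_(t in D) (u t ^+ n.+1 * k t)%:E +
     (n%:R * c ^+ n.+1)%:E * \int[lebesgue_measure]_(t in D) (k t)%:E)%E); last first.
    by rewrite leeD2l // lee_wpmul2l // lee_fin mulr_ge0 ?exprn_ge0.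
  have ZE (a : R) (g : R -> R) : 0 <= a -> measurable_fun [set: R] g -> (forall t, 0 <= g t) ->
      (a%:E * \int[lebesgue_measure]_(t in D) (g t)%:E =
       \int[lebesgue_measure]_(t in D) (a * g t)%:E)%E.
    move=> a0 mg g0; rewrite -ge0_integralZl_EFin //; last exact: mD'.
    by move=> t _; rewrite lee_fin.
  have Iuk : measurable_fun [set: R] (fun t => u t * k t) by exact: measurable_funM.
  have Iuk' : measurable_fun [set: R] (fun t => u t ^+ n.+1 * k t).
    by apply: measurable_funM => //; exact: measurable_funX.
  rewrite -hI ZE ?ZE ?mulr_ge0 ?exprn_ge0 //; last by move=> t; rewrite mulr_ge0.
  have g1 t : 0 <= u t ^+ n.+1 * k t by rewrite mulr_ge0 ?exprn_ge0.
  have g2 t : 0 <= n%:R * c ^+ n.+1 * k t by rewrite !mulr_ge0 ?exprn_ge0.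
  rewrite -ge0_integralD //; last 4 first.
  - by move=> t _; rewrite lee_fin.
  - exact: mD'.
  - by move=> t _; rewrite lee_fin.
  - by apply: mD'; exact: measurable_funM.
  apply: ge0_le_integral => //.
  - by move=> t _; rewrite lee_fin !mulr_ge0 ?exprn_ge0.
  - by apply: mD'; exact: measurable_funM.
  - by apply: emeasurable_funD; apply: mD' => //; exact: measurable_funM.
  - move=> t _; rewrite -EFinD lee_fin mulrA -mulrDl ler_wpM2r //.
    exact: young_pow.
set J := integral _ _ _; case: J => [J| |].
- rewrite -!EFinM -EFinD !lee_fin /c !expr_div_n => h.
  rewrite mulrC -ler_pdivrMr ?exprn_gt0 //.
  have -> : I ^+ n.+1 / 2 ^+ n = n.+1%:R * (I ^+ n / 2 ^+ n) * I -
     n%:R * (I ^+ n.+1 / 2 ^+ n.+1) * 2.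
    by rewrite -natr1 !exprS; field; rewrite expf_neq0.
  by rewrite lerBlDr.
- by move=> _; rewrite gt0_muley ?leey // lte_fin exprn_gt0.
- by rewrite addNye leeNy_eq.
Qed.

(** * Bochner-Fejer approximation *)

(** A positive trigonometric polynomial of mean 1, the analogue of the Fejer
    kernel for an arbitrary finite set S of frequencies. *)
Definition bf_kernel (R : realType) (S : seq R) (t : R) : R :=
  cmodulus (\sum_(m <- S) cexpi (m * t)) ^+ 2 / (size S)%:R.

(** The mean over t of f(t) K(t - x) with K the kernel of S.  The frequency l
    gets the coefficient of f at l times the number of pairs of S with difference l,
    divided by |S|; in particular no frequency outside the spectrum of f survives. *)
Definition bf_poly (R : realType) (S : seq R) (f : R -> R[i]) : seq (R[i] * R) :=
  [seq ((((size S)%:R)^-1)%:C * fourier_coef f (p.2 - p.1), p.2 - p.1)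
  | p <- [seq (m, n) | m <- S, n <- S]].

Lemma bf_kernel_ge0 (R : realType) (S : seq R) t : 0 <= bf_kernel S t.
Proof. by rewrite divr_ge0 ?sqr_ge0. Qed.

Lemma bf_kernelE (R : realType) (S : seq R) t : (bf_kernel S t)%:C =
  \sum_(p <- [seq (m, n) | m <- S, n <- S])
    (((size S)%:R)^-1)%:C * cexpi ((p.1 - p.2) * t).
Proof.
rewrite /bf_kernel rmorphM /= mulrC -mulr_sumr; congr (_ * _).
have -> (z : R[i]) : (cmodulus z ^+ 2)%:C = z * (z^*)%C.
  by case: z => a b; rewrite sqr_cmodulus; apply/eqP; rewrite eq_complex /=; apply/andP; split; apply/eqP; ring.
rewrite rmorph_sum big_allpairs_dep mulr_suml; apply: eq_bigr => m _.
rewrite mulr_sumr; apply: eq_bigr => n _.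
by rewrite -[RHS]/(cexpi ((m - n) * t)) mulrBl cexpiD -conj_cexpi.
Qed.

Lemma bf_kernel_trig (R : realType) (S : seq R) : exists s : seq (R[i] * R),
  forall t, (bf_kernel S t)%:C = trig_poly s t.
Proof.
exists [seq ((((size S)%:R)^-1)%:C, p.1 - p.2) | p <- [seq (m, n) | m <- S, n <- S]].
by move=> t; rewrite bf_kernelE /trig_poly big_map.
Qed.

Lemma measurable_bf_kernel (R : realType) (S : seq R) :
  measurable_fun [set: R] (bf_kernel S).
Proof.
have [s hs] := bf_kernel_trig S; have [h _] := cmeasurable_trig_poly s.
rewrite (_ : bf_kernel S = fun t => complex.Re (trig_poly s t)) //.
by apply/funext => t; rewrite -hs.
Qed.

Lemma tends_to_sum_dist (R : realType) (I : Type) (r : seq I) (F : I -> R -> R[i]) l (d : R) :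
  (forall i, tends_to (F i) (l i)) -> 0 < d ->
  \forall T \near +oo, \sum_(i <- r) cmodulus (F i T - l i) <= d.
Proof.
move=> hF; elim: r d => [|i r IH] d d0.
  by apply: nearW => T; rewrite big_nil ltW.
have d2 : 0 < d / 2 by rewrite divr_gt0.
apply: filterS2 (hF i _ d2) (IH _ d2) => T h1 h2.
by rewrite big_cons; lra.
Qed.

(** The convergence of the means is uniform in x because x enters only through
    factors of modulus 1. *)
Lemma bf_mean_cvg (R : realType) (S : seq R) (f : R -> R[i]) (d : R) :
  stepanov_approx 1 f -> 0 < d ->
  \forall T \near +oo, forall x,
    cmodulus (cmean (fun t => f t * (bf_kernel S (t - x))%:C) T -
              trig_poly (bf_poly S f) x) <= d.
Proof.
move=> hf d0; have bf := stepanov_approx_bounded hf.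
pose P := [seq (m, n) | m <- S, n <- S].
pose c0 : R[i] := (((size S)%:R)^-1)%:C.
have := @tends_to_sum_dist R _ P (fun (p : R * R) T => c0 *
    cmean (fun t => f t * cexpi (- ((p.2 - p.1) * t))) T)
  (fun p => c0 * fourier_coef f (p.2 - p.1)) d
  (fun p => tends_toZ c0 (fourier_coefP (p.2 - p.1) hf)) d0.
apply: filterS => T hT x; apply: le_trans hT.
rewrite (_ : cmean _ _ = \sum_(p <- P) cexpi ((p.2 - p.1) * x) * (c0 *
    cmean (fun t => f t * cexpi (- ((p.2 - p.1) * t))) T)).
  rewrite /trig_poly big_map -sumrB; apply: le_trans (cmodulus_sum _ _) _.
  apply: ler_sum => p _; rewrite [_ * cexpi _]mulrC -mulrBr cmodulusM.
  by rewrite cmodulus_cexpi mul1r.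
transitivity (cmean (fun t => \sum_(p <- P) (cexpi ((p.2 - p.1) * x) * c0) *
    (f t * cexpi (- ((p.2 - p.1) * t)))) T).
  congr (cmean _ _); apply/funext => t; rewrite bf_kernelE mulr_sumr.
  apply: eq_bigr => p _.
  rewrite (_ : (p.1 - p.2) * (t - x) = (p.2 - p.1) * x + - ((p.2 - p.1) * t)); last by ring.
  by rewrite cexpiD -/c0; ring.
have hb (p : R * R) := stepanov_bounded_cexpiN (p.2 - p.1) bf.
rewrite cmean_sum; last by move=> p; exact: stepanov_boundedZ.
by apply: eq_bigr => p _; rewrite cmeanZ // mulrA.
Qed.

(** The kernel has mean 1, since the pairs (m, m) alone contribute to the
    frequency 0; so its integral over [-T, T] is eventually at most twice 2 T, uniformly
    in the translation. *)
Lemma bf_kernel_mass (R : realType) (S : seq R) : uniq S -> (0 < size S)%N ->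
  \forall T \near +oo, forall x,
    (\int[lebesgue_measure]_(t in `[(- T)%R, T]) (bf_kernel S (t - x))%:E <= (4 * T)%:E)%E.
Proof.
move=> uS S0; have SR : (size S)%:R != 0 :> R by rewrite pnatr_eq0 -lt0n.
pose one := trig_poly [:: (1 : R[i], 0 : R)].
have oneE t : one t = 1 by rewrite /one trig_poly1 mul1r mul0r cexpi0.
have h1 := @stepanov_approx_trig R 1 [:: (1, 0)] isT.
have bf1 x : trig_poly (bf_poly S one) x = 1.
  rewrite /trig_poly big_map.
  rewrite (eq_bigr (fun p : R * R => (((size S)%:R)^-1)%:C * (p.2 == p.1)%:R)); last first.
    move=> p _ /=; rewrite fourier_coef_trig /trig_coef big_mkcond big_seq1 /= -mulrA.
    rewrite eq_sym subr_eq0; case: eqVneq => [->|_]; last by rewrite mul0r.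
    by rewrite subrr mul0r cexpi0 mulr1.
  rewrite -mulr_sumr big_allpairs_dep /=.
  rewrite (_ : \sum_(m <- S) _ = (size S)%:R).
    by rewrite -(rmorph_nat (real_complex R)) -rmorphM /= mulVf.
  rewrite -sum1_size natr_sum big_seq [RHS]big_seq; apply: eq_bigr => m mS.
  by rewrite (bigD1_seq m) //= eqxx big1 ?addr0 // => n /negbTE ->.
near=> T => x.
have T0 : 0 < T by near: T; exact: nbhs_pinfty_gt.
have : forall x, cmodulus (cmean (fun t => one t * (bf_kernel S (t - x))%:C) T -
              trig_poly (bf_poly S one) x) <= 1.
  by near: T; exact: bf_mean_cvg.
move=> /(_ x); rewrite bf1 => h.
have [s hs] := bf_kernel_trig S.
have bK : stepanov_bounded (fun t => (bf_kernel S (t - x))%:C).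
  rewrite (_ : (fun t => _) = trig_poly (translate_trig (- x) s)).
    exact: stepanov_bounded_trig.
  by apply/funext => t; rewrite translate_trigE hs.
have [iK _] := cintegrable_itv (- T) T bK.
have -> : (\int[lebesgue_measure]_(t in `[(- T)%R, T]) (bf_kernel S (t - x))%:E =
    (\int[@lebesgue_measure R]_(t in `[- T, T]) bf_kernel S (t - x))%:E)%E.
  by rewrite fineK //; exact: integrable_fin_num iK.
rewrite lee_fin.
have : `|complex.Re (cmean (fun t => one t * (bf_kernel S (t - x))%:C) T)| <= 2.
  apply: le_trans (normr_Re_le _) _.
  set z := cmean _ _ in h *; rewrite (_ : z = (z - 1) + 1); last by rewrite subrK.
  apply: le_trans (cmodulusD _ _) _.
  have -> : cmodulus (1 : R[i]) = 1 by rewrite -[1]/(1%:C) cmodulus_real normr1.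
  by lra.
rewrite /cmean /cintegral.
under eq_Rintegral do rewrite oneE mul1r.
rewrite Re_mulc /= mul0r subr0 => /(le_trans (ler_norm _)).
rewrite mulrC ler_pdivrMr ?mulr_gt0 //; lra.
Unshelve. all: by end_near. Qed.

Lemma measurable_shear (R : realType) (F K : R -> \bar R) :
  measurable_fun [set: R] F -> (forall x, 0 <= F x)%E ->
  measurable_fun [set: R] K -> (forall x, 0 <= K x)%E ->
  measurable_fun [set: R] (fun x => \int[lebesgue_measure]_t (F t * K (t - x)%R))%E.
Proof.
move=> mF F0 mK K0.
pose f (z : measurableTypeR R * measurableTypeR R) : \bar R :=
  (F z.2 * K (z.2 - z.1)%R)%E.
have f0 z : (0 <= f z)%E by rewrite mule_ge0.
have mf : measurable_fun setT f.
  apply: emeasurable_funM; first exact: (measurableT_comp mF measurable_snd).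
  by apply: (measurableT_comp mK); exact: measurable_funB measurable_snd measurable_fst.
exact: (@measurable_fun_fubini_tonelli_F _ _ _ _ _ lebesgue_measure f mf f0).
Qed.

(** The operator that maps h to the mean of h against the kernel is bounded on the
    Stepanov space, with a constant independent of S: for large T it is an average
    with a weight of total mass at most 2, to which [jensen_pow] applies, and
    [shear_integral_le] then integrates the result over the unit interval. *)
Lemma bf_poly_stepanov_bound (R : realType) (S : seq R) (n : nat) (h : R -> R[i]) (eta : R) :
  uniq S -> (0 < size S)%N -> stepanov_approx 1 h -> 0 < eta ->
  stepanov_bound n.+1 h eta%:E ->
  stepanov_bound n.+1 (trig_poly (bf_poly S h))
    (2 ^+ n.+1 * (2 ^+ n.+1 * (2 ^+ n * 4) + 1) * eta)%:E.
Proof.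
move=> uS S0 hh eta0 hb y; have [mh _] := hh.
have bh := stepanov_approx_bounded hh.
have [d d0 dn] := exists_pow_le (ltn0Sn n) eta0.
pose r := `|y| + 1.
have r0 : 0 < r by rewrite ltr_wpDl.
have [T [hT hK [hK' rT]]] : exists T, [/\
    forall x, cmodulus (cmean (fun t => h t * (bf_kernel S (t - x))%:C) T -
      trig_poly (bf_poly S h) x) <= d,
    forall x, (\int[lebesgue_measure]_(t in `[(- T)%R, T]) (bf_kernel S (t - x))%:E <= (4 * T)%:E)%E
  & (\int[lebesgue_measure]_(t in `[(- (T + r))%R, (T + r)%R]) (bf_kernel S t)%:E <= (4 * (T + r))%:E)%E /\ r <= T].
  have [M [_ hM]] := bf_kernel_mass uS S0.
  have /filter_ex [T [h1 [h2 [h3 h4]]]] : \forall T \near +oo,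
      (forall x, cmodulus (cmean (fun t => h t * (bf_kernel S (t - x))%:C) T -
      trig_poly (bf_poly S h) x) <= d) /\ ((forall x,
      (\int[lebesgue_measure]_(t in `[(- T)%R, T]) (bf_kernel S (t - x))%:E <= (4 * T)%:E)%E)
      /\ (M < T /\ r <= T)).
    apply: filterI; first exact: bf_mean_cvg.
    apply: filterI; first exact: bf_kernel_mass.
    apply: filterI; first by apply: nbhs_pinfty_gt; exact: num_real.
    by apply: nbhs_pinfty_ge; exact: num_real.
  exists T; split => //; split => //.
  have : M < T + r by rewrite (lt_le_trans h3) // lerDl ltW.
  move=> /hM /(_ 0); under eq_integral do rewrite subr0; exact.
have T0 : 0 < T by apply: lt_le_trans rT.
have T2 : 0 < 2 * T by rewrite mulr_gt0.
pose D : set R := `[- T, T]%classic.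
pose D' : set R := `[- (T + r), T + r]%classic.
have mD : measurable D by exact: measurable_itv.
have mD' : measurable D' by exact: measurable_itv.
have mH := measurable_cmodulusX n.+1 mh.
pose F (t : R) : \bar R := ((cmodulus (h t) ^+ n.+1)%:E * (\1_D t)%:E)%E.
(* The truncation to D' keeps the mass of the kernel finite and does not
   affect t in D and x in `[y, y + 1], as then |t - x| <= T + r. *)
pose K (t : R) : \bar R := ((bf_kernel S t)%:E * (\1_D' t)%:E)%E.
have mind (E : set R) : measurable E -> measurable_fun [set: R] (fun t => (\1_E t)%:E : \bar R).
  by move=> mE; apply/measurable_EFinP; exact: measurable_indic.
have mF : measurable_fun [set: R] F by apply: emeasurable_funM => //; exact: mind.
have mbk := measurable_bf_kernel S.
have mK : measurable_fun [set: R] K.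
  by apply: emeasurable_funM; [exact/measurable_EFinP|exact: mind].
have F0 t : (0 <= F t)%E by rewrite mule_ge0 // lee_fin ?exprn_ge0 ?cmodulus_ge0 ?indicE.
have K0 t : (0 <= K t)%E by rewrite mule_ge0 // lee_fin ?bf_kernel_ge0 ?indicE.
have hF x : (\int[lebesgue_measure]_(s in `[x, (x + 1)%R]) F s <= eta%:E)%E.
  apply: le_trans (hb x); apply: ge0_le_integral => //.
  - exact: measurable_funTS.
  - exact: measurable_funTS.
  by move=> s _; rewrite /F -EFinM lee_fin ler_piMr ?exprn_ge0 ?cmodulus_ge0.
have IK : (\int[lebesgue_measure]_u K u <= (8 * T)%:E)%E.
  apply: (@le_trans _ _ (4 * (T + r))%:E); last by rewrite lee_fin; lra.
  apply: le_trans hK'; rewrite [leRHS]integral_mkcond le_eqVlt; apply/orP; left; apply/eqP.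
  apply: eq_integral => u _; rewrite patchE /K indicE /D'.
  by case: ifP => _; rewrite ?mule1 ?mule0.
have shear := @shear_integral_le R F K y _ mF F0 mK K0 hF.
pose c : R := 2 ^+ n.+1 * (2 ^+ n.+1 * (2 ^+ n * (2 * T)^-1)).
have c0 : 0 <= c by rewrite !mulr_ge0 ?exprn_ge0 ?invr_ge0 ?(ltW T2).
have mB := measurable_shear mF F0 mK K0.
have B0 x : (0 <= \int[lebesgue_measure]_t (F t * K (t - x)%R))%E.
  by apply: integral_ge0 => t _; rewrite mule_ge0.
have point x : x \in `[y, y + 1] ->
  ((cmodulus (trig_poly (bf_poly S h) x) ^+ n.+1)%:E <=
   c%:E * (\int[lebesgue_measure]_t (F t * K (t - x)%R)) + (2 ^+ n.+1 * eta)%:E)%E.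
  rewrite in_itv /= => /andP[yx xy].
  pose m := cmean (fun t => h t * (bf_kernel S (t - x))%:C) T.
  have [s hs] := bf_kernel_trig S.
  have mk : measurable_fun [set: R] (fun t => (bf_kernel S (t - x)) / (2 * T)).
    apply: measurable_funM => //; apply: (measurableT_comp mbk).
    exact: measurable_funB.
  have bK : stepanov_bounded (fun t => h t * (bf_kernel S (t - x))%:C).
    rewrite (_ : (fun t => _) = fun t => trig_poly (translate_trig (- x) s) t * h t).
      apply: (@stepanov_boundedM _ _ _ _ bh (cmeasurable_trig_poly _)).
      exact: trig_poly_bounded.
    by apply/funext => t; rewrite translate_trigE hs mulrC.
  pose u t := cmodulus (h t); have mu : measurable_fun [set: R] u by exact: measurable_cmodulus.
  pose k t := bf_kernel S (t - x) / (2 * T).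
  have k0 t : 0 <= k t by rewrite divr_ge0 ?bf_kernel_ge0 // ltW.
  have u0 t : 0 <= u t by exact: cmodulus_ge0.
  have scale (g : R -> R) : measurable_fun [set: R] g -> (forall t, 0 <= g t) ->
      (\int[lebesgue_measure]_(t in D) (g t / (2 * T))%:E =
       ((2 * T)^-1)%:E * \int[lebesgue_measure]_(t in D) (g t)%:E)%E.
    move=> mg g0; rewrite -ge0_integralZl_EFin ?invr_ge0 ?(ltW T2) //.
    - by apply: eq_integral => t _; rewrite mulrC EFinM.
    - by move=> t _; rewrite lee_fin.
    - by apply/measurable_EFinP; exact: measurable_funTS.
  have mbx : measurable_fun [set: R] (fun t => bf_kernel S (t - x)).
    by apply: (measurableT_comp mbk); exact: measurable_funB.
  have k2 : (\int[lebesgue_measure]_(t in D) (k t)%:E <= 2%:E)%E.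
    rewrite scale //; last by move=> t; exact: bf_kernel_ge0.
    apply: le_trans (lee_wpmul2l _ (hK x)) _; first by rewrite lee_fin invr_ge0 ltW.
    rewrite -EFinM lee_fin (_ : _ * _ = 2) //.
    by rewrite (_ : 4 * T = 2 * (2 * T)); [rewrite mulrCA mulVf ?mulr1 // gt_eqF|ring].
  have muk : measurable_fun [set: R] (fun t => u t * bf_kernel S (t - x)).
    exact: measurable_funM.
  pose I := fine (\int[lebesgue_measure]_(t in D) (u t * k t)%:E).
  have hI0 : (\int[lebesgue_measure]_(t in D) (u t * k t)%:E =
      ((2 * T)^-1)%:E * \int[lebesgue_measure]_(t in D) (cmodulus (h t * (bf_kernel S (t - x))%:C))%:E)%E.
    rewrite -scale; last 2 first.
    - by apply: measurable_cmodulus; case: bK.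
    - by move=> t; exact: cmodulus_ge0.
    apply: eq_integral => t _; congr (_%:E).
    by rewrite cmodulusM cmodulus_real ger0_norm ?bf_kernel_ge0 // /u /k mulrA.
  have finI : (\int[lebesgue_measure]_(t in D) (u t * k t)%:E)%E \is a fin_num.
    have [mbK [A bKA]] := bK.
    rewrite ge0_fin_numE; last by apply: integral_ge0 => t _; rewrite lee_fin mulr_ge0.
    rewrite hI0.
    apply: le_lt_trans (lee_wpmul2l _ (integral_cmodulus_long_le mbK bKA (ltW T0))) _.
      by rewrite lee_fin invr_ge0 ltW.
    by rewrite -EFinM ltry.
  have hI : (\int[lebesgue_measure]_(t in D) (u t * k t)%:E = I%:E)%E by rewrite fineK.
  have I0 : 0 <= I.
    by apply: fine_ge0; apply: integral_ge0 => t _; rewrite lee_fin mulr_ge0.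
  have mI : cmodulus m <= 2 * I.
    rewrite /m /cmean cmodulusM cmodulus_real ger0_norm ?invr_ge0 ?(ltW T2) //.
    have := cmodulus_cintegral_le (- T) T bK => h1.
    have h2 := lee_wpmul2l (_ : (0 <= ((2 * T)^-1)%:E)%E) h1.
    rewrite -lee_fin EFinM; apply: le_trans (h2 _) _; first by rewrite lee_fin invr_ge0 ltW.
    by rewrite muleCA -hI0 hI -EFinM lee_fin.
  have J := @jensen_pow R n D u k I mD mu mk u0 k0 k2 hI.
  have JE : (\int[lebesgue_measure]_(t in D) (u t ^+ n.+1 * k t)%:E =
      ((2 * T)^-1)%:E * \int[lebesgue_measure]_t (F t * K (t - x)%R))%E.
    transitivity (((2 * T)^-1)%:E * \int[lebesgue_measure]_(t in D)
        (u t ^+ n.+1 * bf_kernel S (t - x))%:E)%E.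
      rewrite -scale.
      - by apply: eq_integral => t _; rewrite /k mulrA.
      - by apply: measurable_funM => //; exact: measurable_funX.
      - by move=> t; rewrite mulr_ge0 ?exprn_ge0 ?bf_kernel_ge0.
    congr (_ * _)%E; rewrite [LHS]integral_mkcond; apply: eq_integral => t _.
    rewrite patchE /F /K indicE; case: ifP => tD; last by rewrite mule0 mul0e.
    rewrite indicE mem_set; first by rewrite !mule1 -EFinM.
    move/set_mem: tD; rewrite /D /D' /= !in_itv /= => /andP[t1 t2].
    have := ler_norm y; have := ler_norm (- y); rewrite normrN /r => y1 y2.
    by apply/andP; split; lra.
  have tm : cmodulus (trig_poly (bf_poly S h) x) <= 2 * I + d.
    rewrite (_ : trig_poly _ _ = m - (m - trig_poly (bf_poly S h) x)); last first.
      by rewrite opprB addrC subrK.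
    apply: le_trans (cmodulusD _ _) _; rewrite cmodulusN.
    by apply: lerD => //; exact: hT.
  apply: (@le_trans _ _ (2 ^+ n.+1 * ((2 * I) ^+ n.+1 + d ^+ n.+1))%:E).
    rewrite lee_fin; apply: le_trans (powD_le n.+1 _ (ltW d0)); last by rewrite mulr_ge0.
    by apply: lerXn2r => //; rewrite nnegrE ?cmodulus_ge0 ?addr_ge0 ?mulr_ge0 // ltW.
  rewrite mulrDr EFinD; apply: leeD; last first.
    by rewrite lee_fin ler_wpM2l ?exprn_ge0.
  have q0 : (0 <= (2 ^+ n.+1 * 2 ^+ n.+1 : R)%:E)%E.
    by rewrite lee_fin mulr_ge0 ?exprn_ge0.
  have := lee_wpmul2l q0 J; rewrite JE -EFinM !muleA -!EFinM.
  rewrite (_ : 2 ^+ n.+1 * 2 ^+ n.+1 * I ^+ n.+1 = 2 ^+ n.+1 * (2 * I) ^+ n.+1).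
    by rewrite (_ : _ * _ * _ / _ = c) // /c; ring.
  by rewrite [(2 * I) ^+ _]exprMn mulrA.
apply: (@le_trans _ _ (\int[lebesgue_measure]_(x in `[y, (y + 1)%R])
   (c%:E * (\int[lebesgue_measure]_t (F t * K (t - x)%R)) + (2 ^+ n.+1 * eta)%:E))%E).
  apply: ge0_le_integral => //.
  - by move=> x _; rewrite lee_fin exprn_ge0 ?cmodulus_ge0.
  - by apply: measurable_funTS; apply: measurable_cmodulusX; exact: cmeasurable_trig_poly.
  - apply: emeasurable_funD => //; apply: emeasurable_funM => //.
    exact: measurable_funTS.
rewrite ge0_integralD //; last 3 first.
- by move=> x _; rewrite mule_ge0.
- by apply: emeasurable_funM => //; exact: measurable_funTS.
- by move=> x _; rewrite lee_fin mulr_ge0 ?exprn_ge0 // ltW.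
rewrite ge0_integralZl_EFin //; last exact: measurable_funTS.
rewrite integral_unit_cst.
apply: (@le_trans _ _ (c%:E * (eta%:E * (8 * T)%:E) + (2 ^+ n.+1 * eta)%:E)%E).
  rewrite leeD2r // lee_wpmul2l ?lee_fin //; apply: le_trans shear _.
  by rewrite lee_wpmul2l // lee_fin ltW.
rewrite -!EFinM -EFinD lee_fin /c le_eqVlt; apply/orP; left; apply/eqP.
by field; rewrite gt_eqF.
Qed.

Lemma bf_polyE (R : realType) (S : seq R) (f : R -> R[i]) x :
  trig_poly (bf_poly S f) x = \sum_(p <- [seq (m, n) | m <- S, n <- S])
    (((size S)%:R)^-1)%:C * fourier_coef f (p.2 - p.1) * cexpi ((p.2 - p.1) * x).
Proof. by rewrite /trig_poly big_map. Qed.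

Lemma bf_polyB (R : realType) (S : seq R) (f g : R -> R[i]) x :
  stepanov_approx 1 f -> stepanov_approx 1 g ->
  trig_poly (bf_poly S (fun x => f x - g x)) x =
  trig_poly (bf_poly S f) x - trig_poly (bf_poly S g) x.
Proof.
move=> hf hg.
rewrite [LHS]bf_polyE [X in _ = X - _]bf_polyE [X in _ = _ - X]bf_polyE.
transitivity (\sum_(p <- [seq (m, n) | m <- S, n <- S])
  ((((size S)%:R)^-1)%:C * fourier_coef f (p.2 - p.1) * cexpi ((p.2 - p.1) * x) -
   (((size S)%:R)^-1)%:C * fourier_coef g (p.2 - p.1) * cexpi ((p.2 - p.1) * x))).
  by apply: eq_bigr => p _; rewrite (fourier_coefB _ hf hg) mulrBr mulrBl.
exact: sumrB.
Qed.

(** The pairs of S with difference l are the points m of S for which m + l stays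
    in S. *)
Lemma sum_pairs_diff (R : realType) (S : seq R) (l : R) : uniq S ->
  \sum_(p <- [seq (m, n) | m <- S, n <- S]) ((p.2 - p.1 == l)%:R : R) =
  (size S)%:R - (count (fun m => m + l \notin S) S)%:R.
Proof.
move=> uS; rewrite big_allpairs_dep /=.
rewrite -(count_predC (fun m => m + l \notin S) S) natrD addrAC subrr add0r.
rewrite -sum1_count natr_sum [RHS]big_mkcond /=; apply: eq_bigr => m _ /=.
rewrite negbK; case: ifPn => hm.
  rewrite (bigD1_seq (m + l)) //= addrAC subrr add0r eqxx big1 ?addr0 // => n nl.
  by rewrite subr_eq addrC (negbTE nl).
rewrite big_seq big1 // => n nS; rewrite subr_eq addrC.
by case: eqP => // h; rewrite -h nS in hm.
Qed.

(** The coefficient of frequency l is multiplied by 1 minus the proportion of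
    points of S that translation by l moves out of S. *)
Lemma bf_poly_trig_dist (R : realType) (S : seq R) (s : seq (R[i] * R)) (e : R) x :
  uniq S -> (0 < size S)%N ->
  (forall l, l \in [seq cl.2 | cl <- s] ->
    (count (fun m => m + l \notin S) S)%:R <= e * (size S)%:R) ->
  cmodulus (trig_poly s x - trig_poly (bf_poly S (trig_poly s)) x) <=
  e * \sum_(cl <- s) cmodulus cl.1.
Proof.
move=> uS S0 hS; have SR : 0 < (size S)%:R :> R by rewrite ltr0n.
have -> : trig_poly s x - trig_poly (bf_poly S (trig_poly s)) x =
    \sum_(cl <- s) ((count (fun m => m + cl.2 \notin S) S)%:R / (size S)%:R : R)%:C *
      (cl.1 * cexpi (cl.2 * x)).
  have -> : trig_poly (bf_poly S (trig_poly s)) x = \sum_(cl <- s)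
      (((size S)%:R - (count (fun m => m + cl.2 \notin S) S)%:R) / (size S)%:R : R)%:C *
      (cl.1 * cexpi (cl.2 * x)).
    rewrite /trig_poly big_map /=.
    under eq_bigr => p _ do rewrite fourier_coef_trig /trig_coef big_mkcond mulr_sumr mulr_suml.
    rewrite exchange_big /=; apply: eq_bigr => cl _.
    rewrite -sum_pairs_diff // mulrC.
    rewrite rmorphM /= rmorph_sum /= mulr_suml mulr_sumr; apply: eq_bigr => p _.
    rewrite rmorph_nat [cl.2 == _]eq_sym; case: eqVneq => [E|_].
      by rewrite E mulr1n; ring.
    by rewrite mulr0n !(mulr0, mul0r).
  rewrite /trig_poly -sumrB; apply: eq_bigr => cl _.
  rewrite -[X in X - _]mul1r -mulrBl; congr (_ * _).
  rewrite -(rmorph1 (real_complex R)) -rmorphB; congr (_%:C).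
  by field; rewrite gt_eqF.
apply: le_trans (cmodulus_sum _ _) _; rewrite mulr_sumr big_seq [leRHS]big_seq.
apply: ler_sum => cl hcl; rewrite !cmodulusM cmodulus_real cmodulus_cexpi mulr1.
rewrite ler_wpM2r ?cmodulus_ge0 // ger0_norm ?divr_ge0 // ler_pdivrMr //.
by apply: hS; exact: map_f.
Qed.

Lemma stepanov_bound_cst (R : realType) (p : nat) (f : R -> R[i]) (d : R) :
  cmeasurable f -> (forall x, cmodulus (f x) <= d) -> stepanov_bound p f (d ^+ p)%:E.
Proof.
move=> mf fd x.
rewrite -[leRHS](integral_unit_cst x).
apply: ge0_le_integral => //.
- by move=> s _; rewrite lee_fin exprn_ge0 ?cmodulus_ge0.
- by apply: measurable_funTS; exact: measurable_cmodulusX.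
- move=> s _; rewrite lee_fin; apply: lerXn2r; rewrite ?nnegrE ?cmodulus_ge0 //.
  by apply: le_trans (fd s); exact: cmodulus_ge0.
Qed.

(** Let P be a trigonometric polynomial close to f, and S almost invariant under
    its frequencies.  The mean of P is close to P, and that of f - P is small, so the
    mean of f is close to f; its frequencies belong to f after deletion of the zero
    coefficients. *)
Lemma bochner_fejer (R : realType) (n : nat) (f : R -> R[i]) (e : R) :
  stepanov_approx n.+1 f -> 0 < e ->
  exists2 s, all (fun cl => fourier_coef f cl.2 != 0) s &
    stepanov_bound n.+1 (fun x => f x - trig_poly s x) e%:E.
Proof.
move=> hf e0; have [mf happ] := hf.
pose Cb : R := 2 ^+ n.+1 * (2 ^+ n.+1 * (2 ^+ n * 4) + 1).
have Cb0 : 0 < Cb by rewrite mulr_gt0 ?addr_gt0 ?mulr_gt0 ?exprn_gt0.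
pose C : R := 2 ^+ n.+1 * (1 + 2 ^+ n.+1 * (1 + Cb)).
have C0 : 0 < C by rewrite mulr_gt0 ?exprn_gt0 // addr_gt0 // mulr_gt0 ?exprn_gt0 ?addr_gt0.
pose eta := e / C; have eta0 : 0 < eta by rewrite divr_gt0.
have [P hP] := happ _ eta0.
have [d d0 dn] := exists_pow_le (ltn0Sn n) eta0.
pose m := \sum_(cl <- P) cmodulus cl.1.
have m0 : 0 <= m by apply: sumr_ge0 => *; exact: cmodulus_ge0.
have m1 : 0 < 1 + m by rewrite ltr_pwDl.
have dm : 0 < d / (1 + m) by rewrite divr_gt0.
have [S [uS S0 hS]] := folner [seq cl.2 | cl <- P] dm.
have hf1 := stepanov_approx_to1 (ltn0Sn n) hf.
have hP1 := @stepanov_approx_trig R 1 P isT.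
have hfP := stepanov_approxB hf1 hP1.
have b1 := bf_poly_stepanov_bound uS S0 hfP eta0 hP.
have b2 : stepanov_bound n.+1 (fun x => trig_poly P x - trig_poly (bf_poly S (trig_poly P)) x) (d ^+ n.+1)%:E.
  apply: stepanov_bound_cst.
    by apply: cmeasurableB; exact: cmeasurable_trig_poly.
  move=> x; apply: le_trans (bf_poly_trig_dist x uS S0 hS) _; rewrite -/m.
  by rewrite mulrAC ler_pdivrMr // ler_wpM2l ?(ltW d0) // lerDr.
have alg (u v w z : R[i]) : u - v + (v - w - (z - w)) = u - z by ring.
pose F := bf_poly S f.
have b3 : stepanov_bound n.+1 (fun x => f x - trig_poly F x) e%:E.
  have h2 : cmeasurable (fun x => trig_poly P x - trig_poly (bf_poly S (trig_poly P)) x).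
    by apply: cmeasurableB; exact: cmeasurable_trig_poly.
  have h1 : cmeasurable (fun x => f x - trig_poly P x).
    by apply: cmeasurableB => //; exact: cmeasurable_trig_poly.
  have h3 : cmeasurable (fun x => - trig_poly (bf_poly S (fun x => f x - trig_poly P x)) x).
    rewrite (_ : (fun x => _) = trig_poly [seq (- cl.1, cl.2) | cl <- bf_poly S (fun x => f x - trig_poly P x)]).
      exact: cmeasurable_trig_poly.
    by apply/funext => x; rewrite trig_poly_opp.
  have h23 := stepanov_boundD h2 h3 b2 (stepanov_boundN b1).
  have := stepanov_boundD h1 (cmeasurableD h2 h3) hP h23.
  have -> : ((2 ^+ n.+1)%:E * (eta%:E + (2 ^+ n.+1)%:E * ((d ^+ n.+1)%:E + (Cb * eta)%:E)) =
    (2 ^+ n.+1 * (eta + 2 ^+ n.+1 * (d ^+ n.+1 + Cb * eta)))%:E)%E by [].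
  move=> H; apply: eq_stepanov_bound; last first.
    apply: stepanov_boundW H; rewrite lee_fin.
    have -> : e = 2 ^+ n.+1 * (eta + 2 ^+ n.+1 * (eta + Cb * eta)).
      rewrite (_ : _ * _ = eta * C); last by rewrite /C; ring.
      by rewrite /eta divfK // gt_eqF.
    rewrite ler_wpM2l ?exprn_ge0 // lerD2l ler_wpM2l ?exprn_ge0 //.
    by rewrite lerD2r.
  move=> x; apply: etrans (alg (f x) (trig_poly P x) _ _).
  by congr (_ + (_ - _)); exact: bf_polyB.
exists [seq cl <- F | cl.1 != 0].
  apply/allP => cl; rewrite mem_filter => /andP[+ /mapP[p _ E]].
  by rewrite E /=; apply: contra => /eqP ->; rewrite mulr0.
apply: eq_stepanov_bound b3 => x; congr (_ - _).
rewrite /trig_poly big_filter [RHS]big_mkcond; apply: eq_bigr => cl _.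
by case: eqP => [->|//]; rewrite mul0r.
Qed.

(** An approximant whose frequencies all belong to an empty spectrum is zero. *)
Lemma stepanov_unique (R : realType) (h : R -> R[i]) :
  stepanov_approx 1 h -> (forall lambda, fourier_coef h lambda = 0) ->
  forall x, (\int[lebesgue_measure]_(s in `[x, (x + 1)%R]) (cmodulus (h s))%:E = 0)%E.
Proof.
move=> hh h0 x; apply/eqP; rewrite eq_le; apply/andP; split; last first.
  by apply: integral_ge0 => s _; rewrite lee_fin cmodulus_ge0.
apply/lee_addgt0Pr => e e0; rewrite add0e.
have [s hs] := bochner_fejer hh e0.
have -> : s = [::] by case: s hs => // cl s /=; rewrite h0 eqxx.
by move=> /(_ x); under eq_integral do rewrite trig_poly_nil subr0 expr1; exact.
Qed.

(** * Completeness and almost everywhere convergence *)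

Lemma limn_esup_le (R : realType) (u : (\bar R)^nat) (n : nat) (M : \bar R) :
  (forall m, (n <= m)%N -> u m <= M)%E -> (limn_esup u <= M)%E.
Proof.
move=> uM; rewrite limn_esup_lim; apply: lime_le; first exact: is_cvg_esups.
exists n => // m /= nm; apply: ge_ereal_sup => _ [k /= mk <-].
by apply: uM; exact: leq_trans mk.
Qed.

Lemma limn_einf_ge (R : realType) (u : (\bar R)^nat) (n : nat) (M : \bar R) :
  (forall m, (n <= m)%N -> M <= u m)%E -> (M <= limn_einf u)%E.
Proof.
move=> uM; rewrite limn_einf_lim; apply: lime_ge; first exact: is_cvg_einfs.
exists n => // m /= nm; apply: le_ereal_inf_tmp => _ [k /= mk <-].
by apply: uM; exact: leq_trans mk.
Qed.

(** Upper limits give the limit of a Cauchy sequence as a total, measurable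
    expression, also at points where the sequence diverges. *)
Lemma limn_esup_dist_le (R : realType) (a : nat -> R) (n : nat) (t : R) :
  (forall m, (n <= m)%N -> `|a m - a n| <= t) ->
  `|fine (limn_esup (EFin \o a)) - a n| <= t.
Proof.
move=> h.
have h1 : (limn_esup (EFin \o a) <= (a n + t)%:E)%E.
  apply: (@limn_esup_le _ _ n) => m nm; rewrite /= lee_fin.
  by have := h m nm; rewrite ler_norml => /andP[_]; rewrite lerBlDl.
have h2 : ((a n - t)%:E <= limn_esup (EFin \o a))%E.
  apply: le_trans (limn_einf_sup _); apply: (@limn_einf_ge _ _ n) => m nm.
  by rewrite /= lee_fin; have := h m nm; rewrite ler_norml => /andP[+ _]; lra.
have fin : limn_esup (EFin \o a) \is a fin_num.
  rewrite fin_numE; apply/andP; split; apply/eqP => e; first by rewrite e in h2.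
  by rewrite e in h1.
move: h1 h2; rewrite -(fineK fin) !lee_fin ler_norml => h1 h2.
by apply/andP; split; lra.
Qed.

Lemma sum_half_le (R : realType) (n : nat) :
  (\sum_(0 <= i <oo) ((2^-1 ^+ (i + n))%:E : \bar R) <= (2 * 2^-1 ^+ n)%:E)%E.
Proof.
apply: lime_le.
  by apply: is_cvg_ereal_nneg_natsum => i _; rewrite lee_fin exprn_ge0 // invr_ge0.
apply: nearW => m; rewrite sumEFin lee_fin.
have : \sum_(0 <= i < m) 2^-1 ^+ (i + n) = (2 - 2 * 2^-1 ^+ m) * 2^-1 ^+ n :> R.
  elim: m => [|m IH]; first by rewrite big_nil expr0 mulr1 subrr mul0r.
  by rewrite big_nat_recr //= IH exprD exprS; field.
have h0 k : 0 <= 2^-1 ^+ k :> R by rewrite exprn_ge0 // invr_ge0.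
by move=> ->; rewrite ler_wpM2r // gerBl mulr_ge0.
Qed.

(** With summable increments, the partial sums converge at every point where the
    series of increments is finite, and h is defined there as the limit; the estimate
    of h - g n by the tail of the series is trivially true at the other points. *)
Lemma stepanov_complete (R : realType) (g : nat -> R -> R[i]) :
  (forall n, cmeasurable (g n)) ->
  (forall n, stepanov_bound 1 (fun x => g n.+1 x - g n x) (2 * 2^-1 ^+ n)%:E) ->
  exists2 h, cmeasurable h &
    forall n, stepanov_bound 1 (fun x => h x - g n x) (8 * 2^-1 ^+ n)%:E.
Proof.
move=> mg hg.
pose re n x := complex.Re (g n x); pose im n x := complex.Im (g n x).
pose h x := fine (limn_esup (EFin \o (re^~ x))) +i* fine (limn_esup (EFin \o (im^~ x))).
have mh : cmeasurable h.
  split; apply: (measurableT_comp (@fine_measurable R setT measurableT));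
    apply: measurable_fun_limn_esup => n; apply/measurable_EFinP;
    by have [] := mg n.
exists h => // n.
have md i : cmeasurable (fun x => g i.+1 x - g i x) by apply: cmeasurableB.
pose D i x : \bar R := (cmodulus (g i.+1 x - g i x) ^+ 1)%:E.
have D0 i x : (0 <= D i x)%E by rewrite lee_fin exprn_ge0 ?cmodulus_ge0.
have mD i : measurable_fun [set: R] (D i) by exact: measurable_cmodulusX.
have point x : ((cmodulus (h x - g n x) ^+ 1)%:E <=
    2%:E * \sum_(0 <= i <oo) D (i + n)%N x)%E.
  set t := (\sum_(0 <= i <oo) D (i + n)%N x)%E.
  have t0 : (0 <= t)%E by apply: nneseries_ge0 => i _ _.
  have step m : ((cmodulus (g (m + n)%N x - g n x))%:E <= t)%E.
    apply: (@le_trans _ _ (\sum_(0 <= i < m) D (i + n)%N x)%E); last first.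
      by apply: nneseries_lim_ge.
    elim: m => [|m IH]; first by rewrite big_nil add0n subrr cmodulus0.
    rewrite big_nat_recr //=; apply: le_trans (leeD2r _ IH).
    rewrite /D expr1 -EFinD lee_fin addSn [leRHS]addrC.
    by rewrite (_ : g (m + n).+1 x - g n x = (g (m + n).+1 x - g (m + n)%N x) + (g (m + n)%N x - g n x)) ?cmodulusD // addrA subrK.
  move: t0 step; case: t => [t| |] // t0 step; last by rewrite gt0_muley ?leey // lte_fin.
  rewrite expr1 -EFinM lee_fin; apply: le_trans (cmodulus_le_ReIm _) _.
  rewrite mulr_natl mulr2n; apply: lerD.
    rewrite (_ : complex.Re _ = fine (limn_esup (EFin \o (re^~ x))) - re n x); last first.
      by rewrite /h /re; case: (g n x).
    apply: limn_esup_dist_le => m nm; have := step (m - n)%N; rewrite subnK // lee_fin.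
    apply: le_trans; apply: le_trans (normr_Re_le _).
    by rewrite /re; case: (g m x) (g n x) => a b [c d].
  rewrite (_ : complex.Im _ = fine (limn_esup (EFin \o (im^~ x))) - im n x); last first.
    by rewrite /h /im; case: (g n x).
  apply: limn_esup_dist_le => m nm; have := step (m - n)%N; rewrite subnK // lee_fin.
  apply: le_trans; apply: le_trans (normr_Im_le _).
  by rewrite /im; case: (g m x) (g n x) => a b [c d].
move=> x.
have mS : measurable_fun `[x, x + 1] (fun y => \sum_(0 <= i <oo) D (i + n)%N y)%E.
  apply: measurable_funTS; apply: ge0_emeasurable_sum => // i _; exact: mD.
have S0 y : (0 <= \sum_(0 <= i <oo) D (i + n)%N y)%E by apply: nneseries_ge0 => i _ _.
apply: (@le_trans _ _ (\int[lebesgue_measure]_(y in `[x, (x + 1)%R])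
   (2%:E * \sum_(0 <= i <oo) D (i + n)%N y))%E).
  apply: ge0_le_integral => //.
  - by move=> y _; rewrite lee_fin exprn_ge0 ?cmodulus_ge0.
  - by apply: measurable_funTS; apply: measurable_cmodulusX; exact: cmeasurableB.
  - exact: emeasurable_funM.
rewrite ge0_integralZl_EFin // integral_nneseries //; last first.
  by move=> i; apply: measurable_funTS; exact: mD.
apply: (@le_trans _ _ (2%:E * (2%:E * \sum_(0 <= i <oo) ((2^-1 ^+ (i + n))%:E : \bar R)))%E).
  rewrite lee_wpmul2l ?lee_fin // -nneseriesZl; last first.
    by move=> i _; rewrite lee_fin exprn_ge0 // invr_ge0.
  apply: lee_nneseries => i _; first by move=> _; apply: integral_ge0 => y _.
  by rewrite -EFinM; exact: hg.
apply: (@le_trans _ _ (2%:E * (2%:E * (2 * 2^-1 ^+ n)%:E))%E).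
  by rewrite !lee_wpmul2l ?lee_fin // sum_half_le.
by rewrite -!EFinM lee_fin (_ : 8 = 2 * (2 * 2) :> R) -?mulrA //; ring.
Qed.

(** The errors have summable integrals, so their sum is finite, and hence they tend
    to 0, almost everywhere. *)
Lemma ae_sum_sqr_le_limn_einf (R : realType) (J : nat) (q : nat) (g : nat -> R -> R[i])
   (u : nat -> nat -> R -> R[i]) (y : R) :
  (forall j, cmeasurable (g j)) -> (forall n j, cmeasurable (u n j)) ->
  (forall n j, stepanov_bound 1 (fun x => g j x - u n j x) (8 * 2^-1 ^+ n)%:E) ->
  {ae lebesgue_measure, forall x, `[y, y + 1]%classic x ->
    ((sum_sqr J g x ^+ q)%:E <= limn_einf (fun n => (sum_sqr J (u n) x ^+ q)%:E))%E}.
Proof.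
move=> mg mu hgu.
pose E n x : R := \sum_(0 <= j < J) cmodulus (g j x - u n j x).
have E0 n x : 0 <= E n x by apply: sumr_ge0 => j _; exact: cmodulus_ge0.
have mE n : measurable_fun [set: R] (E n).
  apply: measurable_sum => j; apply: measurable_cmodulus; exact: cmeasurableB.
have iE n : (\int[lebesgue_measure]_(x in `[y, (y + 1)%R]) (E n x)%:E <=
    (J%:R * (8 * 2^-1 ^+ n))%:E)%E.
  under eq_integral => x _ do rewrite /E -sumEFin.
  rewrite ge0_integral_sum //; last 2 first.
  - move=> j; apply: measurable_funTS; apply: (measurable_cmodulusX 1); exact: cmeasurableB.
  - by move=> j x _; rewrite lee_fin cmodulus_ge0.
  apply: (@le_trans _ _ (\sum_(0 <= j < J) (8 * 2^-1 ^+ n)%:E)%E).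
    by apply: lee_sum => j _; exact: hgu.
  by rewrite sumEFin lee_fin sumr_const_nat subn0 -[leLHS]mulr_natl.
have iS : (\int[lebesgue_measure]_(x in `[y, (y + 1)%R]) (\sum_(0 <= n <oo) (E n x)%:E) < +oo)%E.
  rewrite integral_nneseries //; last 2 first.
  - by move=> n; apply: measurable_funTS; apply/measurable_EFinP; exact: mE.
  - by move=> n x _; rewrite lee_fin.
  apply: (@le_lt_trans _ _ (\sum_(0 <= n <oo) ((J%:R * 8)%:E * (2^-1 ^+ (n + 0))%:E))%E).
    apply: lee_nneseries => n _; first by move=> _; apply: integral_ge0 => x _; rewrite lee_fin.
    by rewrite -EFinM addn0 -mulrA; exact: iE.
  rewrite nneseriesZl; last by move=> i _; rewrite lee_fin exprn_ge0 // invr_ge0.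
  apply: le_lt_trans (lee_wpmul2l _ (sum_half_le R 0)) _; first by rewrite lee_fin mulr_ge0.
  by rewrite -EFinM ltry.
have mS : measurable_fun `[y, y + 1] (fun x => \sum_(0 <= n <oo) (E n x)%:E)%E.
  apply: measurable_funTS; apply: ge0_emeasurable_sum => [i x _ _|i _]; first by rewrite lee_fin.
  by apply/measurable_EFinP; exact: mE.
have S0 x : (0 <= \sum_(0 <= n <oo) (E n x)%:E)%E by apply: nneseries_ge0 => n _ _; rewrite lee_fin.
have intS : (@lebesgue_measure R).-integrable `[y, y + 1] (fun x => \sum_(0 <= n <oo) (E n x)%:E)%E.
  by apply/integrableP; split => //; under eq_integral do rewrite gee0_abs //.
have := @integrable_ae _ _ _ lebesgue_measure `[y, y + 1]%classic (measurable_itv _) _ intS.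
apply: filterS => x /[apply] finS.
have cvE : E^~ x @ \oo --> 0.
  apply: cvg_series_cvg_0; apply: nondecreasing_is_cvgn.
    by apply/nondecreasing_seqP => n; rewrite seriesSr lerDl.
  exists (fine (\sum_(0 <= n <oo) (E n x)%:E)%E) => _ [n _ <-].
  rewrite -lee_fin fineK // /series /= -sumEFin.
  by apply: nneseries_lim_ge => k _ _; rewrite lee_fin.
have cvc j : (j < J)%N -> cmodulus (u n j x) @[n --> \oo] --> cmodulus (g j x).
  move=> jJ; apply/cvgrPdist_le => e e0.
  move/cvgrPdist_le : cvE => /(_ e e0); apply: filterS => n.
  rewrite sub0r normrN ger0_norm // => hE.
  have hj : cmodulus (g j x - u n j x) <= e.
    apply: le_trans hE; rewrite /E (big_rem j) /=; last by rewrite mem_index_iota.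
    by rewrite lerDl sumr_ge0 // => i _; exact: cmodulus_ge0.
  apply: le_trans hj; rewrite ler_norml; apply/andP; split.
    rewrite lerNl opprB lerBlDr cmodulusB.
    by apply: le_trans (cmodulusD _ _); rewrite subrK.
  by rewrite lerBlDr; apply: le_trans (cmodulusD _ _); rewrite subrK.
have cvX : sum_sqr J (u n) x @[n --> \oo] --> sum_sqr J g x.
  have : (J <= J)%N by []; rewrite /sum_sqr; elim: {1 3 4}J => [|K IH] KJ.
    by under eq_fun do rewrite big_nil; rewrite big_nil; exact: cvg_cst.
  under eq_fun do rewrite big_nat_recr //=; rewrite big_nat_recr //=.
  apply: cvgD; first exact: IH (ltnW KJ).
  by rewrite expr2; under eq_fun do rewrite expr2; apply: cvgM; exact: cvc.
have cvXq : ((sum_sqr J (u n) x) ^+ q)%:E @[n --> \oo] --> ((sum_sqr J g x) ^+ q)%:E.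
  apply/cvg_EFin; first by apply: nearW.
  exact: (cvg_comp _ _ cvX (@exprn_continuous R q _)).
by rewrite (cvg_limn_einf_sup cvXq).1.
Qed.

(** * The Hilbert transform of trigonometric polynomials with a spectral gap *)

(** The modified Hilbert transform acts on a list of coefficients frequency by
    frequency. *)
Definition hilbert_trig (R : realType) (s : hsign) (P : seq (R[i] * R)) :=
  [seq (- 'i * (msgn s cl.2)%:C * cl.1, cl.2) | cl <- P].

Definition gapped (R : realType) (alpha : R) (P : seq (R[i] * R)) :=
  all (fun cl => (cl.2 == 0) || (alpha <= `|cl.2|)) P.

Lemma msgn_pm1 (R : realType) s (x : R) : (msgn s x == 1) || (msgn s x == -1).
Proof. by case: s => /=; case: ifP => _; rewrite eqxx ?orbT. Qed.

(** The two modified signs differ by the half to which the frequency 0 belongs;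
    either way the gap between the halves has length alpha. *)
Lemma gapped_halves (R : realType) (alpha : R) (s : hsign) : 0 < alpha ->
  exists a c : R, [/\ a + c = alpha,
    forall P, gapped alpha P -> all (fun cl => a <= cl.2) [seq cl <- P | msgn s cl.2 == 1] &
    forall P, gapped alpha P -> all (fun cl => cl.2 <= - c) [seq cl <- P | msgn s cl.2 != 1]].
Proof.
move=> a0; have n11 : (-1 == 1 :> R) = false by apply/eqP; lra.
case: s.
  exists 0, alpha; split; first by rewrite add0r.
    move=> P _; apply/allP => cl; rewrite mem_filter /= => /andP[+ _].
    by case: ifP => //; rewrite n11.
  move=> P /allP hP; apply/allP => cl; rewrite mem_filter /= => /andP[+ /hP].
  case: ifPn; first by rewrite eqxx.
  rewrite -ltNge => h _ /orP[/eqP h0|]; first by rewrite h0 ltxx in h.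
  by rewrite ltr0_norm // lerNr.
exists alpha, 0; split; first by rewrite addr0.
  move=> P /allP hP; apply/allP => cl; rewrite mem_filter /= => /andP[+ /hP].
  case: ifPn => [h _|_]; last by rewrite n11.
  move=> /orP[/eqP h0|]; first by rewrite h0 ltxx in h.
  by rewrite gtr0_norm.
move=> P _; apply/allP => cl; rewrite mem_filter /= oppr0 => /andP[+ _].
by case: ifPn; [rewrite eqxx|rewrite -leNgt].
Qed.

Lemma trig_poly_split (R : realType) (s : hsign) (P : seq (R[i] * R)) x :
  trig_poly P x = trig_poly [seq cl <- P | msgn s cl.2 == 1] x +
                  trig_poly [seq cl <- P | msgn s cl.2 != 1] x.
Proof. by rewrite /trig_poly !big_filter [LHS](bigID (fun cl => msgn s cl.2 == 1)). Qed.

Lemma hilbert_trig_split (R : realType) (s : hsign) (P : seq (R[i] * R)) x :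
  trig_poly (hilbert_trig s P) x = - 'i *
    (trig_poly [seq cl <- P | msgn s cl.2 == 1] x -
     trig_poly [seq cl <- P | msgn s cl.2 != 1] x).
Proof.
rewrite /trig_poly big_map !big_filter mulrBr !mulr_sumr.
rewrite (bigID (fun cl => msgn s cl.2 == 1)) /= -sumrN; congr (_ + _).
  by apply: eq_bigr => cl /eqP ->; rewrite rmorph1 mulr1 mulrA.
apply: eq_bigr => cl; have := msgn_pm1 s cl.2 => /orP[-> //|/eqP -> _].
by rewrite rmorphN rmorph1 mulrN1 !mulNr -!mulrA.
Qed.

(** [riesz_trig_local] for the two halves of the spectrum; the factor -i does not
    affect moduli. *)
Lemma hilbert_trig_bound (R : realType) (m : nat) (alpha : R) : 0 < alpha ->
  exists2 C : R, 0 < C &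
  forall (s : hsign) (P : nat -> seq (R[i] * R)) (J : nat) (M : \bar R),
  (forall j, gapped alpha (P j)) ->
  (forall y, \int[lebesgue_measure]_(x in `[y, (y + 1)%R])
     (sum_sqr J (fun j => trig_poly (P j)) x ^+ (2 ^ m))%:E <= M)%E ->
  forall y, (\int[lebesgue_measure]_(x in `[y, (y + 1)%R])
     (sum_sqr J (fun j => trig_poly (hilbert_trig s (P j))) x ^+ (2 ^ m))%:E
     <= C%:E * M)%E.
Proof.
move=> alpha0; pose b := Num.min alpha 1.
have b1 : 0 < b <= 1 by rewrite lt_min alpha0 ltr01 ge_min lexx orbT.
have [C C0 hC] := riesz_trig_local m b1; exists C => // s P J M gP hM y.
have [a [c [ac hA hB]]] := gapped_halves s alpha0.
have bac : b <= a + c by rewrite ac ge_min lexx.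
pose A j := [seq cl <- P j | msgn s cl.2 == 1].
pose B j := [seq cl <- P j | msgn s cl.2 != 1].
have := hC a c A B J M bac (fun j => hA _ (gP j)) (fun j => hB _ (gP j)) _ y.
rewrite (_ : sum_sqr J (fun j x => trig_poly (A j) x + trig_poly (B j) x) =
  sum_sqr J (fun j => trig_poly (P j))); last first.
  by apply/funext => x; apply: eq_bigr => j _; rewrite [in RHS](trig_poly_split s).
rewrite (_ : sum_sqr J (fun j x => trig_poly (A j) x - trig_poly (B j) x) =
  sum_sqr J (fun j => trig_poly (hilbert_trig s (P j)))); last first.
  apply/funext => x; apply: eq_bigr => j _; rewrite hilbert_trig_split cmodulusM.
  by rewrite cmodulusN cmodulus_i mul1r.
exact.
Qed.

Lemma sum_sqr1 (R : realType) (F : nat -> R -> R[i]) (m : nat) x :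
  sum_sqr 1 F x ^+ (2 ^ m) = cmodulus (F 0 x) ^+ (2 ^ m.+1).
Proof. by rewrite /sum_sqr big_nat1 -exprM -expnS. Qed.

(** The case of a single function, which is needed to make the transforms of
    approximants a Cauchy sequence. *)
Lemma hilbert_trig_stepanov (R : realType) (m : nat) (alpha : R) : 0 < alpha ->
  exists2 C : R, 0 < C & forall (s : hsign) (P : seq (R[i] * R)) (M : \bar R),
  gapped alpha P -> stepanov_bound (2 ^ m.+1) (trig_poly P) M ->
  stepanov_bound (2 ^ m.+1) (trig_poly (hilbert_trig s P)) (C%:E * M).
Proof.
move=> /(@hilbert_trig_bound R m)[C C0 hC]; exists C => // s P M gP hM y.
have := hC s (fun=> P) 1 M (fun=> gP) _ y.
under eq_integral do rewrite sum_sqr1; apply => z.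
by under eq_integral do rewrite sum_sqr1; exact: hM.
Qed.

Lemma hilbert_trigB (R : realType) (s : hsign) (P Q : seq (R[i] * R)) x :
  trig_poly (hilbert_trig s (P ++ [seq (- cl.1, cl.2) | cl <- Q])) x =
  trig_poly (hilbert_trig s P) x - trig_poly (hilbert_trig s Q) x.
Proof.
rewrite /hilbert_trig map_cat trig_poly_cat; congr (_ + _).
by rewrite /trig_poly !big_map -sumrN; apply: eq_bigr => cl _ /=; rewrite mulrN mulNr.
Qed.

Lemma trig_coef_hilbert (R : realType) (s : hsign) (P : seq (R[i] * R)) lambda :
  trig_coef (hilbert_trig s P) lambda = - 'i * (msgn s lambda)%:C * trig_coef P lambda.
Proof.
rewrite /trig_coef big_map mulr_sumr; apply: eq_bigr => cl /= /eqP -> //.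
Qed.

(** The transforms of consecutive approximants are close because their difference
    is the transform of a polynomial with the same gap, to which
    [hilbert_trig_stepanov] applies. *)
Lemma gapped_approx (R : realType) (m : nat) (alpha : R) (s : hsign) (f : R -> R[i]) :
  0 < alpha -> stepanov_approx (2 ^ m.+1) f ->
  (forall lambda, fourier_coef f lambda != 0 -> (lambda == 0) || (alpha <= `|lambda|)) ->
  exists P : nat -> seq (R[i] * R), forall n, [/\ gapped alpha (P n),
    stepanov_bound (2 ^ m.+1) (fun x => f x - trig_poly (P n) x) (2^-1 ^+ n)%:E,
    stepanov_bound 1 (fun x => f x - trig_poly (P n) x) (2 * 2^-1 ^+ n)%:E &
    stepanov_bound 1 (fun x => trig_poly (hilbert_trig s (P n.+1)) x -
      trig_poly (hilbert_trig s (P n)) x) (2 * 2^-1 ^+ n)%:E].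
Proof.
move=> a0 hf gf; have [mf _] := hf.
have [C C0 hC] := hilbert_trig_stepanov m a0.
set p := (2 ^ m.+1)%N in hf hC *.
have p0 : (0 < p)%N by rewrite expn_gt0.
pose th n : R := 2^-1 ^+ n.
have th0 n : 0 < th n by rewrite exprn_gt0 // invr_gt0.
have thS n : th n.+1 <= th n by rewrite /th exprS ler_piMl ?(ltW (th0 n)) //; lra.
have th1 n : th n <= 1 by apply: exprn_ile1; lra.
(* c is chosen so that d n, after the loss in [hilbert_trig_stepanov] and in the
   triangle inequality, is still below th n ^+ p. *)
pose c : R := 1 + C * (2 ^+ p * 2).
have c1 : 1 <= c by rewrite lerDl !mulr_ge0 ?exprn_ge0 // ltW.
have c0 : 0 < c by apply: lt_le_trans c1.
pose d n := th n ^+ p / c.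
have d0 n : 0 < d n by rewrite divr_gt0 ?exprn_gt0.
have dth n : d n <= th n ^+ p by rewrite ler_pdivrMr // ler_peMr // exprn_ge0 // ltW.
have dS n : d n.+1 <= d n.
  by rewrite ler_pM2r ?invr_gt0 //; apply: lerXn2r; rewrite ?nnegrE ?(ltW (th0 _)).
have exP n : exists P, gapped alpha P /\ stepanov_bound p (fun x => f x - trig_poly P x) (d n)%:E.
  rewrite -(prednK p0) in hf *; have [P hP1 hP2] := bochner_fejer hf (d0 n).
  by exists P; split => //; apply: sub_all hP1 => cl; exact: gf.
pose P n := projT1 (cid (exP n)).
have [gP bP] : (forall n, gapped alpha (P n)) /\
    (forall n, stepanov_bound p (fun x => f x - trig_poly (P n) x) (d n)%:E).
  by split => n; rewrite /P; case: cid => ? [].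
have to1 n (h : R -> R[i]) : cmeasurable h -> stepanov_bound p h (th n ^+ p)%:E ->
    stepanov_bound 1 h (2 * th n)%:E.
  move=> mh hh; apply: stepanov_boundW (stepanov_bound_to1 p0 mh (th0 n) hh).
  rewrite lee_fin (_ : _ ^- _ * _ = th n); first by rewrite -mulr2n mulr_natl.
  case: (p) p0 => // k _; rewrite /= exprSr mulrA mulVf ?mul1r //.
  by rewrite expf_neq0 // gt_eqF.
exists P => n; split => //.
- apply: stepanov_boundW (bP n); rewrite lee_fin; apply: le_trans (dth n) _.
  rewrite -[leRHS]expr1; apply: ler_wiXn2l => //; exact: ltW.
- apply: to1; first by apply: cmeasurableB => //; exact: cmeasurable_trig_poly.
  by apply: stepanov_boundW (bP n); rewrite lee_fin.
apply: to1; first by apply: cmeasurableB; exact: cmeasurable_trig_poly.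
have gPP : gapped alpha (P n.+1 ++ [seq (- cl.1, cl.2) | cl <- P n]).
  rewrite /gapped all_cat; apply/andP; split; first exact: gP.
  by rewrite all_map; exact: gP.
have md k : cmeasurable (fun x => f x - trig_poly (P k) x).
  by apply: cmeasurableB => //; exact: cmeasurable_trig_poly.
have md' : cmeasurable (fun x => - (f x - trig_poly (P n.+1) x)).
  rewrite (_ : (fun x => _) = (fun x => trig_poly (P n.+1) x - f x)).
    by apply: cmeasurableB => //; exact: cmeasurable_trig_poly.
  by apply/funext => x; rewrite opprB.
have := stepanov_boundD md' (md n) (stepanov_boundN (bP n.+1)) (bP n).
rewrite -EFinD -EFinM => hPP.
have {}hPP : stepanov_bound p (trig_poly (P n.+1 ++ [seq (- cl.1, cl.2) | cl <- P n]))
    (2 ^+ p * (d n.+1 + d n))%:E.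
  by apply: eq_stepanov_bound hPP => x; rewrite trig_poly_cat trig_poly_opp; ring.
have hH := hC s _ _ gPP hPP.
apply: (@eq_stepanov_bound _ _ (trig_poly (hilbert_trig s (P n.+1 ++ [seq (- cl.1, cl.2) | cl <- P n])))).
  by move=> x; rewrite hilbert_trigB.
apply: stepanov_boundW hH; rewrite -EFinM lee_fin.
apply: (@le_trans _ _ (C * (2 ^+ p * 2) * d n)).
  rewrite -!mulrA ler_wpM2l ?(ltW C0) // ler_wpM2l ?exprn_ge0 //.
  by have := dS n; lra.
rewrite /d mulrA ler_pdivrMr // mulrC ler_wpM2l ?exprn_ge0 ?(ltW (th0 n)) //.
by rewrite /c lerDr.
Qed.

(** * Passage to the limit *)

Lemma half_pow_small (R : realType) (e : R) : 0 < e -> exists n, 2^-1 ^+ n <= e.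
Proof.
move=> e0; pose n := (Num.truncn e^-1).+1; exists n.
have h : e^-1 < n%:R by exact: truncnS_gt.
have h2 : n%:R <= 2 ^+ n :> R by rewrite -natrX ler_nat ltnW // ltn_expl.
rewrite exprVn -[leRHS]invrK lef_pV2 ?posrE ?exprn_gt0 ?invr_gt0 //.
exact: le_trans (ltW h) h2.
Qed.

Lemma cmodulus_geometric_eq0 (R : realType) (z : R[i]) (K : R) :
  (forall n, cmodulus z <= K * 2^-1 ^+ n) -> z = 0.
Proof.
move=> hz; apply: Normc.eq0_normc; apply/eqP.
rewrite eq_le (cmodulus_ge0 z) andbT; apply/ler_addgt0Pr => e e0; rewrite add0r.
have K0 : 0 <= K by have := hz 0%N; rewrite expr0 mulr1; apply: le_trans; exact: cmodulus_ge0.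
have K1 : 0 < K + 1 by rewrite ltr_wpDl.
have [n hn] := half_pow_small (divr_gt0 e0 K1).
apply: le_trans (hz n) _; rewrite ler_pdivlMr // in hn; apply: le_trans hn.
by rewrite mulrC ler_wpM2l ?exprn_ge0 ?invr_ge0 // lerDl.
Qed.

(** The Fourier coefficients are continuous for the norm of exponent 1, so the
    relation between those of P n and of its transform passes to the limit. *)
Lemma hilbert_limit (R : realType) (s : hsign) (f : R -> R[i])
    (P : nat -> seq (R[i] * R)) :
  stepanov_approx 1 f ->
  (forall n, stepanov_bound 1 (fun x => f x - trig_poly (P n) x) (2 * 2^-1 ^+ n)%:E) ->
  (forall n, stepanov_bound 1 (fun x => trig_poly (hilbert_trig s (P n.+1)) x -
      trig_poly (hilbert_trig s (P n)) x) (2 * 2^-1 ^+ n)%:E) ->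
  exists2 h, is_modified_hilbert s f h & forall n,
    stepanov_bound 1 (fun x => h x - trig_poly (hilbert_trig s (P n)) x) (8 * 2^-1 ^+ n)%:E.
Proof.
move=> hf fP HP.
have [h mh hh] := stepanov_complete (fun n => cmeasurable_trig_poly (hilbert_trig s (P n))) HP.
have ah : stepanov_approx 1 h.
  split=> // e e0.
  have [n hn] := half_pow_small (divr_gt0 e0 (ltr0n R 8)).
  exists (hilbert_trig s (P n)); apply: stepanov_boundW (hh n).
  by rewrite lee_fin mulrC -ler_pdivlMr.
exists h => //; split.
  by rewrite -[1]/(1%:R); apply/stepanov_spaceE.
move=> lambda; apply/eqP; rewrite -subr_eq0; apply/eqP.
(* 30 = 3 * 8 + 3 * 2: the errors of h and of f, each with the constant of
   [fourier_coef_le]. *)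
apply: (@cmodulus_geometric_eq0 _ _ 30) => n.
pose c : R[i] := - 'i * (msgn s lambda)%:C.
have cc : cmodulus c = 1.
  rewrite /c cmodulusM cmodulusN cmodulus_i mul1r cmodulus_real.
  by have := msgn_pm1 s lambda => /orP[/eqP ->|/eqP ->]; rewrite ?normrN normr1.
have aT (Q : seq (R[i] * R)) := @stepanov_approx_trig R 1 Q isT.
have h1 := fourier_coef_le lambda (stepanov_approxB ah (aT (hilbert_trig s (P n)))) (hh n).
rewrite (fourier_coefB _ ah (aT _)) fourier_coef_trig trig_coef_hilbert -/c in h1.
have h2 := fourier_coef_le lambda (stepanov_approxB hf (aT (P n))) (fP n).
rewrite (fourier_coefB _ hf (aT _)) fourier_coef_trig in h2.
rewrite -/c (_ : _ - _ = (fourier_coef h lambda - c * trig_coef (P n) lambda) -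
  c * (fourier_coef f lambda - trig_coef (P n) lambda)); last first.
  move: (fourier_coef h _) (fourier_coef f _) (trig_coef _ _) => u v w; ring.
apply: le_trans (cmodulusD _ _) _; rewrite cmodulusN cmodulusM cc mul1r; lra.
Qed.

Lemma modified_hilbert_approx (R : realType) (s : hsign) (f g : R -> R[i]) :
  is_modified_hilbert s f g -> stepanov_approx 1 g.
Proof. by move=> [h _]; apply/(stepanov_spaceE g (ltn0Sn 0)). Qed.

(** Two modified Hilbert transforms agree almost everywhere, by
    [stepanov_unique].  The index is shifted to compensate the constant 2 lost in
    [stepanov_boundD]. *)
Lemma hilbert_limit_unique (R : realType) (s : hsign) (f g h : R -> R[i])
    (P : nat -> seq (R[i] * R)) :
  is_modified_hilbert s f g -> is_modified_hilbert s f h ->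
  (forall n, stepanov_bound 1 (fun x => h x - trig_poly (hilbert_trig s (P n)) x) (8 * 2^-1 ^+ n)%:E) ->
  forall n, stepanov_bound 1 (fun x => g x - trig_poly (hilbert_trig s (P n.+1)) x) (8 * 2^-1 ^+ n)%:E.
Proof.
move=> Hg Hh hP n; have ag := modified_hilbert_approx Hg.
have ah := modified_hilbert_approx Hh; have [_ cg] := Hg; have [_ ch] := Hh.
have agh := stepanov_approxB ag ah.
have gh0 : stepanov_bound 1 (fun x => g x - h x) 0%:E.
  move=> x; under eq_integral do rewrite expr1.
  rewrite (stepanov_unique agh) // => lambda.
  by rewrite (fourier_coefB _ ag ah) cg ch subrr.
have mh : cmeasurable (fun x => h x - trig_poly (hilbert_trig s (P n.+1)) x).
  by apply: cmeasurableB; [case: ah|exact: cmeasurable_trig_poly].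
have mgh : cmeasurable (fun x => g x - h x) by case: agh.
have := stepanov_boundD mgh mh gh0 (hP n.+1).
move=> H; apply: (@eq_stepanov_bound _ _ (fun x => (g x - h x) + (h x - trig_poly (hilbert_trig s (P n.+1)) x))).
  by move=> x; rewrite addrA subrK.
apply: stepanov_boundW H; rewrite add0e -EFinM lee_fin expr1 exprS le_eqVlt.
by apply/orP; left; apply/eqP; field.
Qed.

Lemma sum_pow_le (R : realType) (q : nat) (z : nat -> R) (J : nat) : (0 < q)%N ->
  (forall j, 0 <= z j) ->
  (\sum_(0 <= j < J) z j) ^+ q <= (2 ^+ q) ^+ J * \sum_(0 <= j < J) z j ^+ q.
Proof.
move=> q0 z0; elim: J => [|J IH]; first by rewrite !big_nil expr0n (gtn_eqF q0) mulr0.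
have S0 : 0 <= \sum_(0 <= j < J) z j ^+ q by apply: sumr_ge0 => j _; exact: exprn_ge0.
have T1 : 1 <= (2 ^+ q) ^+ J :> R by rewrite exprn_ege1 // exprn_ege1 // ler1n.
rewrite !big_nat_recr //=; apply: le_trans (powD_le q _ _) _ => //.
  exact: sumr_ge0.
rewrite exprS -mulrA ler_wpM2l ?exprn_ge0 // mulrDr; apply: lerD => //.
by rewrite ler_peMl // exprn_ge0.
Qed.

(** The approximants satisfy the bound by [hilbert_trig_bound], their transforms
    converge almost everywhere by [ae_sum_sqr_le_limn_einf], and Fatou's lemma
    concludes.  The number J of functions affects the error of approximation, which
    tends to 0, but not the constant C. *)
Lemma vector_hilbert_bound (R : realType) (m : nat) (alpha : R) : 0 < alpha ->
  exists2 C : R, 0 < C &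
  forall (s : hsign) (f g : nat -> R -> R[i]) (J : nat) (A : R),
  (forall j, stepanov_approx (2 ^ m.+1) (f j)) ->
  (forall j lambda, fourier_coef (f j) lambda != 0 -> (lambda == 0) || (alpha <= `|lambda|)) ->
  (forall j, is_modified_hilbert s (f j) (g j)) ->
  (forall y, \int[lebesgue_measure]_(x in `[y, (y + 1)%R])
     (sum_sqr J f x ^+ (2 ^ m))%:E <= A%:E)%E ->
  forall y, (\int[lebesgue_measure]_(x in `[y, (y + 1)%R])
     (sum_sqr J g x ^+ (2 ^ m))%:E <= (C * A)%:E)%E.
Proof.
move=> a0; have [C C0 hC] := hilbert_trig_bound m a0.
set q := (2 ^ m)%N in hC *; have q0 : (0 < q)%N by rewrite expn_gt0.
(* 4 ^+ q comes from two triangle inequalities: one for the square function, one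
   for its q-th power. *)
exists (C * 4 ^+ q); first by rewrite mulr_gt0 ?exprn_gt0.
move=> s f g J A hf gapf hg hA y.
have f1 j : stepanov_approx 1 (f j) by apply: stepanov_approx_to1 (hf j); rewrite expn_gt0.
have mf j : cmeasurable (f j) by case: (hf j).
have mg j : cmeasurable (g j).
  by have [] := modified_hilbert_approx (hg j).
pose P j := projT1 (cid (gapped_approx s a0 (hf j) (gapf j))).
have hP j n : [/\ gapped alpha (P j n),
    stepanov_bound (2 ^ m.+1) (fun x => f j x - trig_poly (P j n) x) (2^-1 ^+ n)%:E,
    stepanov_bound 1 (fun x => f j x - trig_poly (P j n) x) (2 * 2^-1 ^+ n)%:E &
    stepanov_bound 1 (fun x => trig_poly (hilbert_trig s (P j n.+1)) x -
      trig_poly (hilbert_trig s (P j n)) x) (2 * 2^-1 ^+ n)%:E].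
  by rewrite /P; case: cid => Q /= /(_ n).
pose u n j := trig_poly (hilbert_trig s (P j n.+1)).
have hgu n j : stepanov_bound 1 (fun x => g j x - u n j x) (8 * 2^-1 ^+ n)%:E.
  have [h hh1 hh2] := @hilbert_limit _ s (f j) (P j) (f1 j)
    (fun n => let: And4 _ _ h _ := hP j n in h) (fun n => let: And4 _ _ _ h := hP j n in h).
  exact: (hilbert_limit_unique (hg j) hh1 hh2).
have mu n j : cmeasurable (u n j) by exact: cmeasurable_trig_poly.
have A0 : 0 <= A.
  rewrite -lee_fin; apply: le_trans (hA 0); apply: integral_ge0 => x _.
  by rewrite lee_fin exprn_ge0 ?sum_sqr_ge0.
(* J enters only here, in front of an error that tends to 0 with n. *)
pose K : R := (2 ^+ q) ^+ J * J%:R.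
have K0 : 0 <= K by rewrite mulr_ge0 ?exprn_ge0.
have bY n z : (\int[lebesgue_measure]_(x in `[z, (z + 1)%R])
     (sum_sqr J (fun j => trig_poly (P j n.+1)) x ^+ q)%:E <= (4 ^+ q * (A + K * 2^-1 ^+ n))%:E)%E.
  pose Z x := sum_sqr J (fun j x => f j x - trig_poly (P j n.+1) x) x.
  have mZj j : cmeasurable (fun x => f j x - trig_poly (P j n.+1) x).
    by apply: cmeasurableB => //; exact: cmeasurable_trig_poly.
  have mZ : measurable_fun [set: R] Z by exact: measurable_sum_sqr.
  have mF : measurable_fun [set: R] (sum_sqr J f) by exact: measurable_sum_sqr.
  have mq (h : R -> R) : measurable_fun [set: R] h ->
      measurable_fun `[z, z + 1] (fun x => (h x ^+ q)%:E).
    by move=> mh; apply: measurable_funTS; apply/measurable_EFinP; exact: measurable_funX.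
  have iZ : (\int[lebesgue_measure]_(x in `[z, (z + 1)%R]) (Z x ^+ q)%:E <= (K * 2^-1 ^+ n)%:E)%E.
    apply: (@le_trans _ _ (\int[lebesgue_measure]_(x in `[z, (z + 1)%R])
       (((2 ^+ q) ^+ J)%:E * \sum_(0 <= j < J)
         (cmodulus (f j x - trig_poly (P j n.+1) x) ^+ (2 ^ m.+1))%:E))%E).
      apply: ge0_le_integral => //.
      - by move=> x _; rewrite lee_fin exprn_ge0 ?sum_sqr_ge0.
      - exact: mq.
      - apply: emeasurable_funM => //; apply: emeasurable_sum => j.
        by apply: measurable_funTS; exact: measurable_cmodulusX.
      move=> x _; rewrite sumEFin -EFinM lee_fin.
      apply: le_trans (sum_pow_le _ q0 _) _; first by move=> j; exact: sqr_ge0.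
      rewrite ler_wpM2l ?exprn_ge0 //; apply: ler_sum => j _.
      by rewrite -exprM -expnS.
    rewrite ge0_integralZl_EFin ?exprn_ge0 //; last 2 first.
    - by move=> x _; apply: sume_ge0 => j _; rewrite lee_fin exprn_ge0 ?cmodulus_ge0.
    - apply: emeasurable_sum => j.
      by apply: measurable_funTS; exact: measurable_cmodulusX.
    rewrite ge0_integral_sum //; last 2 first.
    - by move=> j; apply: measurable_funTS; exact: measurable_cmodulusX.
    - by move=> j x _; rewrite lee_fin exprn_ge0 ?cmodulus_ge0.
    apply: (@le_trans _ _ (((2 ^+ q) ^+ J)%:E * \sum_(0 <= j < J) (2^-1 ^+ n)%:E)%E).
      rewrite lee_wpmul2l ?lee_fin ?exprn_ge0 //; apply: lee_sum => j _.
      have [_ h _ _] := hP j n.+1; apply: le_trans (h z) _.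
      by rewrite lee_fin exprS ler_piMl ?exprn_ge0 ?invr_ge0 // invf_le1 // ler1n.
    rewrite sumEFin -EFinM lee_fin sumr_const_nat subn0 /K -mulrA.
    by rewrite [J%:R * _]mulr_natl.
  apply: (@le_trans _ _ (\int[lebesgue_measure]_(x in `[z, (z + 1)%R])
     ((4 ^+ q)%:E * ((sum_sqr J f x ^+ q)%:E + (Z x ^+ q)%:E)))%E).
    apply: ge0_le_integral => //.
    - by move=> x _; rewrite lee_fin exprn_ge0 ?sum_sqr_ge0.
    - by apply: mq; apply: measurable_sum_sqr => j; exact: cmeasurable_trig_poly.
    - by apply: emeasurable_funM => //; apply: emeasurable_funD; exact: mq.
    move=> x _; rewrite -EFinD -EFinM lee_fin.
    have hx : sum_sqr J (fun j => trig_poly (P j n.+1)) x <= 2 * (sum_sqr J f x + Z x).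
      rewrite /Z /sum_sqr -big_split /= mulr_sumr; apply: ler_sum => j _.
      apply: le_trans (_ : _ <= (cmodulus (f j x) + cmodulus (f j x - trig_poly (P j n.+1) x)) ^+ 2) _.
        apply: lerXn2r; rewrite ?nnegrE ?addr_ge0 ?cmodulus_ge0 //.
        rewrite -[X in _ <= _ + X]cmodulusN; apply: le_trans (cmodulusD _ _).
        by rewrite opprB addrC subrK.
      have := sqr_ge0 (cmodulus (f j x) - cmodulus (f j x - trig_poly (P j n.+1) x)).
      by rewrite sqrrB sqrrD; lra.
    apply: (@le_trans _ _ ((2 * (sum_sqr J f x + Z x)) ^+ q)).
      by apply: lerXn2r => //; rewrite nnegrE ?mulr_ge0 ?addr_ge0 ?sum_sqr_ge0.
    rewrite exprMn (_ : 4 = 2 * 2 :> R) ?exprMn -?mulrA; last by ring.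
    by rewrite ler_wpM2l ?exprn_ge0 //; apply: powD_le; exact: sum_sqr_ge0.
  rewrite ge0_integralZl_EFin ?exprn_ge0 //; last 2 first.
  - by move=> x _; rewrite -EFinD lee_fin addr_ge0 ?exprn_ge0 ?sum_sqr_ge0.
  - by apply: emeasurable_funD; exact: mq.
  rewrite EFinM lee_wpmul2l ?lee_fin ?exprn_ge0 // ge0_integralD //; last 4 first.
  - by move=> x _; rewrite lee_fin exprn_ge0 ?sum_sqr_ge0.
  - exact: mq.
  - by move=> x _; rewrite lee_fin exprn_ge0 ?sum_sqr_ge0.
  - exact: mq.
  by rewrite EFinD; apply: leeD.
have bX n : (\int[lebesgue_measure]_(x in `[y, (y + 1)%R])
     (sum_sqr J (u n) x ^+ q)%:E <= (C * (4 ^+ q * (A + K * 2^-1 ^+ n)))%:E)%E.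
  rewrite EFinM; apply: hC; last exact: bY.
  by move=> j; have [] := hP j n.+1.
have mqX (h : nat -> R -> R[i]) : (forall j, cmeasurable (h j)) ->
    measurable_fun `[y, y + 1] (fun x => (sum_sqr J h x ^+ q)%:E).
  move=> mh; apply: measurable_funTS; apply/measurable_EFinP; apply: measurable_funX.
  exact: measurable_sum_sqr.
apply: (@le_trans _ _ (\int[lebesgue_measure]_(x in `[y, (y + 1)%R])
    limn_einf (fun n => (sum_sqr J (u n) x ^+ q)%:E))%E).
  apply: ae_ge0_le_integral => //.
  - by move=> x _; rewrite lee_fin exprn_ge0 ?sum_sqr_ge0.
  - exact: mqX.
  - move=> x _; apply: (@limn_einf_ge _ _ 0%N) => n _.
    by rewrite lee_fin exprn_ge0 ?sum_sqr_ge0.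
  - rewrite /limn_einf; apply: measurableT_comp => //.
    by apply: measurable_fun_limn_esup => n; apply: measurableT_comp => //; exact: mqX.
  - exact: ae_sum_sqr_le_limn_einf.
apply: le_trans (fatou _ _ _ _) _ => //.
- by move=> n; exact: mqX.
- by move=> n x _; rewrite lee_fin exprn_ge0 ?sum_sqr_ge0.
apply/lee_addgt0Pr => e e0.
have c4 : 0 < C * 4 ^+ q by rewrite mulr_gt0 ?exprn_gt0.
have K1 : 0 < C * 4 ^+ q * (K + 1) by rewrite mulr_gt0 // ltr_wpDl.
have [N hN] := half_pow_small (divr_gt0 e0 K1).
apply: le_trans (limn_einf_sup _) _.
apply: (@limn_esup_le _ _ N) => n Nn; apply: le_trans (bX n) _.
rewrite -EFinD lee_fin !mulrA [_ * (A + _)]mulrDr lerD2l.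
have hn : 2^-1 ^+ n <= 2^-1 ^+ N :> R.
  by apply: ler_wiXn2l => //; rewrite ?invr_ge0 // invf_le1 // ler1n.
have {}hN := le_trans hn hN; rewrite ler_pdivlMr // in hN.
apply: le_trans hN; rewrite mulrA mulrC ler_wpM2l ?exprn_ge0 ?invr_ge0 //.
by rewrite ler_wpM2l ?(ltW c4) // lerDl.
Qed.

(** * The infinite square function *)

(** Since 0 is the exponent of index 0 and the enumeration is increasing, the
    smallest positive exponent, of index 1, exceeds alpha; symmetry gives the negative
    ones. *)
Lemma separation_gap (R : realType) (alpha : R) (f : R -> R[i]) : 0 < alpha ->
  separation_condition alpha f ->
  forall lambda, fourier_coef f lambda != 0 -> (lambda == 0) || (alpha <= `|lambda|).
Proof.
move=> a0 [ o [ lam [[lamI lamN lamE] sep]]] l fl.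
have idx0 : exponent_index o 0 by case: (o) => //= N; rewrite normr0.
have idx1 n : 0 < n -> exponent_index o n -> exponent_index o 1.
  case: (o) => //= N n0; rewrite normr1 gtr0_norm // => h.
  by apply: le_trans h; rewrite -gtz0_ge1.
have idxN n : exponent_index o n -> exponent_index o (- n).
  by case: (o) => //= N; rewrite normrN.
have lam0 : lam 0 = 0.
  have := lamN 0 idx0; rewrite oppr0 => /eqP; rewrite -subr_eq0 opprK -mulr2n mulrn_eq0 /=.
  by move/eqP.
have pos n : 0 < n -> exponent_index o n -> alpha < lam n.
  move=> n0 hn; have h1 := idx1 n n0 hn.
  have := sep 0 idx0; rewrite add0r => /(_ h1); rewrite lam0 subr0 => h.
  have : 1 <= n by rewrite -gtz0_ge1.
  rewrite le_eqVlt => /orP[/eqP <- //|n1]; exact: lt_trans h (lamI _ _ h1 hn n1).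
have : fourier_spectrum f l by right; left; apply/eqP.
rewrite -lamE => -[n hn <-].
have [n0|n0|<-] := ltgtP 0 n.
- by apply/orP; right; apply: le_trans (ler_norm _); apply: ltW; exact: pos.
- have := pos (- n); rewrite oppr_gt0 => /(_ n0 (idxN n hn)); rewrite lamN // => h.
  by apply/orP; right; rewrite -normrN; apply: le_trans (ler_norm _); exact: ltW.
- by rewrite lam0 eqxx.
Qed.

Lemma poweR_limn (R : realType) (q : nat) (a : nat -> R) : (0 < q)%N ->
  (forall j, 0 <= a j) ->
  ((\sum_(0 <= j <oo) (a j)%:E) `^ q%:R)%E =
  limn (fun J => ((\sum_(0 <= j < J) a j) ^+ q)%:E).
Proof.
move=> q0 a0; set S := (\sum_(0 <= j <oo) _)%E.
have nd : nondecreasing_seq (fun J => \sum_(0 <= j < J) a j).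
  by apply/nondecreasing_seqP => J; rewrite big_nat_recr //= lerDl.
have cS : (\sum_(0 <= j < J) a j)%:E @[J --> \oo] --> S.
  under eq_fun do rewrite -sumEFin.
  by apply: is_cvg_nneseries => j _ _; rewrite lee_fin.
have S0 : (0 <= S)%E by apply: nneseries_ge0 => j _ _; rewrite lee_fin.
apply/esym/cvg_lim => //; move: S0 cS; case: S => [r| |] // r0 cS.
- rewrite poweR_EFin powR_mulrn //.
  apply/cvg_EFin; first by apply: nearW.
  exact: (cvg_comp _ _ (fine_cvg cS) (@exprn_continuous R q r)).
- rewrite poweRyr ?pnatr_eq0 -?lt0n //; apply/cvgeryP/cvgryPge => M.
  move/cvgeryP/cvgryPge : cS => /(_ (Num.max 1 M)); apply: filterS => J.
  rewrite ge_max => /andP[h1 h2]; apply: le_trans h2 _.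
  by rewrite -[leLHS]expr1; apply: ler_weXn2l.
Qed.

Lemma square_function_pow (R : realType) (m : nat) (f : nat -> R -> R[i]) x :
  (square_function f x `^ (2 ^+ m.+1))%E =
  limn (fun J => (sum_sqr J f x ^+ (2 ^ m))%:E).
Proof.
rewrite /square_function -poweRrM exprS mulrA mulVf // mul1r -natrX poweR_limn ?expn_gt0 //.
by move=> j; exact: sqr_ge0.
Qed.

Lemma sum_sqr_pow_nd (R : realType) (q : nat) (f : nat -> R -> R[i]) x :
  {homo (fun J => (sum_sqr J f x ^+ q)%:E : \bar R) : n m / (n <= m)%N >-> (n <= m)%E}.
Proof.
apply/nondecreasing_seqP => J; rewrite lee_fin; apply: lerXn2r.
- by rewrite nnegrE sum_sqr_ge0.
- by rewrite nnegrE sum_sqr_ge0.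
- by rewrite /sum_sqr big_nat_recr //= lerDl sqr_ge0.
Qed.

(** The separation condition places the Fourier exponents in the set covered by
    [vector_hilbert_bound], which bounds the partial sums of the square function
    uniformly; they increase to the full one. *)
Theorem theorem3p4 (R : realType) (k : nat) (hk : (0 < k)%N)
    (alpha : R) (halpha : 0 < alpha) :
  exists2 C : R, 0 < C &
    forall (s : hsign) (f : nat -> R -> R[i]),
      (forall j, stepanov_space (2 ^+ k) (f j)) ->
      (forall j, separation_condition alpha (f j)) ->
      (forall j, exists g : R -> R[i], is_modified_hilbert s (f j) g) /\
      (forall Hf : nat -> R -> R[i],
         (forall j, is_modified_hilbert s (f j) (Hf j)) ->
         (stepanov_norm (2 ^+ k) (square_function Hf)
            <= C%:E * stepanov_norm (2 ^+ k) (square_function f))%E).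
Proof.
case: k hk => // m _.
have [C C0 hC] := vector_hilbert_bound m halpha.
pose p : R := 2 ^+ m.+1; have p0 : 0 < p by rewrite exprn_gt0.
exists (C `^ p^-1); first by rewrite powR_gt0.
move=> s f hf hsep.
have af j : stepanov_approx (2 ^ m.+1) (f j).
  by apply/stepanov_spaceE; rewrite ?expn_gt0 // natrX; exact: hf.
have gap j := separation_gap halpha (hsep j).
split=> [j|g hg].
  have [P hP] := gapped_approx s halpha (af j) (gap j).
  have f1 : stepanov_approx 1 (f j) by apply: stepanov_approx_to1 (af j); rewrite expn_gt0.
  have [h hh _] := hilbert_limit f1 (fun n => let: And4 _ _ h _ := hP n in h)
    (fun n => let: And4 _ _ _ h := hP n in h).
  by exists h.
have mf j : cmeasurable (f j) by case: (af j).
have mg j : cmeasurable (g j) by have [] := modified_hilbert_approx (hg j).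
have mq (h : nat -> R -> R[i]) J (y : R) : (forall j, cmeasurable (h j)) ->
    measurable_fun `[y, y + 1] (fun x => (sum_sqr J h x ^+ (2 ^ m))%:E).
  move=> mh; apply: measurable_funTS; apply/measurable_EFinP; apply: measurable_funX.
  exact: measurable_sum_sqr.
have q0 (h : nat -> R -> R[i]) J x : (0 <= (sum_sqr J h x ^+ (2 ^ m))%:E)%E.
  by rewrite lee_fin exprn_ge0 ?sum_sqr_ge0.
have mono (h : nat -> R -> R[i]) y : (forall j, cmeasurable (h j)) ->
    (\int[@lebesgue_measure R]_(x in `[y, (y + 1)%R]) (square_function h x `^ p) =
     limn (fun J => \int[@lebesgue_measure R]_(x in `[y, (y + 1)%R])
       (sum_sqr J h x ^+ (2 ^ m))%:E))%E.
  move=> mh; rewrite -monotone_convergence //; last 2 first.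
  - by move=> J; exact: mq.
  - by move=> x _; exact: sum_sqr_pow_nd.
  by apply: eq_integral => x _; exact: square_function_pow.
have ndI (h : nat -> R -> R[i]) y : (forall j, cmeasurable (h j)) ->
    nondecreasing_seq (fun J => \int[@lebesgue_measure R]_(x in `[y, (y + 1)%R])
       (sum_sqr J h x ^+ (2 ^ m))%:E)%E.
  move=> mh a b ab; apply: ge0_le_integral => //; [exact: mq|exact: mq|].
  by move=> x _; exact: sum_sqr_pow_nd.
rewrite /stepanov_norm -/p; set A := ereal_sup (range (fun x : R =>
  \int[@lebesgue_measure R]_(s in `[x, (x + 1)%R]) (square_function f s `^ p)))%E.
have hA J y : (\int[@lebesgue_measure R]_(x in `[y, (y + 1)%R])
       (sum_sqr J f x ^+ (2 ^ m))%:E <= A)%E.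
  apply: (@le_trans _ _ (\int[@lebesgue_measure R]_(x in `[y, (y + 1)%R])
     (square_function f x `^ p))%E); last by apply: ereal_sup_ubound; exists y.
  rewrite mono // (cvg_lim _ (ereal_nondecreasing_cvgn (ndI f y mf))) //.
  by apply: ereal_sup_ubound; exists J.
have A0 : (0 <= A)%E by apply: le_trans (hA 0%N 0); exact: integral_ge0.
move: A0 hA; case: A => [r| |] // r0 hA; last first.
  by rewrite poweRyr ?invr_eq0 ?gt_eqF // gt0_muley ?leey // lte_fin powR_gt0.
rewrite poweR_EFin -EFinM -powRM ?(ltW C0) // -poweR_EFin.
apply: le_poweR; first by rewrite invr_ge0 ltW.
  apply: le_trans (ereal_sup_ubound _); last by exists 0.
  by apply: integral_ge0 => x _; exact: poweR_ge0.
apply: ge_ereal_sup => _ [y _ <-]; rewrite mono //.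
apply: lime_le; first exact: ereal_nondecreasing_is_cvgn (ndI g y mg).
by apply: nearW => J; exact: (hC s f g J r af gap hg (hA J)).
Qed.
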